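(* Let $\boldsymbol{k}\in\mathbb{Z}_+^m$ be a partition of $n$ with $m\geq 2$, let $j\in\{1,\dots,m\}$ and $\lambda>-1$ be given. Let $a\in L^\infty(\mathbb{B}^n)$ be a $(\boldsymbol{k},j)$-quasi-radial quasi-homogeneous symbol, and let $f\in L^\infty(\tau(\mathbb{B}^m)\times\mathbb{S}^{k_j})$ be the corresponding function, i.e. $f(r,\eta\xi)=f(r,\xi)$ for every $r\in\tau(\mathbb{B}^m)$, $\xi\in\mathbb{S}^{k_j}$, $\eta\in\mathbb{T}$, and $a(z)=f(|z_{(1)}|,\dots,|z_{(m)}|,\xi_{(j)})$ for almost every $z\in\mathbb{B}^n$. Then, for every $\boldsymbol{\kappa}\in\mathbb{N}^m$, the coefficients of the linear map $(T_a^{(\lambda)})_{\boldsymbol{\kappa},j}$ are given by \[ \begin{aligned} \langle T_a^{(\lambda)}(e_\alpha),e_\beta\rangle_\lambda = {}& \frac{2^{m-1}\,\Gamma(n+\lambda+|\boldsymbol{\kappa}|+1)}{\pi^{k_j}\,\Gamma(\lambda+1)\sqrt{\alpha_{(j)}!\,\beta_{(j)}!}\prod_{l\neq j}(k_l+\kappa_l-1)!} \\ &\times\int_{\tau(\mathbb{B}^m)\times\mathbb{S}^{k_j}} f(r,\xi_{(j)})\,{\xi_{(j)}}^{\alpha_{(j)}}\,{\overline{\xi}_{(j)}}^{\beta_{(j)}}\,(1-|r|^2)^\lambda\prod_{l=1}^m r_l^{2k_l+2\kappa_l-1}\,dr_l\,d\xi_{(j)} \end{aligned} \] for every $\alpha,\beta\in\mathbb{N}^n$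 such that $|\alpha_{(l)}|=|\beta_{(l)}|=\kappa_l$ for all $l=1,\dots,m$ and that satisfy $\alpha_{\widehat{(j)}}=\beta_{\widehat{(j)}}$.
   Context: Here $\mathbb{N}=\{0,1,2,\dots\}$, $\mathbb{Z}_+$ is the set of positive integers, $\mathbb{R}_+=[0,\infty)$, $|\boldsymbol{\kappa}|=\kappa_1+\dots+\kappa_m$, and $\tau(\mathbb{B}^m)=\{r\in\mathbb{R}_+^m : |r|<1\}$ with $|r|$ the Euclidean norm. $\mathbb{B}^n$ is the open unit ball of $\mathbb{C}^n$ with Lebesgue measure $v$. For $\lambda>-1$, $dv_\lambda(z) = c_\lambda (1-|z|^2)^\lambda dv(z)$ with $c_\lambda = \frac{\Gamma(n+\lambda+1)}{\pi^n\Gamma(\lambda+1)}$, and $\mathcal{A}^2_\lambda(\mathbb{B}^n)$ is the closed subspace of holomorphic functions in $L^2(\mathbb{B}^n,v_\lambda)$, with inner product $\langle\cdot,\cdot\rangle_\lambda$ and orthogonal projection $B_\lambda$. For $a\in L^\infty(\mathbb{B}^n)$ the Toeplitz operator is $T_a^{(\lambda)}(f)=B_\lambda(af)$ on $\mathcal{A}^2_\lambda(\mathbb{B}^n)$. The canonical orthonormal monomial basis of $\mathcal{A}^2_\lambda(\mathbb{B}^n)$ is $e_\alpha(z)=\sqrt{\frac{\Gamma(n+\lambda+|\alpha|+1)}{\alpha!\,\Gamma(n+\lambda+1)}}\,z^\alpha$, $\alpha\in\mathbb{N}^n$. A partition of $n$ is $\boldsymbol{k}=(k_1,\dots,k_m)\in\mathbb{Z}_+^m$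 with $k_1+\dots+k_m=n$. It gives $\mathbb{C}^n=\mathbb{C}^{k_1}\times\dots\times\mathbb{C}^{k_m}$, $z=(z_{(1)},\dots,z_{(m)})$ and, for multi-indices, $\alpha=(\alpha_{(1)},\dots,\alpha_{(m)})\in\mathbb{N}^n$ with $\alpha_{(l)}\in\mathbb{N}^{k_l}$. Write $z_{\widehat{(j)}}$, $\alpha_{\widehat{(j)}}$ for the tuples obtained from $z$, $\alpha$ by deleting the $j$-th block. $\mathbb{S}^{k_j}$ denotes the unit sphere in $\mathbb{C}^{k_j}$ (of real dimension $2k_j-1$), $d\xi_{(j)}$ the measure on it coming from the Riemannian structure inherited from $\mathbb{C}^{k_j}$, and $z_{(j)}=|z_{(j)}|\xi_{(j)}$ with $\xi_{(j)}\in\mathbb{S}^{k_j}$. A symbol $a\in L^\infty(\mathbb{B}^n)$ is $(\boldsymbol{k},j)$-quasi-radial quasi-homogeneous if $a\circ A=a$ for all $A$ in the block diagonal subgroup $\mathrm{U}(\boldsymbol{k},j,\mathbb{T})=\mathrm{U}(k_1)\times\dots\times\mathrm{U}(k_{j-1})\times\mathbb{T}I_{(j)}\times\mathrm{U}(k_{j+1})\times\dots\times\mathrm{U}(k_m)$ of $\mathrm{U}(n)$, $I_{(j)}$ being the identity of $\mathbb{C}^{k_j}$; this is equivalent to the existence of a function $f$ as in the claim. For such $a$ and $\boldsymbol{\kappa}\in\mathbb{N}^m$, $T_a^{(\lambda)}$ preserves each subspace ${z_{\widehat{(j)}}}^{\gamma}\mathcal{P}_{\kappa_j}(\mathbb{C}^{k_j})$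 with $\gamma\in\mathbb{N}^{n-k_j}$, $|\gamma_{(l)}|=\kappa_l$ for $l\neq j$ (here $\mathcal{P}_{\kappa_j}(\mathbb{C}^{k_j})$ is the space of homogeneous polynomials of degree $\kappa_j$ in $z_{(j)}$), and under the natural identifications ${z_{\widehat{(j)}}}^{\gamma}p(z_{(j)})\leftrightarrow p$ it acts on all of them by one and the same linear map, denoted $(T_a^{(\lambda)})_{\boldsymbol{\kappa},j}\in\mathrm{End}(\mathcal{P}_{\kappa_j}(\mathbb{C}^{k_j}))$. Its coefficients are the numbers $\langle T_a^{(\lambda)}(e_\alpha),e_\beta\rangle_\lambda$ with $\alpha,\beta$ as in the claim (matrix entries of the restriction of $T_a^{(\lambda)}$ to ${z_{\widehat{(j)}}}^{\gamma}\mathcal{P}_{\kappa_j}(\mathbb{C}^{k_j})$, $\gamma=\alpha_{\widehat{(j)}}=\beta_{\widehat{(j)}}$, in the orthonormal basis of the $e_\alpha$). *)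

(* Defs.v *)
From HB Require Import structures.
From mathcomp Require Import all_boot all_order all_algebra.
From mathcomp Require Import complex.
From mathcomp Require Import all_classical all_reals all_analysis.
From mathcomp Require Import measurable_realfun.
Set Implicit Arguments.
Unset Strict Implicit.
Unset Printing Implicit Defensive.
Import Order.TTheory GRing.Theory Num.Theory.
Import numFieldNormedType.Exports.
Local Open Scope classical_set_scope.
Local Open Scope ring_scope.
Local Open Scope complex_scope.

Notation rvec R d := (d.-tuple (measurableTypeR R)).

Section vcons.
Context {R : realType} {d : nat}.

Definition vcons (p : measurableTypeR R * rvec R d) : rvec R d.+1 :=
  [tuple of p.1 :: p.2].

Definition vuncons (x : rvec R d.+1) : measurableTypeR R * rvec R d :=
  (thead x, [tuple of behead x]).

Lemma vconsK : cancel vcons vuncons.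
Proof.
by move=> [t x]; congr pair; exact/val_inj.
Qed.

Lemma vunconsK : cancel vuncons vcons.
Proof. by move=> x; rewrite [RHS]tuple_eta; exact: val_inj. Qed.

Lemma measurable_vcons : measurable_fun setT vcons.
Proof. exact: measurable_cons. Qed.

Lemma measurable_vuncons : measurable_fun setT vuncons.
Proof.
apply/measurable_fun_pairP; split => /=.
  exact: measurable_tnth.
exact: measurable_behead.
Qed.

End vcons.

Section lebesgue_cons.
Local Open Scope ereal_scope.
Context {R : realType} {d : nat}.
Variable mu : {sigma_finite_measure set (rvec R d) -> \bar R}.

Definition lebesgue_cons : set (rvec R d.+1) -> \bar R :=
  pushforward (@lebesgue_measure R \x mu) vcons.

Let lebesgue_cons0 : lebesgue_cons set0 = 0.
Proof. by rewrite /lebesgue_cons /pushforward preimage_set0 measure0. Qed.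

Let lebesgue_cons_ge0 A : 0 <= lebesgue_cons A.
Proof. by rewrite /lebesgue_cons /pushforward; exact: measure_ge0. Qed.

Let lebesgue_cons_sigma_additive : semi_sigma_additive lebesgue_cons.
Proof.
move=> F mF tF mUF; rewrite /lebesgue_cons /pushforward preimage_bigcup.
apply: measure_semi_sigma_additive.
- by move=> n; rewrite -[X in measurable X]setTI; exact: measurable_vcons.
- apply/trivIsetP => /= i j _ _ ij; rewrite -preimage_setI.
  by move/trivIsetP : tF => /(_ _ _ _ _ ij) ->//; rewrite preimage_set0.
- rewrite -preimage_bigcup -[X in measurable X]setTI.
  exact: measurable_vcons.
Qed.

HB.instance Definition _ := isMeasure.Build _ _ _ lebesgue_cons
  lebesgue_cons0 lebesgue_cons_ge0 lebesgue_cons_sigma_additive.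

Let lebesgue_cons_sigma_finite : sigma_finite setT lebesgue_cons.
Proof.
have /sigma_finiteP[F [TF ndF Foo]] := sigma_finiteT (@lebesgue_measure R).
have /sigma_finiteP[G [TG ndG Goo]] := sigma_finiteT mu.
exists (fun n => vuncons @^-1` (F n `*` G n)).
  apply/seteqP; split => // x _.
  have [n _ Fnx] : (\bigcup_n F n) (vuncons x).1 by rewrite -TF.
  have [k _ Gkx] : (\bigcup_n G n) (vuncons x).2 by rewrite -TG.
  exists (maxn n k) => //; split.
    by move: Fnx; exact/subsetPset/ndF/leq_maxl.
  by move: Gkx; exact/subsetPset/ndG/leq_maxr.
move=> n; have [mF Fn] := Foo n; have [mG Gn] := Goo n; split.
  rewrite -[X in measurable X]setTI; apply: measurable_vuncons => //.
  exact: measurableX.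
rewrite /lebesgue_cons /pushforward.
rewrite (_ : _ @^-1` _ = F n `*` G n).
  by rewrite product_measure1E// lte_mul_pinfty// ge0_fin_numE.
apply/funext => x.
by rewrite -[x in RHS]vconsK.
Qed.

HB.instance Definition _ := Measure_isSigmaFinite.Build _ _ _ lebesgue_cons
  lebesgue_cons_sigma_finite.

End lebesgue_cons.

Fixpoint lebesgue_rvec {R : realType} (d : nat) :
    {sigma_finite_measure set (rvec R d) -> \bar R} :=
  if d is d'.+1 then lebesgue_cons (lebesgue_rvec d') else \d_([tuple]).

Definition rsqnorm {R : realType} {d : nat} (x : rvec R d) : R :=
  \sum_(i < d) tnth x i ^+ 2.

Lemma measurable_rsqnorm {R : realType} {d : nat} :
  measurable_fun setT (@rsqnorm R d).
Proof.
apply: measurable_sum => i.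
by apply: measurable_funX; exact: measurable_tnth.
Qed.

(* The unit sphere of R^d.+1, minus its (null) equator, is the union of the
   graphs over the open unit ball of R^d of h and - h, where
   h x = sqrt (1 - |x|^2).  On each graph the Gram determinant of the induced
   metric is det (1 + grad h (grad h)^T) = 1 + |grad h|^2 = (1 - |x|^2)^-1, so
   the Riemannian volume element is (1 - |x|^2)^(- 1/2) dx. *)
Section sphere_graph.
Local Open Scope ereal_scope.
Context {R : realType} {d : nat} (s : R).

Definition sphere_chart (x : rvec R d) : rvec R d.+1 :=
  vcons (s * Num.sqrt (1 - rsqnorm x), x)%R.

Definition sphere_density (x : rvec R d) : R :=
  ((1 - rsqnorm x) `^ (- 2^-1))%R.

Definition sphere_graph (A : set (rvec R d.+1)) : \bar R :=
  \int[lebesgue_rvec d]_(x in [set x | rsqnorm x < 1]%R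
                              `&` sphere_chart @^-1` A)
    (sphere_density x)%:E.

Lemma measurable_sphere_chart : measurable_fun setT sphere_chart.
Proof.
apply: measurableT_comp; first exact: measurable_vcons.
apply: measurable_fun_pair => //.
apply: measurable_funM => //.
apply: measurableT_comp.
  by apply: continuous_measurable_fun; exact: sqrt_continuous.
by apply: measurable_funB => //; exact: measurable_rsqnorm.
Qed.

Lemma measurable_sphere_density : measurable_fun setT sphere_density.
Proof.
apply: (@measurableT_comp _ _ _ _ _ _ (fun t : R => t `^ (- 2^-1))%R).
  exact: measurable_powR.
by apply: measurable_funB => //; exact: measurable_rsqnorm.
Qed.

Let ball_measurable : measurable [set x : rvec R d | rsqnorm x < 1]%R.
Proof.
rewrite (_ : mkset _ = (@rsqnorm R d) @^-1` `]-oo, 1%R[).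
  by rewrite -[X in measurable X]setTI; apply: measurable_rsqnorm.
by apply/seteqP; split => x /=; rewrite in_itv.
Qed.

Let sphere_graph0 : sphere_graph set0 = 0.
Proof. by rewrite /sphere_graph preimage_set0 setI0 integral_set0. Qed.

Let sphere_graph_ge0 A : 0 <= sphere_graph A.
Proof. by apply: integral_ge0 => x _; rewrite lee_fin powR_ge0. Qed.

Let sphere_graph_sigma_additive : semi_sigma_additive sphere_graph.
Proof.
move=> F mF tF mUF; rewrite /sphere_graph preimage_bigcup setI_bigcupr.
rewrite ge0_integral_bigcup//.
- apply: is_cvg_ereal_nneg_natsum_cond => n _ _; exact: sphere_graph_ge0.
- move=> n; apply: measurableI => //.
  by rewrite -[X in measurable X]setTI; exact: measurable_sphere_chart.
- apply/measurable_EFinP; apply: measurable_funS measurable_sphere_density => //.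
- by move=> x _; rewrite lee_fin powR_ge0.
- apply/trivIsetP => i j _ _ ij; rewrite setIACA -(@preimage_setI _ _ sphere_chart).
  by move/trivIsetP : tF => /(_ _ _ _ _ ij) ->//; rewrite preimage_set0 setI0.
Qed.

HB.instance Definition _ := isMeasure.Build _ _ _ sphere_graph
  sphere_graph0 sphere_graph_ge0 sphere_graph_sigma_additive.

End sphere_graph.

Definition sphere_rvec {R : realType} (d : nat) :
    {measure set (rvec R d) -> \bar R} :=
  if d is d'.+1 then measure_add (sphere_graph 1) (sphere_graph (- 1))
  else mzero.

(* [differentiable] on 'cV[R[i]]_n is then complex differentiability. *)
HB.instance Definition _ (R : realType) := NormedModule.copy R[i] R[i]^o.

Section complex_vectors.
Context {R : realType}.

Definition cvec_of_rvec {n : nat} (x : rvec R n.*2) : 'cV[R[i]]_n :=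
  \col_(i < n) (nth 0 x i.*2 +i* nth 0 x i.*2.+1).

Section measurable_cvec.
Context {n : nat}.

(* [cvec_of_rvec] being a homeomorphism, these are the Borel sets of C^n. *)
Definition cvec_measurable : set (set 'cV[R[i]]_n) :=
  [set A | measurable (cvec_of_rvec @^-1` A)].

Let cvec_measurable0 : cvec_measurable set0.
Proof. by rewrite /cvec_measurable /= preimage_set0. Qed.

Let cvec_measurableC A : cvec_measurable A -> cvec_measurable (~` A).
Proof. by rewrite /cvec_measurable /= preimage_setC; exact: measurableC. Qed.

Let cvec_measurable_bigcup (F : (set _)^nat) :
  (forall i, cvec_measurable (F i)) -> cvec_measurable (\bigcup_i F i).
Proof.
move=> mF; rewrite /cvec_measurable /= preimage_bigcup.
by apply: bigcup_measurable => k _; exact: mF.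
Qed.

HB.instance Definition _ := @isMeasurable.Build default_measure_display
  'cV[R[i]]_n cvec_measurable
  cvec_measurable0 cvec_measurableC cvec_measurable_bigcup.

Lemma measurable_cvec_of_rvec : measurable_fun setT (@cvec_of_rvec n).
Proof. by move=> _ A mA; rewrite setTI. Qed.

End measurable_cvec.
End complex_vectors.

Section complex_measures.
Context {R : realType} {n : nat}.
Variable mu : {measure set (rvec R n.*2) -> \bar R}.

Definition cvec_measure : set 'cV[R[i]]_n -> \bar R :=
  pushforward mu cvec_of_rvec.

Let cvec_measure0 : cvec_measure set0 = 0%E.
Proof. by rewrite /cvec_measure /pushforward preimage_set0 measure0. Qed.

Let cvec_measure_ge0 A : (0 <= cvec_measure A)%E.
Proof. by rewrite /cvec_measure /pushforward; exact: measure_ge0. Qed.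

Let cvec_measure_sigma_additive : semi_sigma_additive cvec_measure.
Proof.
move=> F mF tF mUF; rewrite /cvec_measure /pushforward preimage_bigcup.
apply: measure_semi_sigma_additive.
- exact: mF.
- apply/trivIsetP => /= i j _ _ ij; rewrite -(@preimage_setI _ _ cvec_of_rvec).
  by move/trivIsetP : tF => /(_ _ _ _ _ ij) ->//; rewrite preimage_set0.
- by rewrite -preimage_bigcup; exact: mUF.
Qed.

HB.instance Definition _ := isMeasure.Build _ _ _ cvec_measure
  cvec_measure0 cvec_measure_ge0 cvec_measure_sigma_additive.

End complex_measures.

Definition lebesgue_cvec {R : realType} (n : nat) :
    {measure set 'cV[R[i]]_n -> \bar R} :=
  cvec_measure (lebesgue_rvec n.*2).

Definition sphere_cvec {R : realType} (n : nat) :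
    {measure set 'cV[R[i]]_n -> \bar R} :=
  cvec_measure (sphere_rvec n.*2).

Section complex_integration.
Context d {T : measurableType d} {R : realType}.
Implicit Types (D : set T) (f : T -> R[i]).

Definition cmeasurable D f :=
  measurable_fun D (fun x => complex.Re (f x)) /\
  measurable_fun D (fun x => complex.Im (f x)).

Definition cintegral (mu : {measure set T -> \bar R}) D f : R[i] :=
  (\int[mu]_(x in D) complex.Re (f x)) +i* (\int[mu]_(x in D) complex.Im (f x)).

Definition Linf (mu : {measure set T -> \bar R}) D f :=
  cmeasurable D f /\
  exists M : R, {ae mu, forall x, D x -> ComplexField.Normc.normc (f x) <= M}.

End complex_integration.

Definition Gamma {R : realType} (x : R) : R :=
  \int[lebesgue_measure]_(t in `]0, +oo[) (t `^ (x - 1) * expR (- t)).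

Section balls.
Context {R : realType}.

Definition rnorm {m : nat} (r : rvec R m) : R := Num.sqrt (rsqnorm r).

Definition tau_ball {m : nat} : set (rvec R m) :=
  [set r | (forall l, 0 <= tnth r l) /\ rnorm r < 1].

Definition cnorm {n : nat} (z : 'cV[R[i]]_n) : R :=
  Num.sqrt (\sum_(i < n) ComplexField.Normc.normc (z i 0) ^+ 2).

Definition cball {n : nat} : set 'cV[R[i]]_n := [set z | cnorm z < 1].

Definition csphere {n : nat} : set 'cV[R[i]]_n := [set z | cnorm z = 1].

End balls.

Definition mdeg {n : nat} (alpha : 'cV[nat]_n) : nat :=
  (\sum_(i < n) alpha i 0%R)%N.

Definition mfact {n : nat} (alpha : 'cV[nat]_n) : nat :=
  (\prod_(i < n) (alpha i 0%R)`!)%N.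

Definition mpow {R : realType} {n : nat} (z : 'cV[R[i]]_n)
  (alpha : 'cV[nat]_n) : R[i] := \prod_(i < n) z i 0 ^+ alpha i 0.

(* Functions on the ball are represented by total functions on C^n whose values
   outside of the ball are irrelevant. *)
Section bergman.
Context {R : realType} {n : nat} (lam : R).
Implicit Types f g h a : 'cV[R[i]]_n -> R[i].

Definition bergman_const : R :=
  Gamma (n%:R + lam + 1) / (pi ^+ n * Gamma (lam + 1)).

Definition bergman_weight (z : 'cV[R[i]]_n) : R :=
  bergman_const * (1 - cnorm z ^+ 2) `^ lam.

Definition inner f g : R[i] :=
  cintegral (lebesgue_cvec n) cball
    (fun z => f z * conjc (g z) * (bergman_weight z)%:C).

Definition L2 f :=
  cmeasurable cball f /\
  (\int[lebesgue_cvec n]_(z in cball)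
     (ComplexField.Normc.normc (f z) ^+ 2 * bergman_weight z)%:E < +oo)%E.

Definition holomorphic f :=
  forall z : 'cV[R[i]]_n, cball z -> differentiable f z.

Definition bergman f := L2 f /\ holomorphic f.

(* This determines [P h] on the ball: the difference of two candidates is a
   holomorphic function orthogonal to itself, hence vanishes there. *)
Definition bergman_projection
    (P : ('cV[R[i]]_n -> R[i]) -> ('cV[R[i]]_n -> R[i])) :=
  forall h, L2 h ->
    bergman (P h) /\ forall g, bergman g -> inner (fun z => h z - P h z) g = 0.

Definition toeplitz (P : ('cV[R[i]]_n -> R[i]) -> ('cV[R[i]]_n -> R[i])) a f :=
  P (fun z => a z * f z).

Definition bergman_basis (alpha : 'cV[nat]_n) (z : 'cV[R[i]]_n) : R[i] :=
  (Num.sqrt (Gamma (n%:R + lam + (mdeg alpha)%:R + 1) /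
             ((mfact alpha)%:R * Gamma (n%:R + lam + 1))))%:C * mpow z alpha.

End bergman.

Section symbols.
Context {R : realType} {m : nat} (k : 'I_m -> nat) (j : 'I_m).

Definition block_unitary : set 'M[R[i]]_(\sum_(l < m) k l) :=
  [set A | exists D : forall l, 'M[R[i]]_(k l),
    [/\ forall l, D l \is unitarymx,
        exists2 t : R[i], `|t| = 1 & D j = t%:M &
        A = \mxdiag_(l < m) D l]].

Definition quasi_radial_homogeneous
    (a : 'cV[R[i]]_(\sum_(l < m) k l) -> R[i]) :=
  forall A, block_unitary A ->
    {ae lebesgue_cvec _, forall z, cball z -> a (A *m z) = a z}.

Definition block_norms (z : 'cV[R[i]]_(\sum_(l < m) k l)) : rvec R m :=
  [tuple cnorm (submxcol z l) | l < m].

(* Equal to 0 instead of a unit vector on the null set where the j-th block of z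
   vanishes. *)
Definition block_direction (z : 'cV[R[i]]_(\sum_(l < m) k l)) : 'cV[R[i]]_(k j) :=
  ((cnorm (submxcol z j))^-1)%:C *: submxcol z j.

End symbols.

(* Main.v *)
Require Import Defs.
From HB Require Import structures.
From mathcomp Require Import all_boot all_order all_algebra.
From mathcomp Require Import complex.
From mathcomp Require Import all_classical all_reals all_analysis.
From mathcomp Require Import measurable_realfun.
From mathcomp Require Import ring lra zify.
Set Implicit Arguments.
Unset Strict Implicit.
Unset Printing Implicit Defensive.
Import Order.TTheory GRing.Theory Num.Theory.
Import numFieldNormedType.Exports.
Local Open Scope classical_set_scope.
Local Open Scope ring_scope.
Local Open Scope complex_scope.

(* As the monomial e_beta is in the Bergman space, the matrix entry is the integral
   of a e_alpha conj(e_beta) over the ball.  Tonelli's theorem splits C^n into its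
   blocks C^(k_l), and polar coordinates z_(l) = r_l xi_(l) split each block.  Up to
   powers of r, the integrand depends on xi_(l), l != j, only through the factor
   |xi_(l)^alpha_(l)|^2, whose integral over the sphere is
     2 pi^(k_l) alpha_(l)! / (k_l - 1 + |alpha_(l)|)!
   (compare the two computations of the integral of |z^alpha|^2 exp(-|z|^2)).

   Polar coordinates in R^(d+1) are obtained from the graph charts of the sphere:
   for x in R^d, rescale x by r, exchange the order of integration, and substitute
   t = sqrt (r^2 - |x|^2) in the remaining integral over r. *)

(** * Substitutions on the real line *)

(** The block formula is proved first for nonnegative functions, where Tonelli's theorem asks for
    measurability only. Domains of integration are therefore turned into factors ([hpos], extension
    by zero), so that every integrand is measurable on a whole product. The direction of z_(j) has
    to survive as a variable, since f depends on it, whereas the other directions are integrated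
    out. Hence the two interfaces for a block, [polar_block] and [radial_block]. The sphere measure
    comes from charts whose density blows up at the equator, so its finiteness is not visible from
    the definition. It results from the Gaussian integrals, and makes Tonelli's theorem applicable
    with the sphere as a factor. The Bergman projection is known only by its defining property on
    L2. To remove it, a e_alpha and e_beta must be square integrable, which rests on the finite mass
    of the weight (1 - |z|^2)^lam; for lam < 0 the weight is unbounded near the boundary and lam >
    -1 is what saves it. *)

Section density.
Local Open Scope ereal_scope.
Context d1 d2 (X : measurableType d1) (Y : measurableType d2) (R : realType).
Variables (phi : X -> Y) (w : X -> R) (mu : {measure set X -> \bar R}).

(** The image under [phi] of the measure of density [w] with respect to [mu]; in a change of
    variables [w] is the Jacobian. *)
Definition weighted_pushforward (A : set Y) : \bar R :=
  \int[mu]_x ((w x)%:E * (\1_A (phi x))%:E).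

Hypotheses (mphi : measurable_fun setT phi) (mw : measurable_fun setT w).
Hypothesis w0 : forall x, (0 <= w x)%R.

Let wp0 : weighted_pushforward set0 = 0.
Proof.
by rewrite /weighted_pushforward integral0_eq// => x _; rewrite indic0 mule0.
Qed.

Let wp_ge0 A : 0 <= weighted_pushforward A.
Proof. by apply: integral_ge0 => x _; rewrite mule_ge0// lee_fin. Qed.

Let wp_sigma_additive : semi_sigma_additive weighted_pushforward.
Proof.
move=> F mF tF mUF; rewrite /weighted_pushforward.
rewrite [X in _ --> X](_ : _ = \sum_(n <oo) weighted_pushforward (F n)).
  by apply: is_cvg_ereal_nneg_natsum_cond => n _ _; exact: wp_ge0.
rewrite -integral_nneseries//; last 2 first.
- move=> n; apply: emeasurable_funM; first exact/measurable_EFinP.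
  by apply/measurable_EFinP; exact: measurableT_comp.
- by move=> n x _; rewrite mule_ge0// lee_fin.
apply: eq_integral => x _; rewrite nneseriesZl//; congr (_ * _).
exact: indic_bigcup.
Qed.

Definition weighted_pushforward_measure : {measure set Y -> \bar R} :=
  HB.pack weighted_pushforward
    (isMeasure.Build _ _ _ weighted_pushforward wp0 wp_ge0 wp_sigma_additive).

Import HBNNSimple.

(** For indicators this is the hypothesis on [m]; linearity gives simple functions and monotone
    convergence the rest. Agreement on measurable sets is all that is asked of [m], so that it may
    be a measure built in another way, such as Lebesgue measure. *)
Lemma ge0_integral_weighted_pushforward (m : {measure set Y -> \bar R})
    (F : Y -> \bar R) :
  (forall A, measurable A -> m A = weighted_pushforward A) ->
  measurable_fun setT F -> (forall y, 0 <= F y) ->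
  \int[m]_y F y = \int[mu]_x ((w x)%:E * F (phi x)).
Proof.
move=> mE mF F0.
pose f_ := nnsfun_approx measurableT mF.
have f_cvg y : EFin \o f_^~ y @ \oo --> F y by apply: cvg_nnsfun_approx.
have f_nd y a b : (a <= b)%N -> (f_ a y <= f_ b y)%R.
  by move=> ab; exact/lefP/nd_nnsfun_approx.
transitivity (limn (fun n => \int[m]_y (f_ n y)%:E)).
  rewrite -monotone_convergence//.
  - by apply: eq_integral => y _; apply/esym/cvg_lim => //; exact: f_cvg.
  - by move=> n; exact/measurable_EFinP/measurable_funP.
  - by move=> n y _; rewrite lee_fin.
  - by move=> y _ a b ab; rewrite lee_fin f_nd.
transitivity (limn (fun n => \int[mu]_x ((w x)%:E * (f_ n (phi x))%:E))); last first.
  rewrite -monotone_convergence//.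
  - apply: eq_integral => x _; apply/cvg_lim => //.
    by apply: cvgeZl => //; exact: f_cvg.
  - move=> n; apply: emeasurable_funM; first exact/measurable_EFinP.
    by apply/measurable_EFinP; apply: measurableT_comp.
  - by move=> n x _; rewrite mule_ge0// lee_fin.
  - by move=> x _ a b ab; rewrite lee_wpmul2l// ?lee_fin// f_nd.
(* What remains concerns a simple function, written as a finite sum over its values. *)
congr (limn _); apply/funext => n.
have f_nn r y : 0 <= (r * \1_(f_ n @^-1` [set r]) y)%:E.
  by rewrite EFinM nnfun_muleindic_ge0.
under eq_integral do rewrite fimfunE -fsumEFin//.
rewrite ge0_integral_fsum//; last first.
  by move=> r; exact/measurable_EFinP/measurable_funM.
under [RHS]eq_integral.
  move=> x _; rewrite fimfunE -fsumEFin// ge0_mule_fsumr; last first.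
    by move=> r; exact: f_nn.
  over.
rewrite ge0_integral_fsum//; last 2 first.
  - move=> r; apply: emeasurable_funM; first exact/measurable_EFinP.
    apply/measurable_EFinP; apply: measurable_funM => //.
    by apply: measurableT_comp.
  - by move=> r x _; rewrite mule_ge0// lee_fin.
apply: eq_fsbigr => r; rewrite inE => -[z _ <-].
have mfr : measurable (f_ n @^-1` [set f_ n z]) by [].
under eq_integral do rewrite EFinM.
rewrite ge0_integralZl//; last 2 first.
- by apply/measurable_EFinP.
- by rewrite lee_fin.
rewrite integral_indic// setIT mE// /weighted_pushforward.
rewrite -ge0_integralZl//.
- by apply: eq_integral => x _; rewrite EFinM muleCA.
- apply: emeasurable_funM; first exact/measurable_EFinP.
  by apply/measurable_EFinP; exact: measurableT_comp.
- by move=> x _; rewrite mule_ge0// lee_fin.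
- by rewrite lee_fin.
Qed.

End density.

Lemma ge0_integral_image d1 d2 (X : measurableType d1) (Y : measurableType d2)
    (R : realType) (phi : X -> Y) (mu : {measure set X -> \bar R})
    (m : {measure set Y -> \bar R}) (F : Y -> \bar R) :
  measurable_fun setT phi ->
  (forall A, measurable A -> m A = mu (phi @^-1` A)) ->
  measurable_fun setT F -> (forall y, 0 <= F y)%E ->
  (\int[m]_y F y = \int[mu]_x F (phi x))%E.
Proof.
move=> mphi mE mF F0.
rewrite (@ge0_integral_weighted_pushforward _ _ _ _ _ phi (cst 1) mu)//.
  by apply: eq_integral => x _; rewrite mul1e.
move=> A mA; rewrite mE// /weighted_pushforward.
under eq_integral do rewrite mul1e.
rewrite -[X in mu X]setIT -integral_indic//.
by rewrite -[X in measurable X]setTI; exact: mphi.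
Qed.

Section line.
Local Open Scope ereal_scope.
Context {R : realType}.
Notation mu := (@lebesgue_measure R).
Implicit Types F : measurableTypeR R -> \bar R.

(* A factor rather than a domain of integration, for Tonelli's theorem to apply
   to functions defined on the whole product. *)
Definition hpos : R -> R := \1_`]0%R, +oo[.

Lemma hposE r : hpos r = (0 < r)%R%:R.
Proof. by rewrite /hpos indicE mem_setE in_itv/= andbT. Qed.

Lemma hpos_ge0 r : (0 <= hpos r)%R.
Proof. by rewrite hposE. Qed.

Lemma measurable_hpos : measurable_fun setT (hpos : measurableTypeR R -> R).
Proof. exact: measurable_indic. Qed.

Lemma integral_hpos (G : R -> \bar R) :
  \int[mu]_x ((hpos x)%:E * G x) = \int[mu]_(x in `]0%R, +oo[) G x.
Proof.
rewrite [RHS]integral_mkcond; apply: eq_integral => x _.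
rewrite patchE hposE mem_setE in_itv/= andbT.
by case: ltP => _; rewrite ?mul1e ?mul0e.
Qed.

Lemma integral_indicM (A B : set (measurableTypeR R)) :
  measurable A -> measurable B ->
  \int[mu]_x ((\1_A x)%:E * (\1_B x)%:E) = mu (A `&` B).
Proof.
move=> mA mB; under eq_integral do rewrite -EFinM -[(\1_A _ * _)%R]/((\1_A \* \1_B)%R _) -indicI.
by rewrite integral_indic ?setIT//; exact: measurableI.
Qed.

Lemma integral_sqr_itv (a b : R) : (0 <= a)%R -> (a < b)%R ->
  \int[mu]_(r in `]Num.sqrt a, Num.sqrt b]) (2 * r)%:E = (b - a)%:E.
Proof.
move=> a0 ab; have b0 : (0 < b)%R := le_lt_trans a0 ab.
have sab : (Num.sqrt a < Num.sqrt b)%R by rewrite ltr_sqrt.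
have m2 : measurable_fun [set: R] (fun r : R => 2 * r)%R.
  by apply: measurable_funM.
rewrite integral_itv_obnd_cbnd; last by apply/measurable_EFinP/measurable_funTS.
rewrite (@continuous_FTC2 _ _ (fun r => r ^+ 2)%R)//.
- by rewrite sqr_sqrtr ?ltW// sqr_sqrtr// EFinB.
- apply: continuous_subspaceT => x; apply: cvgM; [exact: cvg_cst|exact: cvg_id].
- have dX (x : R) : derivable (fun r : R => r ^+ 2)%R x 1 by [].
  have cX (x : R) : {for x, continuous (fun r : R => r ^+ 2)%R}.
    by apply: exprn_continuous.
  split => //; first by apply: cvg_at_right_filter; exact: cX.
  by apply: cvg_at_left_filter; exact: cX.
- by move=> x _; rewrite exp_derive1 expr1.
Qed.

(** The substitution u = r^2, du = 2 r dr. Lebesgue measure is determined by its values on the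
    intervals ]a, b], and there the weighted image is computed with the primitive r^2 of 2 r. *)
Lemma lebesgue_measure_sqr (A : set (measurableTypeR R)) : measurable A ->
  weighted_pushforward (fun r : measurableTypeR R => r ^+ 2 : measurableTypeR R)%R
    (fun r => hpos r * (2 * r))%R mu A = mu (A `&` `]0%R, +oo[).
Proof.
move=> mA.
have mphi : measurable_fun setT
    (fun r : measurableTypeR R => r ^+ 2 : measurableTypeR R)%R.
  exact: measurable_funX.
have mw : measurable_fun setT (fun r : measurableTypeR R => hpos r * (2 * r))%R.
  by apply: measurable_funM; [exact: measurable_hpos|exact: measurable_funM].
have w0 (r : measurableTypeR R) : (0 <= hpos r * (2 * r))%R.
  rewrite hposE; case: ltP => r0; rewrite ?mul0r// mul1r mulr_ge0//.
  exact: ltW.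
(* Uniqueness of the Lebesgue measure is only available on the whole line: add
   the Lebesgue measure of the negative half-line. *)
have mid : measurable_fun setT (@idfun (measurableTypeR R)) by exact: measurable_id.
have mn : measurable_fun setT (\1_`]-oo, 0%R] : measurableTypeR R -> R).
  exact: measurable_indic.
have n0 (r : measurableTypeR R) : (0 <= \1_`]-oo, 0%R] r :> R)%R by [].
pose m1 := weighted_pushforward_measure mu mphi mw w0.
pose m2 := weighted_pushforward_measure mu mid mn n0.
have m2E B : measurable B -> m2 B = mu (`]-oo, 0%R] `&` B).
  by move=> mB; apply: integral_indicM.
have muE B : measurable B -> mu B = m1 B + m2 B.
  move=> mB; rewrite (@lebesgue_measure_unique _ (measure_add m1 m2))//.
    exact: measure_addE.
  move=> _ [[a b]] _ <-; rewrite [RHS]measure_addE; cbn [fst snd].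
  have [ba|ab] := leP b a.
    rewrite set_itv_ge ?measure0 ?adde0// bnd_simp -leNgt//.
  rewrite m2E//.
  have [b0|b0] := leP b 0%R.
    rewrite (_ : m1 _ = 0) ?add0e.
      congr (mu _); apply/esym/setIidPr => x /=; rewrite !in_itv/= => /andP[_ xb].
      exact: le_trans xb b0.
    apply: integral0_eq => r _; rewrite indicE mem_setE in_itv/= hposE.
    case: ltP => r0; rewrite ?mul0r ?mul0e// -[(r ^+ 2 <= b)%R]negbK -ltNge.
    by rewrite (le_lt_trans b0) ?exprn_gt0// andbF mule0.
  (* Only the part ]max a 0, b] is reached by squares of positive numbers; its preimage among these
     is ]sqrt (max a 0), sqrt b]. *)
  have -> : m1 `]a, b]%classic = (b - Num.max a 0)%:E.
    rewrite -integral_sqr_itv; last 2 first.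
    - by rewrite le_max lexx orbT.
    - by rewrite gt_max ab.
    rewrite [RHS]integral_mkcond; apply: eq_integral => r _.
    rewrite patchE indicE !mem_setE !in_itv/= hposE; case: ltP => r0; last first.
      rewrite mul0r mul0e ifF//; apply/negbTE; rewrite negb_and -leNgt.
      by rewrite (le_trans r0)// sqrtr_ge0.
    rewrite mul1r -EFinM.
    have -> : (r <= Num.sqrt b)%R = (r ^+ 2 <= b)%R.
      rewrite -[in RHS](sqr_sqrtr (ltW b0)) ler_pXn2r// nnegrE ?sqrtr_ge0//.
      exact: ltW.
    have -> : (Num.sqrt (Num.max a 0) < r)%R = (Num.max a 0 < r ^+ 2)%R.
      have a'0 : (0 <= Num.max a 0)%R by rewrite le_max lexx orbT.
      rewrite -[in RHS](sqr_sqrtr a'0) ltr_pXn2r// nnegrE ?sqrtr_ge0//.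
      exact: ltW.
    rewrite gt_max exprn_gt0// andbT.
    by case: ifPn => _; rewrite ?mulr1// mulr0.
  rewrite lebesgue_measure_itv/= lte_fin ab -EFinB.
  have [a0|a0] := leP a 0%R.
    rewrite (_ : `]-oo, 0%R] `&` `]a, b] = `]a, 0%R])%classic; last first.
      apply/seteqP; split => x/=; rewrite !in_itv/=.
        by move=> [-> /andP[->]].
      by move=> /andP[-> x0]; rewrite x0 (le_trans x0)// ltW.
    rewrite lebesgue_measure_itv/= lte_fin; case: ltP => a1.
      by rewrite -EFinB -EFinD subr0 sub0r.
    by rewrite (@le_anti _ _ a 0%R) ?a0// subr0 adde0.
  rewrite (_ : _ `&` _ = set0) ?measure0 ?adde0//.
  apply/seteqP; split => x//=; rewrite !in_itv/= => -[x0 /andP[ax _]].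
  by move: (lt_le_trans ax x0); rewrite ltNge (ltW a0).
(* On a subset of the positive half-line the auxiliary measure [m2] vanishes and only [m1] is
   left. *)
rewrite muE; last exact: measurableI.
rewrite m2E; last exact: measurableI.
rewrite (_ : `]-oo, 0%R] `&` _ = set0) ?measure0 ?adde0; last first.
  apply/seteqP; split => x//=; rewrite !in_itv/= andbT => -[x0 [_]].
  by rewrite ltNge x0.
apply: eq_integral => r _; rewrite !indicE in_setI mem_setE in_itv/= andbT.
rewrite hposE; case: ltP => r0; rewrite ?mul0r ?mul0e//.
by rewrite exprn_gt0// andbT.
Qed.

Lemma ge0_integral_sqr F : measurable_fun setT F -> (forall x, 0 <= F x) ->
  \int[mu]_r ((hpos r * (2 * r))%:E * F (r ^+ 2)%R) =
  \int[mu]_u ((hpos u)%:E * F u).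
Proof.
move=> mF F0.
have mphi : measurable_fun setT
    (fun r : measurableTypeR R => r ^+ 2 : measurableTypeR R)%R.
  exact: measurable_funX.
have mw : measurable_fun setT (fun r : measurableTypeR R => hpos r * (2 * r))%R.
  by apply: measurable_funM; [exact: measurable_hpos|exact: measurable_funM].
have w0 (r : measurableTypeR R) : (0 <= hpos r * (2 * r))%R.
  rewrite hposE; case: ltP => r0; rewrite ?mul0r// mul1r mulr_ge0//.
  exact: ltW.
rewrite -(ge0_integral_weighted_pushforward mphi mw w0
  (m := weighted_pushforward_measure mu mphi mw w0))//.
(* The same measure is also the image under the identity of Lebesgue measure with density [hpos]. *)
rewrite (@ge0_integral_weighted_pushforward _ _ (measurableTypeR R) (measurableTypeR R) _
  (@idfun (measurableTypeR R)) hpos mu)//.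
- exact: measurable_id.
- exact: measurable_hpos.
- move=> A mA; rewrite [LHS]lebesgue_measure_sqr// /weighted_pushforward.
  by rewrite setIC; apply/esym/integral_indicM.
Qed.

Lemma ge0_integral_affine (c b : R) F : (0 < c)%R ->
  measurable_fun setT F -> (forall x, 0 <= F x) ->
  \int[mu]_x F x = c%:E * \int[mu]_x F (c * x + b)%R.
Proof.
move=> c0 mF F0.
have mphi : measurable_fun setT
    (fun r : measurableTypeR R => c * r + b : measurableTypeR R)%R.
  by apply: measurable_funD => //; exact: measurable_funM.
rewrite -ge0_integralZl//; last 2 first.
- exact: measurableT_comp.
- by rewrite lee_fin ltW.
have c0' (x : measurableTypeR R) : (0 <= cst c x)%R by rewrite ltW.
have mc : measurable_fun setT (cst c : measurableTypeR R -> R) by [].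
apply: (ge0_integral_weighted_pushforward mphi mc c0') => // A mA.
apply: (@lebesgue_measure_unique _ (weighted_pushforward_measure mu mphi mc c0')) => //.
move=> _ [[s t]] _ <-; transitivity (\int[mu]_x
    (c%:E * (\1_(`](s - b) / c, (t - b) / c]%classic) x)%:E)); last first.
  apply: eq_integral => x _; congr (_ * _%:E).
  rewrite !indicE !mem_setE !in_itv/= ltr_pdivrMr// ler_pdivlMr//.
  by rewrite ltrBlDr lerBrDr mulrC.
rewrite ge0_integralZl ?lee_fin ?(ltW c0)//; last exact/measurable_EFinP.
rewrite integral_indic// setIT lebesgue_measure_itv/=.
rewrite [X in _ = _ * X]lebesgue_measure_itv/= !lte_fin.
rewrite ltr_pM2r ?invr_gt0// ltrD2r; case: ifPn => _; last by rewrite mule0.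
by rewrite -!EFinB -EFinM -mulrBl mulrC divfK ?gt_eqF// opprB addrA subrK.
Qed.

Lemma ge0_integral_shift (b : R) F :
  measurable_fun setT F -> (forall x, 0 <= F x) ->
  \int[mu]_x F x = \int[mu]_x F (x + b)%R.
Proof.
move=> mF F0; rewrite (ge0_integral_affine b ltr01)// mul1e.
by apply: eq_integral => x _; rewrite mul1r.
Qed.

(** Serves to separate the half-spaces t > 0 and t < 0, each of which is swept out by the dilations
    of one graph of the sphere. The point 0 is negligible. *)
Lemma ge0_integral_halves F : measurable_fun setT F -> (forall x, 0 <= F x) ->
  \int[mu]_x F x =
  \int[mu]_x ((hpos x)%:E * F x) + \int[mu]_x ((hpos x)%:E * F (- x)%R).
Proof.
move=> mF F0.
have mFN : measurable_fun setT (fun x : measurableTypeR R => F (- x)%R).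
  exact: measurableT_comp.
rewrite !integral_hpos -(setUv `]-oo, 0%R]%classic) ge0_integral_setU//=; last 3 first.
- exact: measurableC.
- by rewrite setUv.
- exact/disj_setPCl.
rewrite addeC setCitvl; congr (_ + _).
rewrite integral_itv_obnd_cbnd; last exact: measurable_funTS.
rewrite (ge0_integration_by_substitution0 (f := fun x => F (- x)%R))//.
by apply: eq_integral => x _; rewrite opprK.
Qed.

End line.

(** * Polar coordinates *)

Section rvec.
Local Open Scope ereal_scope.
Context {R : realType}.
Notation mu := (@lebesgue_measure R).

Definition rscale {d} (c : R) (x : rvec R d) : rvec R d := map_tuple ( *%R c) x.

Lemma rscale_vcons d (c t : R) (x : rvec R d) :
  rscale c (vcons (t, x)) = vcons ((c * t)%R, rscale c x).
Proof. exact/val_inj. Qed.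

Lemma tnth_rscale d (c : R) (x : rvec R d) i :
  tnth (rscale c x) i = (c * tnth x i)%R.
Proof. exact: tnth_map. Qed.

Lemma tnth_vconsS d (t : R) (x : rvec R d) i :
  tnth (vcons (t, x)) (lift ord0 i) = tnth x i.
Proof. exact: tnthS. Qed.

Lemma rsqnorm_vcons d (t : R) (x : rvec R d) :
  rsqnorm (vcons (t, x)) = (t ^+ 2 + rsqnorm x)%R.
Proof.
by rewrite /rsqnorm big_ord_recl; congr +%R; apply: eq_bigr => i _; rewrite tnth_vconsS.
Qed.

Lemma rsqnorm_rscale d (c : R) (x : rvec R d) :
  rsqnorm (rscale c x) = (c ^+ 2 * rsqnorm x)%R.
Proof.
rewrite /rsqnorm mulr_sumr; apply: eq_bigr => i _.
by rewrite tnth_rscale exprMn.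
Qed.

Lemma rsqnorm_ge0 d (x : rvec R d) : (0 <= rsqnorm x)%R.
Proof. by apply: sumr_ge0 => i _; exact: sqr_ge0. Qed.

Lemma measurable_rscale dT (T : measurableType dT) d (f : T -> R)
    (g : T -> rvec R d) : measurable_fun setT f -> measurable_fun setT g ->
  measurable_fun setT (fun t => rscale (f t) (g t)).
Proof.
move=> mf mg; apply/measurable_fun_tnthP => i.
rewrite (_ : _ \o _ = (fun t => f t * tnth (g t) i)%R); last first.
  by apply/funext => t /=; rewrite tnth_rscale.
apply: measurable_funM => //; apply: (measurableT_comp (measurable_tnth i)) => //.
Qed.

Lemma measurable_vconsP dT (T : measurableType dT) d
    (f : T -> measurableTypeR R) (g : T -> rvec R d) :
  measurable_fun setT f -> measurable_fun setT g ->
  measurable_fun setT (fun t => vcons (f t, g t)).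
Proof.
move=> mf mg; apply: measurableT_comp; first exact: measurable_vcons.
exact: measurable_fun_pair.
Qed.

Lemma ge0_integral_rvec0 (F : rvec R 0 -> \bar R) :
  measurable_fun setT F -> (forall x, 0 <= F x) ->
  \int[lebesgue_rvec 0]_x F x = F [tuple].
Proof.
move=> mF F0; have := integral_dirac ([tuple] : rvec R 0) measurableT mF. rewrite /= => ->.
by rewrite diracT mul1e.
Qed.

Lemma ge0_integral_rvecS d (F : rvec R d.+1 -> \bar R) :
  measurable_fun setT F -> (forall x, 0 <= F x) ->
  \int[lebesgue_rvec d.+1]_x F x =
  \int[mu]_t \int[lebesgue_rvec d]_x F (vcons (t, x)).
Proof.
move=> mF F0.
rewrite (@ge0_integral_image _ _ _ _ _ vcons (mu \x lebesgue_rvec d))//; last first.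
  exact: measurable_vcons.
rewrite fubini_tonelli1//.
by apply: measurableT_comp => //; exact: measurable_vcons.
Qed.

(** The order suited to the charts of the sphere: the height t above a fixed x is the variable to be
    substituted. *)
Lemma ge0_integral_rvecS_swap d (F : rvec R d.+1 -> \bar R) :
  measurable_fun setT F -> (forall x, 0 <= F x) ->
  \int[lebesgue_rvec d.+1]_x F x =
  \int[lebesgue_rvec d]_x \int[mu]_t F (vcons (t, x)).
Proof.
move=> mF F0; rewrite ge0_integral_rvecS//.
rewrite (fubini_tonelli (F \o vcons))//; last by move=> ?; exact: F0.
by apply: measurableT_comp => //; exact: measurable_vcons.
Qed.

Lemma ge0_integral_rscale d (c : R) (F : rvec R d -> \bar R) : (0 < c)%R ->
  measurable_fun setT F -> (forall x, 0 <= F x) ->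
  \int[lebesgue_rvec d]_x F x =
  (c ^+ d)%:E * \int[lebesgue_rvec d]_x F (rscale c x).
Proof.
move=> c0; elim: d F => [|d IH] F mF F0.
  rewrite expr0 mul1e !ge0_integral_rvec0//; last first.
    by apply: measurableT_comp => //; apply: measurable_rscale => //.
  by congr F; exact/val_inj.
have cd0 : 0 <= (c ^+ d)%:E by rewrite lee_fin exprn_ge0// ltW.
have mFs : measurable_fun setT (fun x => F (rscale c x)).
  by apply: measurableT_comp => //; exact: measurable_rscale.
rewrite !ge0_integral_rvecS//.
transitivity (\int[mu]_t ((c ^+ d)%:E *
    \int[lebesgue_rvec d]_x F (vcons (t, rscale c x)))).
  apply: eq_integral => t _; rewrite (IH (fun x => F (vcons (t, x))))//.
  by apply: measurableT_comp => //; exact: measurable_vconsP.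
have mG : measurable_fun setT (fun t : measurableTypeR R =>
    \int[lebesgue_rvec d]_x F (vcons (t, rscale c x))).
  apply: (measurable_fun_fubini_tonelli_F
    (fun p : measurableTypeR R * rvec R d => F (vcons (p.1, rscale c p.2)))) => //.
  apply: measurableT_comp => //; apply: measurable_vconsP => //.
  exact: measurable_rscale.
have G0 (t : measurableTypeR R) :
    0 <= \int[lebesgue_rvec d]_x F (vcons (t, rscale c x)).
  by apply: integral_ge0.
rewrite ge0_integralZl// (ge0_integral_affine 0 c0 mG)//.
rewrite muleA -EFinM -exprSr; congr (_ * _); apply: eq_integral => t _.
by apply: eq_integral => x _; rewrite addr0 rscale_vcons.
Qed.

End rvec.

Section polar.
Local Open Scope ereal_scope.
Context {R : realType} {d : nat}.
Notation mu := (@lebesgue_measure R).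
Implicit Types F : rvec R d.+1 -> \bar R.

(** The domain of the chart, the open unit ball, moves into the density as the factor
    [hpos (1 - rsqnorm x)]; the graph measure is then a weighted image of Lebesgue measure. *)
Lemma ge0_integral_sphere_graph (s : R) F : measurable_fun setT F ->
  (forall x, 0 <= F x) ->
  \int[sphere_graph s]_x F x =
  \int[lebesgue_rvec d]_x ((hpos (1 - rsqnorm x) * sphere_density x)%:E *
    F (sphere_chart s x)).
Proof.
move=> mF F0; apply: ge0_integral_weighted_pushforward => //.
- exact: measurable_sphere_chart.
- apply: measurable_funM; last exact: measurable_sphere_density.
  apply: measurableT_comp; first exact: measurable_hpos.
  by apply: measurable_funB => //; exact: measurable_rsqnorm.
- by move=> x; rewrite mulr_ge0 ?hpos_ge0 ?powR_ge0.
- move=> A mA; rewrite [LHS]integral_mkcond; apply: eq_integral => x _.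
  rewrite patchE hposE subr_gt0 indicE in_setI.
  rewrite (_ : (x \in sphere_chart s @^-1` A) = (sphere_chart s x \in A)); last first.
    by apply/idP/idP => /set_mem ?; exact/mem_set.
  rewrite (_ : (x \in _) = (rsqnorm x < 1)%R); last first.
    by apply/idP/idP => [/set_mem//|?]; exact/mem_set.
  case: (_ < _)%R; rewrite ?mul0r ?mul0e//= mul1r -EFinM.
  by case: (_ \in _); rewrite ?mulr1 ?mulr0.
Qed.

(* The change of variable t = sqrt (r^2 - q) is the composite of two squarings
   and of a translation, r^2 = t^2 + q. *)
Lemma radial_substitution (q : R) (G : measurableTypeR R -> \bar R) :
  (0 <= q)%R -> measurable_fun setT G -> (forall x, 0 <= G x) ->
  \int[mu]_t ((hpos t)%:E * G t) =
  \int[mu]_r ((hpos r * hpos (r ^+ 2 - q) * (r * (r ^+ 2 - q) `^ (- 2^-1)))%:E *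
    G (Num.sqrt (r ^+ 2 - q))).
Proof.
move=> q0 mG G0.
have msqrt : measurable_fun setT
    (Num.sqrt : measurableTypeR R -> measurableTypeR R).
  by apply: continuous_measurable_fun; exact: sqrt_continuous.
(* The factor 2^-1 u^(-1/2) is the Jacobian of t = sqrt u; it cancels the 2 t produced by the first
   squaring. *)
pose K (u : measurableTypeR R) := (hpos u * (2^-1 * u `^ (- 2^-1)))%:E * G (Num.sqrt u).
have mK : measurable_fun setT K.
  apply: emeasurable_funM; last exact: measurableT_comp.
  apply/measurable_EFinP; apply: measurable_funM; first exact: measurable_hpos.
  by apply: measurable_funM => //; exact: measurable_powR.
have K0 u : 0 <= K u.
  by rewrite mule_ge0// lee_fin mulr_ge0 ?hpos_ge0// mulr_ge0// powR_ge0.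
transitivity (\int[mu]_u ((hpos u)%:E * K u)).
  rewrite -(@ge0_integral_sqr _ K)//; apply: eq_integral => r _.
  rewrite /K !hposE; case: (ltP 0%R r) => r0; last by rewrite !mul0r !mul0e.
  rewrite exprn_gt0// sqrtr_sqr gtr0_norm// !mul1r muleA -EFinM.
  rewrite -powR_mulrn ?(ltW r0)// -powRrM mulrN mulfV// powRN powRr1 ?(ltW r0)//.
  by rewrite mulrACA divff// mul1r divff ?gt_eqF// mul1e.
pose K' u := (hpos u)%:E * K u.
have mK' : measurable_fun setT K'.
  by apply: emeasurable_funM => //; apply/measurable_EFinP; exact: measurable_hpos.
have K'0 u : 0 <= K' u by rewrite mule_ge0// lee_fin hpos_ge0.
rewrite [LHS](ge0_integral_shift (- q) mK' K'0).
(* With v = r^2, the translate by q turns u = t^2 into v - q. *)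
pose L (v : measurableTypeR R) := K' (v - q)%R.
have mL : measurable_fun setT L.
  by apply: measurableT_comp => //; exact: measurable_funB.
transitivity (\int[mu]_v ((hpos v)%:E * L v)).
  (* Since q >= 0, the support v > q of [L] lies in v > 0, so the factor [hpos v] demanded by the
     second squaring can be inserted. *)
  apply: eq_integral => v _; rewrite /L /K' hposE (hposE v).
  case: ltP => vq; last by rewrite !mul0e mule0.
  by rewrite (le_lt_trans q0) ?mul1e// -subr_gt0.
rewrite -(@ge0_integral_sqr _ L)//; last by move=> ?; exact: K'0.
apply: eq_integral => r _; rewrite /L /K' /K !muleA -!EFinM.
congr (_%:E * _); rewrite !hposE.
set P := (_ `^ _)%R.
by case: (ltP 0%R r) => _; case: ltP => _;
  rewrite ?(mul0r, mulr0, mul1r, mulr1)//; field.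
Qed.

Lemma ge0_integral_polar_graph (s : R) F : measurable_fun setT F ->
  (forall x, 0 <= F x) ->
  \int[lebesgue_rvec d]_x \int[mu]_t ((hpos t)%:E * F (vcons ((s * t)%R, x))) =
  \int[mu]_r ((hpos r * r ^+ d)%:E * \int[sphere_graph s]_x F (rscale r x)).
Proof.
move=> mF F0.
(* [w] is the Jacobian of t = sqrt (r^2 - |x|^2), with the conditions r > 0 and r^2 > |x|^2 as
   factors; [v] is the point at height s t above x. *)
pose w (p : rvec R d * measurableTypeR R) := (hpos p.2 *
  hpos (p.2 ^+ 2 - rsqnorm p.1) * (p.2 * (p.2 ^+ 2 - rsqnorm p.1) `^ (- 2^-1)))%R.
pose v (p : rvec R d * measurableTypeR R) :=
  vcons ((s * Num.sqrt (p.2 ^+ 2 - rsqnorm p.1))%R, p.1).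
have mdiff : measurable_fun setT (fun p : rvec R d * measurableTypeR R =>
    p.2 ^+ 2 - rsqnorm p.1 : measurableTypeR R)%R.
  apply: measurable_funB; first by apply: measurable_funX.
  by apply: measurableT_comp => //; exact: measurable_rsqnorm.
have mw : measurable_fun setT w.
  apply: measurable_funM; first apply: measurable_funM.
  - exact: (measurableT_comp measurable_hpos measurable_snd).
  - exact: (measurableT_comp measurable_hpos mdiff).
  - apply: measurable_funM => //.
    exact: (measurableT_comp (measurable_powR (- 2^-1)%R) mdiff).
have mv : measurable_fun setT v.
  apply: measurable_vconsP => //; apply: measurable_funM => //.
  apply: measurableT_comp mdiff.
  by apply: continuous_measurable_fun; exact: sqrt_continuous.
have mwv : measurable_fun setT (fun p => (w p)%:E * F (v p)).
  by apply: emeasurable_funM; [exact/measurable_EFinP|exact: measurableT_comp].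
have w0 p : (0 <= w p)%R.
  rewrite /w !hposE; case: (ltP 0%R p.2) => p2; rewrite ?mul0r//.
  by rewrite mul1r mulr_ge0// mulr_ge0 ?powR_ge0// ltW.
transitivity (\int[lebesgue_rvec d]_x \int[mu]_r ((w (x, r))%:E * F (v (x, r)))).
  apply: eq_integral => x _.
  rewrite (@radial_substitution (rsqnorm x) (fun t => F (vcons ((s * t)%R, x))))//.
    exact: rsqnorm_ge0.
  by apply: measurableT_comp => //; exact: measurable_vconsP.
rewrite (fubini_tonelli (fun p => (w p)%:E * F (v p)))//; last first.
  by move=> p; rewrite mule_ge0// lee_fin.
apply: eq_integral => r _; have [r0|r0] := ltP 0%R r; last first.
  rewrite hposE ltNge r0 mul0r mul0e; apply: integral0_eq => x _.
  by rewrite /w/= hposE ltNge r0 !mul0r mul0e.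
rewrite (ge0_integral_rscale (c := r))//; last 2 first.
- by apply: (measurableT_comp mwv); exact: measurable_fun_pair.
- by move=> x; rewrite mule_ge0// lee_fin.
rewrite ge0_integral_sphere_graph//; last first.
  by apply: measurableT_comp => //; exact: measurable_rscale.
(* The scaling x = r y produced r^d. The other Jacobian r (r^2 - |x|^2)^(-1/2) has become (1 -
   |y|^2)^(-1/2), which is [sphere_density y], and the height has become r times that of the
   chart. *)
rewrite hposE r0 mul1r; congr (_ * _); apply: eq_integral => x _.
rewrite /w /v /sphere_chart/= rscale_vcons rsqnorm_rscale -[X in (X - _)%R]mulr1 -mulrBr.
rewrite (hposE r) r0 mul1r; congr (_%:E * F (vcons (_, _))).
  rewrite !hposE pmulr_rgt0 ?exprn_gt0//; case: ltP => q1; last by rewrite !mul0r.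
  rewrite !mul1r /sphere_density powRM ?exprn_ge0 ?(ltW r0) ?(ltW q1)//.
  rewrite -powR_mulrn ?(ltW r0)// -powRrM mulrN mulfV// powRN powRr1 ?(ltW r0)//.
  by rewrite mulrA divff ?gt_eqF// mul1r.
by rewrite sqrtrM ?exprn_ge0 ?(ltW r0)// sqrtr_sqr gtr0_norm// mulrCA.
Qed.

Lemma hpos_expr_ge0 (r : R) n : (0 <= hpos r * r ^+ n)%R.
Proof.
rewrite hposE; case: ltP => r0; rewrite ?mul0r// mul1r.
by rewrite exprn_ge0// ltW.
Qed.

Lemma measurable_hpos_expr n :
  measurable_fun setT (fun r : measurableTypeR R => (hpos r * r ^+ n)%R).
Proof.
apply: measurable_funM; first exact: measurable_hpos.
exact: measurable_funX.
Qed.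

Lemma measurable_radial_part (s : R) F : measurable_fun setT F ->
  (forall x, 0 <= F x) ->
  measurable_fun setT (fun r : measurableTypeR R =>
    (hpos r * r ^+ d)%:E * \int[sphere_graph s]_x F (rscale r x)).
Proof.
move=> mF F0; apply: emeasurable_funM.
  by apply/measurable_EFinP; exact: measurable_hpos_expr.
under eq_fun => r.
  rewrite ge0_integral_sphere_graph//; last first.
    by apply: measurableT_comp => //; exact: measurable_rscale.
  over.
apply: (measurable_fun_fubini_tonelli_F (fun p : measurableTypeR R * rvec R d =>
  (hpos (1 - rsqnorm p.2) * sphere_density p.2)%:E *
    F (rscale p.1 (sphere_chart s p.2)))); last first.
  by move=> p; rewrite mule_ge0// lee_fin mulr_ge0 ?hpos_ge0 ?powR_ge0.
apply: emeasurable_funM.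
  apply/measurable_EFinP; apply: measurable_funM.
    apply: (measurableT_comp measurable_hpos); apply: measurable_funB => //.
    exact: (measurableT_comp measurable_rsqnorm measurable_snd).
  exact: (measurableT_comp measurable_sphere_density measurable_snd).
apply: measurableT_comp => //; apply: measurable_rscale => //.
exact: (measurableT_comp (measurable_sphere_chart s) measurable_snd).
Qed.

Theorem ge0_integral_polar F : measurable_fun setT F -> (forall x, 0 <= F x) ->
  \int[lebesgue_rvec d.+1]_x F x =
  \int[mu]_r ((hpos r * r ^+ d)%:E * \int[sphere_rvec d.+1]_x F (rscale r x)).
Proof.
move=> mF F0; rewrite ge0_integral_rvecS_swap//.
have mFv x : measurable_fun setT (fun t : measurableTypeR R => F (vcons (t, x))).
  by apply: measurableT_comp => //; exact: measurable_vconsP.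
have mF2 s : measurable_fun setT (fun p : rvec R d * measurableTypeR R =>
    (hpos p.2)%:E * F (vcons ((s * p.2)%R, p.1))).
  apply: emeasurable_funM.
    apply/measurable_EFinP.
    by apply: (measurableT_comp measurable_hpos); exact: measurable_snd.
  apply: measurableT_comp => //; apply: measurable_vconsP => //.
  by apply: measurable_funM => //; exact: measurable_snd.
have F20 s (p : rvec R d * measurableTypeR R) :
    0 <= (hpos p.2)%:E * F (vcons ((s * p.2)%R, p.1)).
  by rewrite mule_ge0// lee_fin hpos_ge0.
(* The two summands are the half-spaces above and below the equator, for the graphs with s = 1 and s
   = -1. *)
transitivity (\int[lebesgue_rvec d]_x
    (\int[mu]_t ((hpos t)%:E * F (vcons ((1 * t)%R, x))) +
     \int[mu]_t ((hpos t)%:E * F (vcons ((-1 * t)%R, x))))).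
  apply: eq_integral => x _; rewrite ge0_integral_halves//; congr (_ + _);
    by apply: eq_integral => t _; rewrite ?mul1r ?mulN1r.
rewrite ge0_integralD//; last 4 first.
- by move=> x _; apply: integral_ge0 => t _; exact: (F20 1%R (x, t)).
- exact: measurable_fun_fubini_tonelli_F (mF2 1%R) (F20 1%R).
- by move=> x _; apply: integral_ge0 => t _; exact: (F20 (-1)%R (x, t)).
- exact: measurable_fun_fubini_tonelli_F (mF2 (-1)%R) (F20 (-1)%R).
rewrite !ge0_integral_polar_graph// -ge0_integralD//; last 4 first.
- by move=> r _; rewrite mule_ge0 ?integral_ge0// lee_fin; exact: hpos_expr_ge0.
- exact: measurable_radial_part.
- by move=> r _; rewrite mule_ge0 ?integral_ge0// lee_fin; exact: hpos_expr_ge0.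
- exact: measurable_radial_part.
apply: eq_integral => r _; rewrite -ge0_muleDr ?integral_ge0//.
congr (_ * _); rewrite [RHS]ge0_integral_measure_add//.
by apply: measurableT_comp => //; exact: measurable_rscale.
Qed.

End polar.

(** * Gamma-like integrals *)

Section gamma_primitive.
Context {R : realType}.

(** A primitive of u^n exp(-u), obtained by repeated integration by parts and normalized to vanish
    at infinity; its value at 0 is - n!. *)
Fixpoint gamma_primitive (n : nat) (u : R) : R :=
  (if n is n'.+1 then n%:R * gamma_primitive n' u - u ^+ n * expR (- u)
  else - expR (- u)).

Lemma is_derive_gamma_primitive n (u : R) :
  is_derive u 1 (gamma_primitive n) (u ^+ n * expR (- u)).
Proof.
elim: n => [|n IH]; rewrite /gamma_primitive -/gamma_primitive.
  apply: is_derive_eq; rewrite expr0 mul1r /GRing.scale/=; ring.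
have dE : is_derive u 1 (fun v => expR (- v)) (- expR (- u)).
  by apply: is_derive_eq; rewrite /GRing.scale/=; ring.
have dX : is_derive u 1 (fun v : R => v ^+ n.+1) (n.+1%:R * u ^+ n).
  apply: DeriveDef; first exact: exprn_derivable.
  by rewrite exp_derive /GRing.scale/= mulr1.
have := is_deriveB (is_deriveZ n.+1%:R IH) (is_deriveM dX dE).
rewrite /GRing.scale/= => dF; apply: (is_derive_eq dF).
by rewrite exprS; ring.
Qed.

(** From exp x >= x^(n+1) / (n+1)! follows x^n exp(-x) <= (n+1)! / x. *)
Lemma cvg_exprn_expRN n : (x ^+ n * expR (- x)) @[x --> +oo%R] --> (0 : R).
Proof.
apply: (@squeeze_cvgr _ _ _ _ (cst 0) (fun x : R => (n.+1)`!%:R * x^-1)).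
- near=> x; have x0 : (0 < x) by near: x; exact: nbhs_pinfty_gt.
  rewrite mulr_ge0 ?exprn_ge0 ?expR_ge0 ?(ltW x0)//=.
  rewrite expRN ler_pdivrMr ?expR_gt0// mulrAC ler_pdivlMr// -exprSr.
  rewrite mulrC -ler_pdivrMr ?ltr0n ?fact_gt0//.
  by apply: le_trans (expR_ge1Dxn n (ltW x0)); rewrite lerDr.
- exact: cvg_cst.
- rewrite -[X in _ --> X](mulr0 (n.+1)`!%:R).
  by apply: cvgMr; apply/gtr0_cvgV0; [near=> x|exact: cvg_id].
Unshelve. all: by end_near. Qed.

Lemma cvg_gamma_primitive n :
  gamma_primitive n x @[x --> +oo%R] --> (0 : R).
Proof.
elim: n => [|n IH] /=.
  by rewrite -oppr0; apply: cvgN; exact: cvgr_expR.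
rewrite -[X in _ --> X](subr0 (0 : R)) -[X in (X - _)](mulr0 n.+1%:R).
by apply: cvgB; [exact: cvgMr|exact: cvg_exprn_expRN].
Qed.

Lemma gamma_primitive0 n : gamma_primitive n 0 = (- (n`!)%:R).
Proof.
elim: n => [|n IH] /=; first by rewrite oppr0 expR0 fact0.
by rewrite IH exprS !mul0r subr0 factS natrM mulrN.
Qed.

End gamma_primitive.

Section gamma_integrals.
Local Open Scope ereal_scope.
Context {R : realType}.
Notation mu := (@lebesgue_measure R).

Lemma integral_exprn_expRN n :
  \int[mu]_u ((hpos u * (u ^+ n * expR (- u)))%:E) = (n`!%:R)%:E.
Proof.
have cf : continuous (fun u : R => u ^+ n * expR (- u))%R.
  move=> x; apply: cvgM; first exact: exprn_continuous.
  apply: (@continuous_comp _ _ _ (@GRing.opp R) expR).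
    exact: opp_continuous.
  exact: continuous_expR.
have mf : measurable_fun [set: R] (fun u : R => u ^+ n * expR (- u))%R.
  exact: continuous_measurable_fun.
have cF : continuous (gamma_primitive n : R -> R).
  move=> x; apply/differentiable_continuous/derivable1_diffP.
  by have [] := is_derive_gamma_primitive n x.
under eq_integral do rewrite EFinM.
rewrite integral_hpos integral_itv_obnd_cbnd; last first.
  exact/measurable_EFinP/measurable_funTS.
rewrite (@ge0_continuous_FTC2y _ _ (gamma_primitive n) _ 0%R).
- by rewrite gamma_primitive0 EFinN oppeK add0e.
- by move=> x x0; rewrite mulr_ge0 ?expR_ge0// exprn_ge0.
- exact: continuous_subspaceT.
- exact: cvg_gamma_primitive.
- by move=> x _; have [] := is_derive_gamma_primitive n x.
- by apply: cvg_at_right_filter; exact: cF.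
- move=> x _; rewrite derive1E.
  exact: (@derive_val _ _ _ _ _ _ _ (is_derive_gamma_primitive n x)).
Qed.

Lemma integral_expr_gauss n :
  \int[mu]_r ((hpos r * r ^+ n.*2.+1 * expR (- r ^+ 2))%:E) = (n`!%:R / 2)%:E.
Proof.
pose F (u : measurableTypeR R) := (hpos u * (u ^+ n * expR (- u)) / 2)%:E.
have mf : measurable_fun setT (fun u : measurableTypeR R => hpos u * (u ^+ n * expR (- u)))%R.
  apply: measurable_funM; first exact: measurable_hpos.
  apply: measurable_funM; first exact: measurable_funX.
  by apply: measurableT_comp => //; exact: measurableT_comp.
have mF : measurable_fun setT F by apply/measurable_EFinP; exact: measurable_funM.
have f0 u : (0 <= hpos u * (u ^+ n * expR (- u)))%R.
  by rewrite mulrA mulr_ge0 ?expR_ge0// hpos_expr_ge0.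
have F0 u : 0 <= F u by rewrite /F lee_fin divr_ge0//; exact: f0.
transitivity (\int[mu]_r ((hpos r * (2 * r))%:E * F (r ^+ 2)%R)).
  apply: eq_integral => r _; rewrite /F -EFinM !hposE; congr EFin.
  case: (ltP 0%R r) => r0; last by rewrite !mul0r.
  by rewrite exprn_gt0// !mul1r -exprM mul2n [(r ^+ _.*2.+1)%R]exprS; field.
rewrite ge0_integral_sqr// EFinM -integral_exprn_expRN -ge0_integralZr//; last 2 first.
- by apply/measurable_EFinP; exact: mf.
- by move=> u _; rewrite lee_fin; exact: f0.
apply: eq_integral => u _; rewrite /F -!EFinM hposE mulrA.
by case: ltP; rewrite ?mul1r// !mul0r.
Qed.

(** For an integer N >= x one has t^x <= 1 + t^N, as seen separately for t <= 1 and t > 1. The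
    integral is thus at most 0! + N!. *)
Lemma integral_powR_expRN_fin (x : R) : (0 <= x)%R ->
  \int[mu]_(t in `]0%R, +oo[) (t `^ x * expR (- t))%:E < +oo.
Proof.
have mE : measurable_fun setT (fun t : measurableTypeR R => expR (- t)).
  by apply: measurableT_comp => //; exact: measurableT_comp.
have mX n : measurable_fun setT (fun t : measurableTypeR R => t ^+ n * expR (- t))%R.
  by apply: measurable_funM => //; exact: measurable_funX.
move=> x0; have [N xN] : exists N, (x <= N%:R)%R.
  exists (Num.truncn x).+1; apply: ltW.
  by have /truncn_itv/andP[] := x0.
apply: (@le_lt_trans _ _ (\int[mu]_(t in `]0%R, +oo[)
    ((t ^+ 0 * expR (- t))%:E + (t ^+ N * expR (- t))%:E))).
  apply: ge0_le_integral => //.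
  - by move=> t _; rewrite lee_fin mulr_ge0 ?powR_ge0 ?expR_ge0.
  - apply/measurable_EFinP/measurable_funTS; apply: measurable_funM.
      exact: measurable_powR.
    exact: mE.
  - by apply/measurable_funTS; apply: emeasurable_funD; apply/measurable_EFinP; exact: mX.
  - move=> t /=; rewrite in_itv/= andbT => t0.
    rewrite -EFinD lee_fin expr0 -mulrDl ler_pM2r ?expR_gt0//.
    have [t1|t1] := leP t 1%R.
      rewrite (le_trans (y := 1%R))// ?lerDl ?exprn_ge0 ?(ltW t0)//.
      have := @ger_powR _ t; rewrite t0 t1 => /(_ isT 0%R x x0).
      by rewrite powRr0.
    rewrite -powR_mulrn ?(ltW t0)//.
    by rewrite (le_trans (ler_powR (ltW t1) xN))// lerDr.
rewrite ge0_integralD//; last 4 first.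
- move=> t /=; rewrite in_itv/= andbT => t0.
  by rewrite lee_fin mulr_ge0 ?expR_ge0// exprn_ge0// ltW.
- by apply/measurable_funTS/measurable_EFinP; exact: mX.
- move=> t /=; rewrite in_itv/= andbT => t0.
  by rewrite lee_fin mulr_ge0 ?expR_ge0// exprn_ge0// ltW.
- by apply/measurable_funTS/measurable_EFinP; exact: mX.
rewrite -!integral_hpos; under eq_integral do rewrite -EFinM.
rewrite integral_exprn_expRN; under eq_integral do rewrite -EFinM.
by rewrite integral_exprn_expRN -EFinD ltry.
Qed.

(** [Gamma] is a real-valued integral, which is 0 when the integral is infinite, so finiteness is
    part of the claim. The lower bound comes from [1, 2], where t^(x-1) >= 1 and exp(-t) >= exp(-2).
    The case x >= 1 covers [Gamma (n%:R + lam + 1)] for n >= 1 and lam > -1. *)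
Lemma Gamma_gt0 (x : R) : (1 <= x)%R -> (0 < Gamma x)%R.
Proof.
move=> x1; have x0 : (0 <= x - 1)%R by rewrite subr_ge0.
have mG : measurable_fun setT (fun t : measurableTypeR R => t `^ (x - 1) * expR (- t))%R.
  apply: measurable_funM; first exact: measurable_powR.
  by apply: measurableT_comp => //; exact: measurableT_comp.
have G0 t : (0 <= t `^ (x - 1) * expR (- t))%R.
  by rewrite mulr_ge0 ?powR_ge0 ?expR_ge0.
rewrite /Gamma /Rintegral fine_gt0// integral_powR_expRN_fin// andbT.
apply: (@lt_le_trans _ _ (\int[mu]_(t in `[1%R, 2%R]) (expR (- 2%R))%:E)).
  rewrite integral_cst//.
  apply: mule_gt0; first by rewrite lte_fin expR_gt0.
  rewrite [ltRHS]lebesgue_measure_itv/= lte_fin ltr1n.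
  by rewrite -EFinB lte_fin subr_gt0 ltr1n.
apply: (@le_trans _ _ (\int[mu]_(t in `[1%R, 2%R]) (t `^ (x - 1) * expR (- t))%:E)).
  apply: ge0_le_integral => //.
  - by apply/measurable_funTS/measurable_EFinP; exact: mG.
  - move=> t /=; rewrite in_itv/= => /andP[t1 t2]; rewrite lee_fin.
    rewrite -[leLHS]mul1r ler_pM ?expR_ge0//.
      by rewrite -[leLHS](powRr0 t); exact: ler_powR.
    by rewrite ler_expR lerN2.
apply: ge0_subset_integral => //.
- by apply/measurable_funTS/measurable_EFinP; exact: mG.
- by move=> t _; rewrite lee_fin; exact: G0.
- move=> t /=; rewrite !in_itv/= andbT => /andP[t1 _].
  exact: lt_le_trans t1.
Qed.

End gamma_integrals.

(** * Integrability of the weight (1 - r^2)^a up to the boundary of the ball *)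

Section ball_weight.
Local Open Scope ereal_scope.
Context {R : realType}.
Notation mu := (@lebesgue_measure R).

Lemma continuous_powR_gt0 (a x : R) : (0 < x)%R -> {for x, continuous (fun y : R => y `^ a)%R}.
Proof.
move=> x0; apply/differentiable_continuous/derivable1_diffP.
by have [] := is_derive1_powR a x0.
Qed.

(** The bound is independent of [e] and so survives the limit e -> 0: since a + 1 > 0, the term -
    e^(a+1) / (a+1) of the exact value is at most 0. *)
Lemma integral_powR_itv (a e : R) : (-1 < a)%R -> (0 < e < 1)%R ->
  \int[mu]_(x in `[e, 1%R]) (x `^ a)%:E <= ((a + 1)^-1)%:E.
Proof.
move=> a1 /andP[e0 e1]; have a0 : (0 < a + 1)%R by rewrite -ltrBlDr sub0r.
have dF (x : R) : (0 < x)%R ->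
    is_derive x 1%R (fun y : R => (a + 1)^-1 * y `^ (a + 1))%R (x `^ a)%R.
  move=> x0; have := is_deriveZ (a + 1)^-1 (is_derive1_powR (a + 1) x0).
  rewrite /GRing.scale/= => h; apply: (is_derive_eq h).
  by rewrite mulrA mulVf ?gt_eqF// mul1r addrK.
have cF (x : R) : (0 < x)%R ->
    {for x, continuous (fun y : R => (a + 1)^-1 * y `^ (a + 1))%R}.
  move=> x0; apply/differentiable_continuous/derivable1_diffP.
  by have [] := dF x x0.
rewrite (@continuous_FTC2 _ _ (fun y : R => (a + 1)^-1 * y `^ (a + 1))%R)//.
- rewrite -EFinB lee_fin powR1 mulr1 gerBl mulr_ge0 ?powR_ge0// invr_ge0 ltW//.
- apply: continuous_in_subspaceT => x /set_mem/=; rewrite in_itv/= => /andP[ex _].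
  by apply: continuous_powR_gt0; exact: lt_le_trans ex.
- split.
  + move=> x; rewrite in_itv/= => /andP[ex _].
    by have [] := dF x (lt_trans e0 ex).
  + by apply: cvg_at_right_filter; exact: cF.
  + by apply: cvg_at_left_filter; exact: cF.
- move=> x; rewrite in_itv/= => /andP[ex _].
  have dx := dF x (lt_trans e0 ex).
  by rewrite derive1E; exact: (@derive_val _ _ _ _ _ _ _ dx).
Qed.

Lemma integral_powR01 (a : R) : (-1 < a)%R ->
  \int[mu]_(x in `]0%R, 1%R]) (x `^ a)%:E < +oo.
Proof.
move=> a1.
(* The shift to n + 2 keeps the left end strictly below 1, as [integral_powR_itv] requires. *)
pose F (n : nat) := `[(n.+2%:R)^-1%R, 1%R]%classic : set (measurableTypeR R).
have ndF : nondecreasing_seq F.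
  move=> p q pq; rewrite subsetEset => x; rewrite /F/= !in_itv/= => /andP[px ->].
  by rewrite andbT (le_trans _ px)// lef_pV2 ?posrE ?ltr0n// ler_nat.
have mf : measurable_fun setT (fun x : measurableTypeR R => (x `^ a)%:E).
  by apply/measurable_EFinP; exact: measurable_powR.
have -> : `]0%R, 1%R]%classic = \bigcup_n F n.
  apply/seteqP; split => x /=; rewrite in_itv/=.
    move=> /andP[x0 x1]; exists (Num.truncn x^-1) => //; rewrite /F/= in_itv/= x1 andbT.
    rewrite invf_ple ?posrE ?ltr0n//.
    have /truncn_itv/andP[_ /ltW/le_trans] : (0 <= x^-1)%R by rewrite invr_ge0 ltW.
    by apply; rewrite ler_nat.
  move=> [n _]; rewrite /F/= in_itv/= => /andP[nx ->]; rewrite andbT.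
  by apply: lt_le_trans nx; rewrite invr_gt0 ltr0n.
have cvgF := @ge0_nondecreasing_set_cvg_integral _ _ _ F (fun x => (x `^ a)%:E) mu ndF.
apply: (@le_lt_trans _ _ ((a + 1)^-1)%:E); last exact: ltry.
apply: (cvge_le _ (cvgF _ _ _)) => //.
- apply: nearW => n; apply: integral_powR_itv => //.
  by rewrite invr_gt0 ltr0n invf_lt1 ?ltr0n// ltr1n.
- by move=> n; exact: measurable_itv.
- by move=> n; exact: measurable_funTS.
- by move=> n x _; rewrite lee_fin powR_ge0.
Qed.

Lemma ge0_integral_opp (F : measurableTypeR R -> \bar R) :
  measurable_fun setT F -> (forall x, 0 <= F x) ->
  \int[mu]_x F x = \int[mu]_x F (- x)%R.
Proof.
move=> mF F0.
apply: (@ge0_integral_image _ _ (measurableTypeR R) (measurableTypeR R) _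
  (fun x : measurableTypeR R => - x : measurableTypeR R)%R mu) => //.
  exact: measurableT_comp.
by move=> A mA; rewrite -[RHS]/(pushforward mu _ A); apply/esym; exact: lebesgue_measureN.
Qed.

(** For 0 < r < 1 one has r^(n+1) <= 2 r. The substitutions u = r^2 and v = 1 - u then lead to the
    integral of v^a over ]0, 1], finite because a > -1. *)
Lemma integral_radial_weight (a : R) n : (-1 < a)%R ->
  \int[mu]_r ((hpos r * r ^+ n.+1 * (hpos (1 - r ^+ 2) * (1 - r ^+ 2) `^ a))%:E) < +oo.
Proof.
move=> a1.
pose F (u : measurableTypeR R) := (hpos u * (hpos (1 - u) * (1 - u) `^ a))%:E.
have mB : measurable_fun setT (fun u : measurableTypeR R => 1 - u : measurableTypeR R)%R.
  exact: measurable_funB.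
have mF : measurable_fun setT F.
  apply/measurable_EFinP; apply: measurable_funM; first exact: measurable_hpos.
  apply: measurable_funM; first exact: (measurableT_comp measurable_hpos mB).
  exact: (measurableT_comp (measurable_powR a) mB).
have F0 u : 0 <= F u.
  by rewrite /F lee_fin mulr_ge0 ?hpos_ge0// mulr_ge0 ?hpos_ge0 ?powR_ge0.
have mX2 : measurable_fun setT (fun r : measurableTypeR R => 1 - r ^+ 2 : measurableTypeR R)%R.
  by apply: measurable_funB => //; exact: measurable_funX.
apply: (@le_lt_trans _ _ (\int[mu]_r ((hpos r * (2 * r))%:E * F (r ^+ 2)%R))).
  apply: ge0_le_integral => //.
  - move=> r _; rewrite lee_fin mulr_ge0 ?hpos_expr_ge0//.
    by rewrite mulr_ge0 ?hpos_ge0 ?powR_ge0.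
  - apply/measurable_EFinP; apply: measurable_funM; first exact: measurable_hpos_expr.
    apply: measurable_funM; first exact: (measurableT_comp measurable_hpos mX2).
    exact: (measurableT_comp (measurable_powR a) mX2).
  - apply: emeasurable_funM.
      apply/measurable_EFinP; apply: measurable_funM; first exact: measurable_hpos.
      exact: measurable_funM.
    by apply: measurableT_comp => //; exact: measurable_funX.
  - move=> r _; rewrite /F -EFinM lee_fin (hposE r).
    have [r0|r0] := ltP 0%R r; last by rewrite !mul0r.
    rewrite !mul1r [hpos (r ^+ 2)%R]hposE exprn_gt0// mul1r.
    rewrite hposE subr_gt0; case: (ltP (r ^+ 2)%R 1%R) => r1; last by rewrite mul0r !mulr0.
    rewrite mul1r ler_wpM2r ?powR_ge0//.
    have {}r1 : (r <= 1)%R by rewrite -(@expr_le1 _ 2) ?ltW.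
    rewrite exprS mulrC ler_pM ?exprn_ge0 ?(ltW r0)//.
    by rewrite (@le_trans _ _ 1%R) ?ler1n// exprn_ile1// ltW.
rewrite ge0_integral_sqr//.
have -> : \int[mu]_u ((hpos u)%:E * F u) = \int[mu]_u F u.
  apply: eq_integral => u _; rewrite /F -EFinM hposE.
  by case: ltP => _; rewrite ?mul1r// !mul0r.
(* A reflection followed by a shift by -1 is the substitution u -> 1 - u. *)
rewrite ge0_integral_opp// (@ge0_integral_shift _ (-1)%R)//; last first.
  by apply: measurableT_comp => //; exact: measurableT_comp.
apply: le_lt_trans (integral_powR01 a1).
rewrite [leRHS]integral_mkcond; apply: ge0_le_integral => //.
- by apply: measurableT_comp => //; apply: measurableT_comp => //; exact: measurable_funD.
- apply/(measurable_restrictT _ _).1 => //; apply/measurable_funTS.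
  by apply/measurable_EFinP; exact: measurable_powR.
move=> u _; rewrite patchE mem_setE in_itv/= /F !hposE opprB.
have -> : (1 - (1 - u) = u)%R by ring.
have [u0|u0] := ltP 0%R u; last by rewrite /= mul0r mulr0.
rewrite /= mul1r subr_gt0; have [u1|u1] := ltP u 1%R.
  by rewrite (ltW u1) mul1r.
by rewrite mul0r; case: ifPn; rewrite // lee_fin powR_ge0.
Qed.

End ball_weight.

(** * Moments of the sphere *)

Section sphere_support.
Local Open Scope ereal_scope.
Context {R : realType}.

Lemma rsqnorm_sphere_chart d (s : R) (x : rvec R d) : (s ^+ 2 = 1)%R ->
  (rsqnorm x < 1)%R -> rsqnorm (sphere_chart s x) = 1%R.
Proof.
move=> s1 x1; rewrite rsqnorm_vcons exprMn s1 mul1r sqr_sqrtr ?subrK//.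
by rewrite subr_ge0 ltW.
Qed.

(** The measure is carried by the unit sphere, because the charts with s^2 = 1 take their values
    there. This is how homogeneity is used: after a dilation by r, powers of r can be pulled out on
    the sphere only. *)
Lemma eq_integral_sphere n (F G : rvec R n -> \bar R) :
  measurable_fun setT F -> (forall x, 0 <= F x) ->
  measurable_fun setT G -> (forall x, 0 <= G x) ->
  (forall x, rsqnorm x = 1%R -> F x = G x) ->
  \int[sphere_rvec n]_x F x = \int[sphere_rvec n]_x G x.
Proof.
case: n F G => [|d] F G mF F0 mG G0 FG.
  by rewrite !integral_measure_zero.
rewrite !ge0_integral_measure_add//.
have graph (s : R) : (s ^+ 2 = 1)%R ->
    \int[sphere_graph s]_x F x = \int[sphere_graph s]_x G x.
  move=> s1; rewrite !ge0_integral_sphere_graph//; apply: eq_integral => x _.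
  rewrite hposE subr_gt0; case: ltP => x1; last by rewrite !mul0r !mul0e.
  by rewrite FG// rsqnorm_sphere_chart.
by rewrite !graph ?expr1n// sqrrN expr1n.
Qed.

Lemma integral_sphere_radial d (g : R -> \bar R) : (0 < d)%N ->
  measurable_fun setT (g : measurableTypeR R -> \bar R) -> (forall t, 0 <= g t) ->
  \int[lebesgue_rvec d]_x g (rsqnorm x) =
  sphere_rvec d setT * \int[lebesgue_measure]_r ((hpos r * r ^+ d.-1)%:E * g (r ^+ 2)%R).
Proof.
case: d => // d _ mg g0.
have mgs : measurable_fun setT (fun x : rvec R d.+1 => g (rsqnorm x)).
  exact: (measurableT_comp mg measurable_rsqnorm).
rewrite ge0_integral_polar// -ge0_integralZl//; last 2 first.
- apply: emeasurable_funM; first by apply/measurable_EFinP; exact: measurable_hpos_expr.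
  by apply: measurableT_comp => //; exact: measurable_funX.
- by move=> r _; rewrite mule_ge0// lee_fin hpos_expr_ge0.
apply: eq_integral => r _; rewrite [RHS]muleCA; congr (_ * _).
rewrite (@eq_integral_sphere _ _ (cst (g (r ^+ 2)%R)))//.
- by rewrite integral_cst// muleC.
- by apply: (measurableT_comp mgs); exact: measurable_rscale.
- by move=> x; exact: g0.
- by move=> x x1; rewrite rsqnorm_rscale x1 mulr1.
Qed.

End sphere_support.

Section complex_moments.
Local Open Scope ereal_scope.
Context {R : realType}.
Notation mu := (@lebesgue_measure R).

(** The squared norm |z|^2 of the vector z of C^k with coordinates z_i = s_(2i) + i s_(2i+1). *)
Definition csq (k : nat) (s : seq R) : R :=
  (\sum_(i < k) (nth 0 s i.*2 ^+ 2 + nth 0 s i.*2.+1 ^+ 2))%R.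

(** In the same notation, |z^a|^2. *)
Definition cweight (k : nat) (a : 'I_k -> nat) (s : seq R) : R :=
  (\prod_(i < k) (nth 0 s i.*2 ^+ 2 + nth 0 s i.*2.+1 ^+ 2) ^+ a i)%R.

Lemma rsqnorm_nth n (x : rvec R n) : rsqnorm x = (\sum_(i < n) nth 0 x i ^+ 2)%R.
Proof. by apply: eq_bigr => i _; rewrite (tnth_nth 0%R). Qed.

Lemma csq_rsqnorm k (x : rvec R k.*2) : csq k x = rsqnorm x.
Proof.
rewrite rsqnorm_nth /csq; move: (val x) => {x} s.
elim: k s => [|k IH] s; first by rewrite !big_ord0.
by rewrite doubleS big_ord_recr IH !big_ord_recr/= -addrA.
Qed.

Lemma cweight_ge0 k (a : 'I_k -> nat) s : (0 <= cweight a s)%R.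
Proof. by apply: prodr_ge0 => i _; rewrite exprn_ge0// addr_ge0 ?sqr_ge0. Qed.

Lemma cweight_scale k (a : 'I_k -> nat) (c : R) (s : seq R) :
  size s = k.*2 ->
  cweight a (map ( *%R c) s) = (c ^+ (\sum_(i < k) a i).*2 * cweight a s)%R.
Proof.
move=> sk; rewrite -muln2 big_distrl -prodrXr -big_split; apply: eq_bigr => i _ /=.
rewrite !(nth_map 0%R) ?sk ?ltn_double ?ltn_Sdouble//.
by rewrite !exprMn -mulrDr exprMn -exprM mulnC.
Qed.

Lemma measurable_nth n i :
  measurable_fun setT (fun x : rvec R n => nth 0%R x i : measurableTypeR R).
Proof.
have [ni|ni] := ltnP i n.
  rewrite (_ : (fun _ => _) = (fun x => tnth x (Ordinal ni))).
    exact: measurable_tnth.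
  by apply/funext => x; rewrite (tnth_nth 0%R).
rewrite (_ : (fun _ => _) = cst 0%R) //.
by apply/funext => x; rewrite nth_default// size_tuple.
Qed.

Lemma measurable_cweight n k (a : 'I_k -> nat) :
  measurable_fun setT (fun x : rvec R n => cweight a x).
Proof.
apply: measurable_prod => i _; apply: measurable_funX.
by apply: measurable_funD; apply: measurable_funX; exact: measurable_nth.
Qed.

Lemma measurable_csq n k : measurable_fun setT (fun x : rvec R n => csq k x).
Proof.
apply: measurable_sum => i.
by apply: measurable_funD; apply: measurable_funX; exact: measurable_nth.
Qed.

Lemma cweightS k (a : 'I_k.+1 -> nat) (t u : R) (s : seq R) :
  cweight a (t :: u :: s) =
  ((t ^+ 2 + u ^+ 2) ^+ a ord0 * cweight (fun i => a (lift ord0 i)) s)%R.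
Proof. by rewrite /cweight big_ord_recl. Qed.

Lemma integral_sphere_gauss k (n : nat) :
  \int[@lebesgue_rvec R k.+1.*2]_x (rsqnorm x ^+ n * expR (- rsqnorm x))%:E =
  @sphere_rvec R k.+1.*2 setT * ((k + n)`!%:R / 2)%:E.
Proof.
(* The absolute value makes [g] nonnegative on all of R; only its values at q >= 0 matter. *)
pose g (q : R) := (`|q| ^+ n * expR (- q))%:E.
have mg : measurable_fun setT (g : measurableTypeR R -> \bar R).
  apply/measurable_EFinP; apply: measurable_funM.
    by apply: measurable_funX; exact: normr_measurable.
  by apply: measurableT_comp => //; exact: measurableT_comp.
have g0 q : 0 <= g q by rewrite lee_fin mulr_ge0 ?expR_ge0// exprn_ge0.
transitivity (\int[@lebesgue_rvec R k.+1.*2]_x g (rsqnorm x)).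
  by apply: eq_integral => x _; rewrite /g ger0_norm// rsqnorm_ge0.
rewrite integral_sphere_radial//; congr (_ * _).
rewrite -integral_expr_gauss; apply: eq_integral => r _; rewrite /g -EFinM.
have -> : ((k + n).*2.+1 = (k.+1.*2).-1 + 2 * n)%N by rewrite doubleD mul2n.
by rewrite ger0_norm ?sqr_ge0// -exprM exprD !mulrA.
Qed.

(** The Gaussian integral over the plane is pi, the square of the one over the line, and in polar
    coordinates it is half the length of the circle. *)
Lemma sphere_circle : @sphere_rvec R 2 setT = (2 * pi : R)%:E.
Proof.
have := integral_sphere_gauss 0 0; rewrite addn0 fact0.
rewrite ge0_integral_rvecS//; last 2 first.
- apply/measurable_EFinP; under eq_fun do rewrite expr0 mul1r.
  apply: measurableT_comp => //; apply: measurableT_comp => //.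
  exact: measurable_rsqnorm.
- by move=> x; rewrite lee_fin expr0 mul1r expR_ge0.
under eq_integral => t _.
  rewrite ge0_integral_rvecS//; last 2 first.
  - apply/measurable_EFinP; under eq_fun do rewrite expr0 mul1r rsqnorm_vcons.
    apply: measurableT_comp => //; apply: measurableT_comp => //.
    by apply: measurable_funD => //; exact: measurable_rsqnorm.
  - by move=> x; rewrite lee_fin expr0 mul1r expR_ge0.
  under eq_integral => u _.
    rewrite ge0_integral_rvec0//; last first.
    - by move=> x; rewrite lee_fin expr0 mul1r expR_ge0.
    - apply/measurable_EFinP; under eq_fun do rewrite expr0 mul1r !rsqnorm_vcons.
      apply: measurableT_comp => //; apply: measurableT_comp => //.
      by do 2 apply: measurable_funD => //; exact: measurable_rsqnorm.
    rewrite expr0 mul1r !rsqnorm_vcons /rsqnorm big_ord0 addr0 opprD expRD EFinM.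
    over.
  rewrite ge0_integralZl//; last first.
    by apply/measurable_EFinP; exact: measurable_gauss_fun.
  rewrite [X in _ * X]integralT_gauss muleC.
  over.
rewrite ge0_integralZl//; last first.
  by apply/measurable_EFinP; exact: measurable_gauss_fun.
rewrite [X in _ * X]integralT_gauss -EFinM -expr2 sqr_sqrtr ?pi_ge0//.
(* At this point the length might still be infinite; that would make the Gaussian integral
   infinite. *)
case: (@sphere_rvec R 2 setT) => [x||] //.
- by rewrite -EFinM => -[->]; rewrite mul1r mulrCA divff// mulr1.
- by rewrite gt0_mulye// lte_fin divr_gt0// ltr0n.
- by rewrite gt0_mulNye// lte_fin divr_gt0// ltr0n.
Qed.

(** Polar coordinates in one complex variable: the length 2 pi times the radial integral n! / 2. *)
Lemma integral_plane_moment n :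
  \int[mu]_t \int[mu]_u ((t ^+ 2 + u ^+ 2) ^+ n * expR (- (t ^+ 2 + u ^+ 2)))%:E =
  (pi * n`!%:R)%:E.
Proof.
have := integral_sphere_gauss 0 n; rewrite add0n sphere_circle -EFinM.
have -> : (2 * pi * (n`!%:R / 2) = pi * n`!%:R :> R)%R by field.
move=> <-; pose F d (x : rvec R d) := (rsqnorm x ^+ n * expR (- rsqnorm x))%:E.
have mF0 : measurable_fun setT (fun q : measurableTypeR R => q ^+ n * expR (- q))%R.
  apply: measurable_funM; first exact: measurable_funX.
  by apply: measurableT_comp => //; exact: measurableT_comp.
have mF d : measurable_fun setT (@F d).
  apply/measurable_EFinP; exact: (measurableT_comp mF0 measurable_rsqnorm).
have F0 d (x : rvec R d) : 0 <= F d x.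
  by rewrite lee_fin mulr_ge0 ?expR_ge0// exprn_ge0// rsqnorm_ge0.
rewrite [RHS](ge0_integral_rvecS (mF 2%N) (F0 2%N)); apply: eq_integral => t _.
have mv d (t0 : R) : measurable_fun setT (fun x : rvec R d => vcons (t0, x)).
  exact: measurable_vconsP.
rewrite ge0_integral_rvecS//; last exact: (measurableT_comp (mF 2%N) (mv _ _)).
apply: eq_integral => u _.
rewrite ge0_integral_rvec0//; last first.
  exact: (measurableT_comp (measurableT_comp (mF 2%N) (mv _ _)) (mv _ _)).
by rewrite /F !rsqnorm_vcons /rsqnorm big_ord0 addr0.
Qed.

(** The integrand is a product over the complex coordinates; each induction step peels off two real
    coordinates, whose integral is a plane moment. *)
Lemma integral_cweight_gauss k (a : 'I_k -> nat) :
  \int[@lebesgue_rvec R k.*2]_x (cweight a x * expR (- rsqnorm x))%:E =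
  (\prod_(i < k) (pi * (a i)`!%:R))%:E.
Proof.
pose F k (a : 'I_k -> nat) d (x : rvec R d) := (cweight a x * expR (- rsqnorm x))%:E.
have mF k' (a' : 'I_k' -> nat) d : measurable_fun setT (@F k' a' d).
  apply/measurable_EFinP; apply: measurable_funM; first exact: measurable_cweight.
  apply: measurableT_comp => //; apply: measurableT_comp => //.
  exact: measurable_rsqnorm.
have F0 k' (a' : 'I_k' -> nat) d (x : rvec R d) : 0 <= F k' a' d x.
  by rewrite lee_fin mulr_ge0 ?expR_ge0// cweight_ge0.
have mv d (t0 : R) : measurable_fun setT (fun x : rvec R d => vcons (t0, x)).
  exact: measurable_vconsP.
elim: k a => [|k IH] a.
  rewrite big_ord0 (ge0_integral_rvec0 (mF 0%N a 0%N)); last exact: F0.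
  by rewrite /F /cweight /rsqnorm !big_ord0 oppr0 expR0 mulr1.
pose g (t u : R) := ((t ^+ 2 + u ^+ 2) ^+ a ord0 * expR (- (t ^+ 2 + u ^+ 2)))%R.
pose a' i := a (lift ord0 i).
have g0 t u : (0 <= g t u)%R.
  by rewrite mulr_ge0 ?expR_ge0// exprn_ge0// addr_ge0 ?sqr_ge0.
have mg2 : measurable_fun setT (fun p : measurableTypeR R * measurableTypeR R => (g p.1 p.2)%:E).
  apply/measurable_EFinP; apply: measurable_funM.
    by apply: measurable_funX; apply: measurable_funD; apply: measurable_funX.
  do 2 apply: measurableT_comp => //.
  by apply: measurable_funD; apply: measurable_funX.
have FE t u x : F k.+1 a _ (vcons (t, vcons (u, x))) = (g t u)%:E * F k a' k.*2 x.
  rewrite /F cweightS !rsqnorm_vcons addrA opprD expRD -EFinM; congr EFin.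
  by rewrite /g; ring.
pose c : R := (\prod_(i < k) (pi * (a' i)`!%:R))%R.
have c0 : (0 <= c)%R by apply: prodr_ge0 => i _; rewrite mulr_ge0 ?pi_ge0.
rewrite [LHS](ge0_integral_rvecS (mF _ _ _) (F0 _ _ _)).
transitivity (\int[mu]_t \int[mu]_u ((g t u)%:E * c%:E)).
  apply: eq_integral => t _; rewrite ge0_integral_rvecS//; last first.
    exact: (measurableT_comp (mF _ _ _) (mv _ _)).
  apply: eq_integral => u _; under eq_integral do rewrite FE.
  rewrite ge0_integralZl ?lee_fin//; first by rewrite /c -IH.
  exact: mF.
transitivity (\int[mu]_t ((\int[mu]_u (g t u)%:E) * c%:E)).
  apply: eq_integral => t _; rewrite ge0_integralZr ?lee_fin//.
    exact: (measurable_fun_pair2 t mg2).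
  by move=> u _; rewrite lee_fin.
rewrite ge0_integralZr ?lee_fin//; last 2 first.
- by apply: (measurable_fun_fubini_tonelli_F _ mg2) => p; rewrite lee_fin.
- by move=> t _; apply: integral_ge0 => u _; rewrite lee_fin.
by rewrite integral_plane_moment -EFinM big_ord_recl.
Qed.

(* Both sides of the Gaussian moment of C^k are computed: coordinate by coordinate,
   and in polar coordinates. *)
Lemma sphere_moment k (a : 'I_k.+1 -> nat) :
  \int[@sphere_rvec R k.+1.*2]_x (cweight a x)%:E =
  (2 * \prod_(i < k.+1) (pi * (a i)`!%:R) / (k + \sum_(i < k.+1) a i)`!%:R)%:E.
Proof.
have := integral_cweight_gauss a.
have mc d : measurable_fun setT (fun x : rvec R d => (cweight a x)%:E).
  by apply/measurable_EFinP; exact: measurable_cweight.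
rewrite [LHS]ge0_integral_polar; last 2 first.
- apply/measurable_EFinP; apply: measurable_funM; first exact: measurable_cweight.
  by do 2 apply: measurableT_comp => //; exact: measurable_rsqnorm.
- by move=> x; rewrite lee_fin mulr_ge0 ?expR_ge0 ?cweight_ge0.
set s := (X in _ -> X = _); set p := (\sum_(i < k.+1) a i)%N; set c := (\prod_(i < _) _)%R.
have s0 : 0 <= s by apply: integral_ge0 => x _; rewrite lee_fin cweight_ge0.
have sE : \int[mu]_r ((hpos r * r ^+ (k.*2.+1))%:E *
    \int[@sphere_rvec R k.+1.*2]_x
      (cweight a (rscale r x) * expR (- rsqnorm (rscale r x)))%:E) =
    ((k + p)`!%:R / 2)%:E * s.
  rewrite -integral_expr_gauss -ge0_integralZr//; last 2 first.
  - apply/measurable_EFinP; apply: measurable_funM; first exact: measurable_hpos_expr.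
    exact: measurable_gauss_fun.
  - by move=> r _; rewrite lee_fin mulr_ge0 ?expR_ge0 ?hpos_expr_ge0.
  apply: eq_integral => r _.
  (* For |x| = 1 the weight at r x is r^(2p) times the weight at x, and the Gaussian factor depends
     on r alone. *)
  rewrite (@eq_integral_sphere _ _ _
      (fun x => (r ^+ p.*2 * expR (- r ^+ 2))%:E * (cweight a x)%:E))//.
  - rewrite ge0_integralZl//; last 3 first.
    + exact: mc.
    + by move=> x _; rewrite lee_fin cweight_ge0.
    + by rewrite lee_fin mulr_ge0 ?expR_ge0// -mul2n exprM exprn_ge0// sqr_ge0.
    rewrite muleA -EFinM doubleD -addSn exprD; congr (_%:E * _); ring.
  - apply/measurable_EFinP; apply: measurable_funM.
      apply: (measurableT_comp (@measurable_cweight _ k.+1 a)).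
      exact: measurable_rscale.
    do 2 apply: measurableT_comp => //.
    by apply: (measurableT_comp measurable_rsqnorm); exact: measurable_rscale.
  - by move=> x; rewrite lee_fin mulr_ge0 ?expR_ge0 ?cweight_ge0.
  - by apply: emeasurable_funM => //; exact: mc.
  - move=> x; rewrite -EFinM lee_fin !mulr_ge0 ?expR_ge0 ?cweight_ge0//.
    by rewrite -mul2n exprM exprn_ge0// sqr_ge0.
  - move=> x x1; rewrite rsqnorm_rscale x1 mulr1 -EFinM.
    rewrite cweight_scale ?size_tuple// -/p; congr EFin; ring.
rewrite [X in X = _]sE.
have N0 : (0 < (k + p)`!%:R / 2 :> R)%R by rewrite divr_gt0// ltr0n fact_gt0.
(* An infinite moment is excluded because the Gaussian moment is finite; otherwise the equation is
   solved for [s]. *)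
case: s {s0 sE} => [x||] //.
- rewrite -EFinM => -[<-]; congr EFin; field.
  by rewrite pnatr_eq0 -lt0n fact_gt0.
- by rewrite gt0_muley.
- by rewrite gt0_muleNy.
Qed.
End complex_moments.

(** * Integration block by block *)

Section rint.
Local Open Scope ereal_scope.
Context {R : realType}.

(* Functions of real vectors are functions of sequences here, so that vectors
   of provably equal dimensions need no transport. *)
Definition rint (n : nat) (F : seq R -> \bar R) : \bar R :=
  \int[@lebesgue_rvec R n]_x F x.

Definition rmeas (n : nat) d (T : measurableType d) (F : seq R -> T) : Prop :=
  measurable_fun setT (fun x : rvec R n => F x).

Lemma measurable_cat n1 n2 : measurable_fun setT
  (fun p : rvec R n1 * rvec R n2 => cat_tuple p.1 p.2 : rvec R (n1 + n2)).
Proof.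
apply/measurable_fun_tnthP => i.
have E (p : rvec R n1 * rvec R n2) : tnth (cat_tuple p.1 p.2) i =
    (if (i < n1)%N then nth 0%R p.1 i else nth 0%R p.2 (i - n1))%R.
  by rewrite (tnth_nth 0%R)/= nth_cat size_tuple.
under [X in measurable_fun _ X]eq_fun do rewrite /= E.
have [_|_] := ltnP i n1.
  exact: (measurableT_comp (measurable_nth i) measurable_fst).
exact: (measurableT_comp (measurable_nth (i - n1)) measurable_snd).
Qed.

Lemma rmeas_cat n1 n2 d (T : measurableType d) (F : seq R -> T) :
  rmeas (n1 + n2) F ->
  measurable_fun setT (fun p : rvec R n1 * rvec R n2 => F (p.1 ++ p.2)).
Proof. by move=> mF; exact: (measurableT_comp mF (@measurable_cat n1 n2)). Qed.

Lemma rmeas_cons n d (T : measurableType d) (F : seq R -> T) t :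
  rmeas n.+1 F -> rmeas n (fun s => F (t :: s)).
Proof.
move=> mF; have mv : measurable_fun setT (fun x : rvec R n => vcons (t, x)).
  exact: measurable_vconsP.
exact: (measurableT_comp mF mv).
Qed.

Lemma rint_cons n F : rmeas n.+1 F -> (forall s, 0 <= F s) ->
  rint n.+1 F = \int[lebesgue_measure]_t rint n (fun s => F (t :: s)).
Proof. by move=> mF F0; rewrite /rint ge0_integral_rvecS. Qed.

Lemma rint_cat n1 n2 F : rmeas (n1 + n2) F -> (forall s, 0 <= F s) ->
  rint (n1 + n2) F = rint n1 (fun s => rint n2 (fun t => F (s ++ t))).
Proof.
elim: n1 F => [|n1 IH] F mF F0.
  rewrite [RHS]ge0_integral_rvec0//; last by move=> x; exact: integral_ge0.
  exact: measurable_fun_fubini_tonelli_F (rmeas_cat mF) _.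
rewrite addSn rint_cons// rint_cons//; last 2 first.
- exact: measurable_fun_fubini_tonelli_F (rmeas_cat mF) _.
- by move=> s; exact: integral_ge0.
apply: eq_integral => t _; rewrite IH//.
exact: rmeas_cons.
Qed.

End rint.

Section blocks.
Local Open Scope ereal_scope.
Context {R : realType}.

Definition offset {m} (k : 'I_m -> nat) (l : 'I_m) : nat :=
  \sum_(i < m | (i < l)%N) k i.

(** The real coordinates of block [l], the complex coordinate i occupying the places 2i and 2i + 1.
    Through [nth] it is total, and its result always has length 2 k_l. *)
Definition seg {m} (k : 'I_m -> nat) (l : 'I_m) (s : seq R) : seq R :=
  mkseq (fun i => nth 0%R s ((offset k l).*2 + i)) (k l).*2.

Lemma offset0 m (k : 'I_m.+1 -> nat) : offset k ord0 = 0%N.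
Proof. by rewrite /offset big1. Qed.

Lemma offsetS m (k : 'I_m.+1 -> nat) l :
  offset k (lift ord0 l) = (k ord0 + offset (k \o lift ord0) l)%N.
Proof. by rewrite /offset big_mkcond big_ord_recl/= [in RHS]big_mkcond. Qed.

Lemma seg_cat0 m (k : 'I_m.+1 -> nat) (s t : seq R) : size s = (k ord0).*2 ->
  seg k ord0 (s ++ t) = s.
Proof.
move=> sk; apply: (@eq_from_nth _ 0%R); rewrite size_mkseq// => i ik.
by rewrite nth_mkseq// offset0 add0n nth_cat sk ik.
Qed.

Lemma seg_catS m (k : 'I_m.+1 -> nat) l (s t : seq R) : size s = (k ord0).*2 ->
  seg k (lift ord0 l) (s ++ t) = seg (k \o lift ord0) l t.
Proof.
move=> sk; apply: eq_mkseq => i.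
by rewrite offsetS doubleD -addnA nth_cat sk ltnNge leq_addr/= addKn.
Qed.

Lemma rmeas_seg m (k : 'I_m -> nat) l n d (T : measurableType d) (F : seq R -> T) :
  rmeas (k l).*2 F -> rmeas n (fun s => F (seg k l s)).
Proof.
move=> mF; pose g (x : rvec R n) : rvec R (k l).*2 :=
  [tuple nth 0%R x ((offset k l).*2 + i) | i < (k l).*2].
have gE (x : rvec R n) : seg k l x = g x.
  by rewrite /seg /mkseq -val_enum_ord -map_comp.
rewrite /rmeas; under eq_fun do rewrite gE.
apply: (measurableT_comp mF); apply/measurable_fun_tnthP => i.
rewrite (_ : _ \o _ = fun x : rvec R n => nth 0%R x ((offset k l).*2 + i)).
  exact: measurable_nth.
by apply/funext => x /=; rewrite tnth_mktuple.
Qed.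

Lemma mktupleS m (f : 'I_m.+1 -> R) :
  [tuple f l | l < m.+1] = vcons (f ord0, [tuple f (lift ord0 l) | l < m]).
Proof.
apply: eq_from_tnth => l; rewrite tnth_mktuple.
case: (unliftP ord0 l) => [i ->|->]; last by [].
by rewrite tnth_vconsS tnth_mktuple.
Qed.

Definition radial_density m (p : 'I_m -> nat) (r : rvec R m) : R :=
  (\prod_(l < m) (hpos (tnth r l) * tnth r l ^+ p l))%R.

Lemma radial_density_ge0 m (p : 'I_m -> nat) r : (0 <= radial_density p r)%R.
Proof. by apply: prodr_ge0 => l _; exact: hpos_expr_ge0. Qed.

Lemma measurable_radial_density m (p : 'I_m -> nat) :
  measurable_fun setT (radial_density p).
Proof.
apply: measurable_prod => l _.
exact: (measurableT_comp (measurable_hpos_expr (p l)) (measurable_tnth l)).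
Qed.

Lemma radial_densityS m (p : 'I_m.+1 -> nat) t r :
  radial_density p (vcons (t, r)) =
  (hpos t * t ^+ p ord0 * radial_density (p \o lift ord0) r)%R.
Proof.
rewrite /radial_density big_ord_recl; congr *%R.
by apply: eq_bigr => l _; rewrite tnth_vconsS.
Qed.

(** Polar coordinates on one block with the angles integrated out: [N] is the radius, [p] collects
    the power of r from the volume element and from the homogeneous weight [w], and [C] is the
    integral of [w] over the sphere. *)
Definition radial_block (n : nat) (N w : seq R -> R) (p : nat) (C : R) :=
  forall h : measurableTypeR R -> \bar R, measurable_fun setT h ->
  (forall t, 0 <= h t) ->
  rint n (fun s => h (N s) * (w s)%:E) =
  C%:E * \int[lebesgue_measure]_r ((hpos r * r ^+ p)%:E * h r).

Definition seg_norms m (k : 'I_m -> nat) (N : 'I_m -> seq R -> R) (s : seq R) :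
  rvec R m := [tuple N l (seg k l s) | l < m].

Lemma rmeas_seg_norms m (k : 'I_m -> nat) (N : 'I_m -> seq R -> measurableTypeR R) n :
  (forall l, rmeas (k l).*2 (N l)) -> rmeas n (seg_norms k N).
Proof.
move=> mN; apply/measurable_fun_tnthP => l.
rewrite (_ : _ \o _ = fun x : rvec R n => N l (seg k l x)).
  exact: rmeas_seg.
by apply/funext => x /=; rewrite tnth_mktuple.
Qed.

Lemma rmeas_seg_prod m (k : 'I_m -> nat) (w : 'I_m -> seq R -> R) n :
  (forall l, rmeas (k l).*2 (w l)) ->
  rmeas n (fun s => \prod_(l < m) w l (seg k l s))%R.
Proof. by move=> mw; apply: measurable_prod => l _; exact: rmeas_seg. Qed.

Lemma seg_norms_cat m (k : 'I_m.+1 -> nat) N (s t : seq R) :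
  size s = (k ord0).*2 -> seg_norms k N (s ++ t) =
  vcons (N ord0 s, seg_norms (k \o lift ord0) (N \o lift ord0) t).
Proof.
move=> sk; rewrite /seg_norms mktupleS seg_cat0//; congr (vcons (_, _)).
by apply: eq_from_tnth => l; rewrite !tnth_mktuple seg_catS.
Qed.

Lemma seg_prod_cat m (k : 'I_m.+1 -> nat) (w : 'I_m.+1 -> seq R -> R) (s t : seq R) :
  size s = (k ord0).*2 -> (\prod_(l < m.+1) w l (seg k l (s ++ t)) =
  w ord0 s * \prod_(l < m) (w \o lift ord0) l (seg (k \o lift ord0) l t))%R.
Proof.
move=> sk; rewrite big_ord_recl seg_cat0//; congr *%R.
by apply: eq_bigr => l _; rewrite seg_catS.
Qed.

(** Induction on the number of blocks. Concatenation splits off the first one, the induction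
    hypothesis integrates over the others with the first radius fixed, and the property of the first
    block is applied to the result. *)
Lemma rint_blocks m (k : 'I_m -> nat) (N w : 'I_m -> seq R -> measurableTypeR R)
    (p : 'I_m -> nat) (C : 'I_m -> R) (H : rvec R m -> \bar R) :
  (forall l, rmeas (k l).*2 (N l)) -> (forall l, rmeas (k l).*2 (w l)) ->
  (forall l s, 0 <= w l s)%R -> (forall l, 0 <= C l)%R ->
  (forall l, radial_block (k l).*2 (N l) (w l) (p l) (C l)) ->
  measurable_fun setT H -> (forall r, 0 <= H r) ->
  rint (\sum_(l < m) k l).*2
    (fun s => H (seg_norms k N s) * (\prod_(l < m) w l (seg k l s))%:E) =
  (\prod_(l < m) C l)%:E *
  \int[lebesgue_rvec m]_r (H r * (radial_density p r)%:E).
Proof.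
elim: m k N w p C H => [|m IH] k N w p C H mN mw w0 C0 hB mH H0.
  rewrite !big_ord0 mul1e ge0_integral_rvec0//; last 2 first.
  - by apply: emeasurable_funM => //; apply/measurable_EFinP; exact: measurable_radial_density.
  - by move=> x; rewrite mule_ge0// lee_fin radial_density_ge0.
  rewrite /rint double0 ge0_integral_rvec0//.
  - rewrite /radial_density !big_ord0; congr (H _ * _).
    by apply: eq_from_tnth => -[].
  - apply: emeasurable_funM; first by apply: (measurableT_comp mH); exact: rmeas_seg_norms.
    by apply/measurable_EFinP; exact: rmeas_seg_prod.
  - by move=> x; rewrite mule_ge0// lee_fin prodr_ge0.
set F := (fun s => _ * _).
have mF n : rmeas n F.
  apply: emeasurable_funM; first by apply: (measurableT_comp mH); exact: rmeas_seg_norms.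
  by apply/measurable_EFinP; exact: rmeas_seg_prod.
have F0 s : 0 <= F s by rewrite mule_ge0// lee_fin prodr_ge0.
have mHv t : measurable_fun setT (fun r : rvec R m => H (vcons (t, r))).
  by apply: (measurableT_comp mH); exact: measurable_vconsP.
have mD n (q : 'I_n -> nat) : measurable_fun setT (fun r => (radial_density q r)%:E).
  by apply/measurable_EFinP; exact: measurable_radial_density.
have D0 n (q : 'I_n -> nat) r : 0 <= (radial_density q r)%:E.
  by rewrite lee_fin radial_density_ge0.
(* The integral over the remaining radii as a function of the first one. *)
pose h t := \int[lebesgue_rvec m]_r
  (H (vcons (t, r)) * (radial_density (p \o lift ord0) r)%:E).
have mHD : measurable_fun setT (fun q : measurableTypeR R * rvec R m =>
    H (vcons q) * (radial_density (p \o lift ord0) q.2)%:E).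
  apply: emeasurable_funM; first exact: (measurableT_comp mH measurable_vcons).
  by apply: (measurableT_comp (mD _ _)).
have HD0 q : 0 <= H (vcons q) * (radial_density (p \o lift ord0) q.2)%:E.
  by rewrite mule_ge0.
have mh : measurable_fun setT h by exact: measurable_fun_fubini_tonelli_F mHD HD0.
have h0 t : 0 <= h t by apply: integral_ge0 => r _; exact: (HD0 (t, r)).
have C'0 : (0 <= \prod_(l < m) (C \o lift ord0) l)%R by apply: prodr_ge0 => l _; exact: C0.
have mw0 : measurable_fun setT (fun x : rvec R (k ord0).*2 => (w ord0 x)%:E).
  by apply/measurable_EFinP; exact: mw.
rewrite big_ord_recl doubleD rint_cat//.
transitivity (\int[@lebesgue_rvec R (k ord0).*2]_x
    ((\prod_(l < m) (C \o lift ord0) l)%:E * (h (N ord0 x) * (w ord0 x)%:E))).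
  apply: eq_integral => x _.
  transitivity ((w ord0 x)%:E * rint (\sum_(l < m) (k \o lift ord0) l).*2 (fun t =>
      H (vcons (N ord0 x, seg_norms (k \o lift ord0) (N \o lift ord0) t)) *
      (\prod_(l < m) (w \o lift ord0) l (seg (k \o lift ord0) l t))%:E)).
    rewrite /rint -ge0_integralZl//; last 3 first.
    - apply: emeasurable_funM.
        by apply: (measurableT_comp (mHv _)); apply: rmeas_seg_norms => l; exact: mN.
      by apply/measurable_EFinP; apply: rmeas_seg_prod => l; exact: mw.
    - by move=> y _; rewrite mule_ge0// lee_fin prodr_ge0// => l _; exact: w0.
    - by rewrite lee_fin.
    apply: eq_integral => y _; rewrite /F seg_norms_cat ?size_tuple//.
    by rewrite seg_prod_cat ?size_tuple// EFinM muleCA.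
  rewrite (IH (k \o lift ord0) (N \o lift ord0) (w \o lift ord0) (p \o lift ord0)
    (C \o lift ord0) (fun r => H (vcons (N ord0 x, r))))//.
 - by rewrite muleCA [X in _ = _ * X]muleC.
 - by move=> l; exact: mN.
 - by move=> l; exact: mw.
 - by move=> l s; exact: w0.
 - by move=> l; exact: C0.
 - by move=> l; exact: hB.
rewrite ge0_integralZl ?lee_fin//; last 2 first.
- by apply: emeasurable_funM => //; apply: (measurableT_comp mh); exact: mN.
- by move=> x _; rewrite mule_ge0// lee_fin.
have := hB ord0 h mh h0; rewrite {1}/rint => ->.
rewrite muleA -EFinM mulrC [in RHS]big_ord_recl; congr (_ * _).
rewrite ge0_integral_rvecS//; last 2 first.
- by apply: emeasurable_funM => //; exact: mD.
- by move=> r; rewrite mule_ge0.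
apply: eq_integral => t _; rewrite /h -ge0_integralZl//; last 2 first.
- by apply: emeasurable_funM; [exact: mHv|exact: mD].
- by rewrite lee_fin hpos_expr_ge0.
by apply: eq_integral => r _; rewrite radial_densityS EFinM muleCA.
Qed.

End blocks.

Section special_block.
Local Open Scope ereal_scope.
Context {R : realType} {dX : measure_display} {X : measurableType dX}.
Variable nu : {sigma_finite_measure set X -> \bar R}.

(** The counterpart of [radial_block] for the block whose direction [D] remains a variable of the
    integrand; no weight is split off and no angle is integrated out in advance. *)
Definition polar_block (n : nat) (N : seq R -> R) (D : seq R -> X) (p : nat) :=
  forall h : measurableTypeR R * X -> \bar R, measurable_fun setT h ->
  (forall t, 0 <= h t) ->
  rint n (fun s => h (N s, D s)) =
  \int[nu]_xi \int[lebesgue_measure]_r ((hpos r * r ^+ p)%:E * h (r, xi)).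

(** Block [j] has weight and constant 1, its own monomials being part of [H], so the products over
    all blocks effectively run over l != j. *)
Lemma rint_polar_blocks m (k : 'I_m -> nat) (j : 'I_m)
    (N w : 'I_m -> seq R -> measurableTypeR R) (D : seq R -> X)
    (p : 'I_m -> nat) (C : 'I_m -> R) (H : rvec R m * X -> \bar R) :
  (forall l, rmeas (k l).*2 (N l)) -> (forall l, rmeas (k l).*2 (w l)) ->
  rmeas (k j).*2 D ->
  (forall l s, 0 <= w l s)%R -> (forall l, 0 <= C l)%R ->
  (forall l, l != j -> radial_block (k l).*2 (N l) (w l) (p l) (C l)) ->
  polar_block (k j).*2 (N j) D (p j) -> w j = cst 1%R -> C j = 1%R ->
  measurable_fun setT H -> (forall r, 0 <= H r) ->
  rint (\sum_(l < m) k l).*2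
    (fun s => H (seg_norms k N s, D (seg k j s)) *
      (\prod_(l < m) w l (seg k l s))%:E) =
  (\prod_(l < m) C l)%:E *
  \int[nu]_xi \int[lebesgue_rvec m]_r (H (r, xi) * (radial_density p r)%:E).
Proof.
elim: m k j N w D p C H => [|m IH] k j N w D p C H mN mw mD w0 C0 hB hP wj Cj mH H0.
  by case: j mD hB hP wj Cj.
set F := (fun s => _ * _).
have mF n : rmeas n F.
  apply: emeasurable_funM.
    apply: (measurableT_comp mH); apply: measurable_fun_pair.
      exact: rmeas_seg_norms.
    exact: rmeas_seg.
  by apply/measurable_EFinP; exact: rmeas_seg_prod.
have F0 s : 0 <= F s by rewrite mule_ge0// lee_fin prodr_ge0.
have mrd n (q : 'I_n -> nat) : measurable_fun setT (fun r => (radial_density q r)%:E).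
  by apply/measurable_EFinP; exact: measurable_radial_density.
have rd0 n (q : 'I_n -> nat) r : 0 <= (radial_density q r)%:E.
  by rewrite lee_fin radial_density_ge0.
have mHx xi : measurable_fun setT (fun r : rvec R m.+1 => H (r, xi)).
  exact: (measurable_fun_pair1 xi mH).
pose K (q : (measurableTypeR R * X) * rvec R m) :=
  H (vcons (q.1.1, q.2), q.1.2) * (radial_density (p \o lift ord0) q.2)%:E.
have mK : measurable_fun setT K.
  apply: emeasurable_funM; last first.
    apply/measurable_EFinP.
    exact: (measurableT_comp (measurable_radial_density _) measurable_snd).
  apply: (measurableT_comp mH); apply: measurable_fun_pair.
    apply: measurable_vconsP => //.
    exact: (measurableT_comp measurable_fst measurable_fst).
  exact: (measurableT_comp measurable_snd measurable_fst).
have K0 q : 0 <= K q by rewrite mule_ge0.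
pose h (q : measurableTypeR R * X) := \int[lebesgue_rvec m]_r K (q, r).
have mh : measurable_fun setT h by exact: measurable_fun_fubini_tonelli_F mK K0.
have h0 q : 0 <= h q by apply: integral_ge0.
have C'0 : (0 <= \prod_(l < m) (C \o lift ord0) l)%R.
  by apply: prodr_ge0 => l _; exact: C0.
have mw0 : measurable_fun setT (fun x : rvec R (k ord0).*2 => (w ord0 x)%:E).
  by apply/measurable_EFinP; exact: mw.
have mKt t xi : measurable_fun setT (fun r : rvec R m => K ((t, xi), r)).
  exact: (measurable_fun_pair2 (t, xi) mK).
have radialE t xi : (hpos t * t ^+ p ord0)%:E * h (t, xi) =
    \int[lebesgue_rvec m]_r (H (vcons (t, r), xi) * (radial_density p (vcons (t, r)))%:E).
  rewrite /h -ge0_integralZl//; last by rewrite lee_fin hpos_expr_ge0.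
  by apply: eq_integral => r _; rewrite radial_densityS EFinM muleCA.
have totalE xi : \int[lebesgue_measure]_t ((hpos t * t ^+ p ord0)%:E * h (t, xi)) =
    \int[lebesgue_rvec m.+1]_r (H (r, xi) * (radial_density p r)%:E).
  rewrite ge0_integral_rvecS//; last 2 first.
  - by apply: emeasurable_funM => //; exact: mrd.
  - by move=> r; rewrite mule_ge0.
  by apply: eq_integral => t _; exact: radialE.
rewrite big_ord_recl doubleD rint_cat//.
(* If [j] is a later block, the first one is radial and the induction hypothesis treats the others.
   If [j] is the first block, all the others are radial and [rint_blocks] applies. *)
case: (unliftP ord0 j) => [j' jE|jE].
  rewrite {}jE in mD hB hP wj Cj F mF F0 *.
  pose h' t := \int[nu]_xi h (t, xi).
  have mh' : measurable_fun setT h' by exact: measurable_fun_fubini_tonelli_F mh h0.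
  have h'0 t : 0 <= h' t by apply: integral_ge0.
  transitivity (\int[@lebesgue_rvec R (k ord0).*2]_x
    ((\prod_(l < m) (C \o lift ord0) l)%:E * (h' (N ord0 x) * (w ord0 x)%:E))).
    apply: eq_integral => x _.
    pose Hx (q : rvec R m * X) := H (vcons (N ord0 x, q.1), q.2).
    have mHx' : measurable_fun setT Hx.
      apply: (measurableT_comp mH); apply: measurable_fun_pair => //.
      exact: (measurable_vconsP (measurable_cst (N ord0 x)) measurable_fst).
    have Hx0 q : 0 <= Hx q by exact: H0.
    transitivity ((w ord0 x)%:E * rint (\sum_(l < m) (k \o lift ord0) l).*2 (fun t =>
        Hx (seg_norms (k \o lift ord0) (N \o lift ord0) t,
            D (seg (k \o lift ord0) j' t)) *
        (\prod_(l < m) (w \o lift ord0) l (seg (k \o lift ord0) l t))%:E)).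
      rewrite /rint -ge0_integralZl//; last 3 first.
      - apply: emeasurable_funM.
          apply: (measurableT_comp mHx'); apply: measurable_fun_pair.
            by apply: rmeas_seg_norms => l; exact: mN.
          exact: rmeas_seg.
        by apply/measurable_EFinP; apply: rmeas_seg_prod => l; exact: mw.
      - by move=> y _; rewrite mule_ge0// lee_fin prodr_ge0// => l _; exact: w0.
      - by rewrite lee_fin.
      apply: eq_integral => y _; rewrite /F seg_norms_cat ?size_tuple//.
      by rewrite seg_prod_cat ?size_tuple// seg_catS ?size_tuple// EFinM muleCA.
    rewrite (IH (k \o lift ord0) j' (N \o lift ord0) (w \o lift ord0) D
      (p \o lift ord0) (C \o lift ord0) Hx)//.
    - by rewrite muleCA [X in _ = _ * X]muleC.
    - by move=> l; exact: mN.
    - by move=> l; exact: mw.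
    - by move=> l s; exact: w0.
    - by move=> l; exact: C0.
    - by move=> l lj; apply: hB; rewrite (inj_eq lift_inj).
  rewrite ge0_integralZl ?lee_fin//; last 2 first.
  - by apply: emeasurable_funM => //; apply: (measurableT_comp mh'); exact: mN.
  - by move=> x _; rewrite mule_ge0// lee_fin.
  have := hB ord0 (neq_lift _ _) h' mh' h'0; rewrite {1}/rint => ->.
  rewrite muleA -EFinM mulrC [in RHS]big_ord_recl; congr (_ * _).
  (* The first radius now stands outside the integral over directions, and Tonelli's theorem moves
     it inside, next to the other radii. *)
  transitivity (\int[lebesgue_measure]_t \int[nu]_xi
      ((hpos t * t ^+ p ord0)%:E * h (t, xi))).
    apply: eq_integral => t _; rewrite /h' ge0_integralZl//.
    - exact: (measurable_fun_pair2 t mh).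
    - by rewrite lee_fin hpos_expr_ge0.
  rewrite (fubini_tonelli (fun q : measurableTypeR R * X =>
    (hpos q.1 * q.1 ^+ p ord0)%:E * h q))//; last 2 first.
  - apply: emeasurable_funM => //; apply/measurable_EFinP.
    exact: (measurableT_comp (measurable_hpos_expr _) measurable_fst).
  - by move=> q; rewrite mule_ge0// lee_fin hpos_expr_ge0.
  by apply: eq_integral => xi _; exact: totalE.
rewrite {}jE in mD hB hP wj Cj F mF F0 *.
transitivity (\int[@lebesgue_rvec R (k ord0).*2]_x
    ((\prod_(l < m) (C \o lift ord0) l)%:E * h (N ord0 x, D x))).
  apply: eq_integral => x _.
  pose Hx (r : rvec R m) := H (vcons (N ord0 x, r), D x).
  have mHx' : measurable_fun setT Hx.
    by apply: (measurableT_comp (mHx (D x))); exact: measurable_vconsP.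
  rewrite [RHS](_ : _ = rint (\sum_(l < m) (k \o lift ord0) l).*2 (fun t =>
      Hx (seg_norms (k \o lift ord0) (N \o lift ord0) t) *
      (\prod_(l < m) (w \o lift ord0) l (seg (k \o lift ord0) l t))%:E)).
    apply: eq_integral => y _; rewrite /F seg_norms_cat ?size_tuple//.
    by rewrite seg_prod_cat ?size_tuple// seg_cat0 ?size_tuple// wj mul1r.
  rewrite (rint_blocks (k := k \o lift ord0) (N := N \o lift ord0)
    (w := w \o lift ord0) (p := p \o lift ord0) (C := C \o lift ord0))//.
  - by move=> l; exact: mN.
  - by move=> l; exact: mw.
  - by move=> l s; exact: w0.
  - by move=> l; exact: C0.
  - by move=> l; apply: hB; rewrite eq_sym neq_lift.
  - by move=> r; exact: H0.
rewrite ge0_integralZl ?lee_fin//; last first.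
  apply: (measurableT_comp mh); apply: measurable_fun_pair; [exact: mN|exact: mD].
rewrite big_ord_recl Cj mul1r; congr (_ * _).
have := hP h mh h0; rewrite {1}/rint => ->.
by apply: eq_integral => xi _; exact: totalE.
Qed.

End special_block.

(** * Polar coordinates in C^k *)

Section complex_blocks.
Local Open Scope ereal_scope.
Context {R : realType}.
Notation mu := (@lebesgue_measure R).

Definition snorm (k : nat) (s : seq R) : measurableTypeR R := Num.sqrt (csq k s).

Definition cvec_of_seq (k : nat) (s : seq R) : 'cV[R[i]]_k :=
  (\col_(i < k) (nth 0 s i.*2 +i* nth 0 s i.*2.+1))%R.

Definition cdirection (k : nat) (s : seq R) : 'cV[R[i]]_k :=
  (((snorm k s)^-1)%:C *: cvec_of_seq k s)%R.

Lemma csq_ge0 k (s : seq R) : (0 <= csq k s)%R.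
Proof. by apply: sumr_ge0 => i _; rewrite addr_ge0 ?sqr_ge0. Qed.

Lemma rmeas_snorm n k : @rmeas R n _ _ (snorm k).
Proof.
apply: measurableT_comp; last exact: measurable_csq.
by apply: continuous_measurable_fun; exact: sqrt_continuous.
Qed.

Lemma rmeas_cdirection k : @rmeas R k.*2 _ _ (cdirection k).
Proof.
(* The factor 1/|x| is written as the power -1/2 of |x|^2 to be visibly measurable; at x = 0 both
   expressions are 0. *)
rewrite /rmeas; pose g (x : rvec R k.*2) := rscale (csq k x `^ (- 2^-1))%R x.
have mg : measurable_fun setT g.
  apply: measurable_rscale => //.
  exact: (measurableT_comp (measurable_powR _) (@measurable_csq _ _ k)).
have -> : (fun x : rvec R k.*2 => cdirection k x) = cvec_of_rvec \o g; last first.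
  exact: (measurableT_comp measurable_cvec_of_rvec mg).
apply/funext => x /=; apply/colP => i; rewrite !mxE /g.
rewrite !(nth_map 0%R) ?size_tuple ?ltn_double ?ltn_Sdouble// /snorm.
have -> : ((Num.sqrt (csq k x))^-1 = csq k x `^ (- 2^-1) :> R)%R.
  by rewrite powRN powR12_sqrt// csq_ge0.
by apply/eqP; rewrite eq_complex /= !mul0r subr0 addr0 !eqxx.
Qed.

Lemma snorm_rscale k (r : R) (x : rvec R k.*2) : (0 < r)%R ->
  snorm k (rscale r x) = (r * snorm k x)%R.
Proof.
move=> r0; rewrite /snorm !csq_rsqnorm rsqnorm_rscale sqrtrM ?sqr_ge0//.
by rewrite sqrtr_sqr gtr0_norm.
Qed.

Lemma snorm1 k (x : rvec R k.*2) : rsqnorm x = 1%R -> snorm k x = 1%R.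
Proof. by move=> x1; rewrite /snorm csq_rsqnorm x1 sqrtr1. Qed.

Lemma cdirection_rscale k (r : R) (x : rvec R k.*2) : (0 < r)%R ->
  rsqnorm x = 1%R -> cdirection k (rscale r x) = cvec_of_rvec x.
Proof.
move=> r0 x1; rewrite /cdirection snorm_rscale// snorm1// mulr1.
apply/colP => i; rewrite !mxE.
rewrite !(nth_map 0%R) ?size_tuple ?ltn_double ?ltn_Sdouble//.
have rn0 : r != 0%R by rewrite gt_eqF.
by apply/eqP; rewrite eq_complex /= !mul0r subr0 addr0 !mulKf// !eqxx.
Qed.

(** The volume element of R^(2k) gives r^(2k-1), the homogeneity of |z^a|^2 gives r^(2|a|), and the
    constant is the sphere moment. *)
Lemma radial_block_cweight k (a : 'I_k -> nat) : (0 < k)%N ->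
  radial_block k.*2 (snorm k) (cweight a) (k.*2.-1 + (\sum_(i < k) a i).*2)
    (2 * \prod_(i < k) (pi * (a i)`!%:R) / (k.-1 + \sum_(i < k) a i)`!%:R).
Proof.
case: k a => // k a _ h mh h0; rewrite /rint.
have mhw : measurable_fun setT (fun x : rvec R k.+1.*2 => h (snorm k.+1 x) * (cweight a x)%:E).
  apply: emeasurable_funM; first exact: (measurableT_comp mh (@rmeas_snorm _ _)).
  by apply/measurable_EFinP; exact: measurable_cweight.
have mw : measurable_fun setT (fun x : rvec R k.+1.*2 => (cweight a x)%:E).
  by apply/measurable_EFinP; exact: measurable_cweight.
rewrite (@ge0_integral_polar _ k.*2.+1)//; last first.
  by move=> x; rewrite mule_ge0// lee_fin cweight_ge0.
rewrite -sphere_moment -ge0_integralZl//; last 3 first.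
- apply: emeasurable_funM => //.
  by apply/measurable_EFinP; exact: measurable_hpos_expr.
- by move=> r _; rewrite mule_ge0// lee_fin hpos_expr_ge0.
- by apply: integral_ge0 => x _; rewrite lee_fin cweight_ge0.
apply: eq_integral => r _.
have [r0|r0] := ltP 0%R r; last first.
  by rewrite !hposE ltNge r0 !mul0r !mul0e mule0.
rewrite (@eq_integral_sphere _ _ _ (fun x =>
  (r ^+ (\sum_(i < k.+1) a i).*2)%:E * h r * (cweight a x)%:E))//.
- rewrite ge0_integralZl//; last 2 first.
  + by move=> x _; rewrite lee_fin cweight_ge0.
  + by rewrite mule_ge0// lee_fin exprn_ge0// ltW.
  by rewrite [RHS]muleC exprD mulrA EFinM !muleA.
- by apply: (measurableT_comp mhw); exact: measurable_rscale.
- by move=> x; rewrite mule_ge0// lee_fin cweight_ge0.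
- exact: emeasurable_funM.
- move=> x; rewrite !mule_ge0 ?lee_fin ?cweight_ge0// exprn_ge0//.
  exact: ltW.
- move=> x x1; rewrite snorm_rscale// snorm1// mulr1 cweight_scale ?size_tuple//.
  by rewrite EFinM muleA [h r * _]muleC.
Qed.

(** The total mass is the moment of exponent 0. *)
Lemma sphere_cvec_fin k : @sphere_cvec R k setT < +oo.
Proof.
rewrite [X in X < _]/(sphere_rvec k.*2 (cvec_of_rvec @^-1` setT)) preimage_setT.
case: k => [|k]; first by rewrite ltry.
have := @sphere_moment R k (fun=> 0%N).
have -> : (fun x : rvec R k.+1.*2 => (cweight (fun _ : 'I_k.+1 => 0%N) x)%:E) = cst 1.
  by apply/funext => x; rewrite /cweight big1.
have fin (x : \bar R) c : x = c%:E -> x < +oo by move=> ->; exact: ltry.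
by rewrite integral_cst// mul1e => sE; exact: fin sE.
Qed.

(** Exchanging radius and direction by Tonelli's theorem asks for a sigma-finite measure; hence
    [nu], which agrees with the sphere measure and carries that structure. *)
Lemma polar_block_sphere k (nu : {sigma_finite_measure set 'cV[R[i]]_k -> \bar R}) :
  (0 < k)%N -> (forall A, measurable A -> nu A = sphere_cvec k A) ->
  polar_block nu k.*2 (snorm k) (cdirection k) k.*2.-1.
Proof.
case: k nu => // k nu _ nuE h mh h0; rewrite /rint.
have mhp : measurable_fun setT (fun x : rvec R k.+1.*2 =>
    h (snorm k.+1 x, cdirection k.+1 x)).
  apply: (measurableT_comp mh); apply: measurable_fun_pair.
    exact: rmeas_snorm.
  exact: rmeas_cdirection.
rewrite (@ge0_integral_polar _ k.*2.+1)//.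
have mhr r : measurable_fun setT (fun xi => h (r, xi)).
  exact: (measurable_fun_pair2 r mh).
transitivity (\int[mu]_r \int[nu]_xi ((hpos r * r ^+ k.*2.+1)%:E * h (r, xi))).
  apply: eq_integral => r _.
  rewrite [RHS]ge0_integralZl//; last by rewrite lee_fin hpos_expr_ge0.
  have [r0|r0] := ltP 0%R r; last by rewrite hposE ltNge r0 !mul0r !mul0e.
  congr (_ * _).
  rewrite (@ge0_integral_image _ _ _ _ _ cvec_of_rvec (@sphere_rvec R k.+1.*2) nu)//.
  - apply: eq_integral_sphere => //.
    + by apply: (measurableT_comp mhp); exact: measurable_rscale.
    + exact: (measurableT_comp (mhr r) measurable_cvec_of_rvec).
    + by move=> x x1; rewrite snorm_rscale// snorm1// mulr1 cdirection_rscale.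
  - exact: measurable_cvec_of_rvec.
rewrite (fubini_tonelli (fun q : measurableTypeR R * 'cV[R[i]]_k.+1 =>
  (hpos q.1 * q.1 ^+ k.*2.+1)%:E * h q))//.
- apply: emeasurable_funM => //; apply/measurable_EFinP.
  exact: (measurableT_comp (measurable_hpos_expr _) measurable_fst).
- by move=> q; rewrite mule_ge0// lee_fin hpos_expr_ge0.
Qed.

End complex_blocks.

(** * The block decomposition of C^n *)

Section cvec_blocks.
Context {R : realType}.
Local Notation normc := ComplexField.Normc.normc.

Lemma big_Rank (T : Type) (idx : T) (op : Monoid.com_law idx) m (k : 'I_m -> nat)
    (F : 'I_(\sum_(l < m) k l) -> T) :
  \big[op/idx]_(i < \sum_(l < m) k l) F i =
  \big[op/idx]_(l < m) \big[op/idx]_(i < k l) F (tagnat.Rank l i).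
Proof.
rewrite (sig_big_dep _ (fun _ _ => true) (fun l i => F (tagnat.Rank l i)))/=.
rewrite (reindex (@tagnat.rank m k)); last first.
  by apply: onW_bij; exists (@tagnat.sig m k) => x; rewrite ?tagnat.rankK ?tagnat.sigK.
by apply: eq_bigr => -[l i] _.
Qed.

Lemma sqr_normcE (z : R[i]) :
  normc z ^+ 2 = complex.Re z ^+ 2 + complex.Im z ^+ 2.
Proof. by case: z => a b /=; rewrite sqr_sqrtr// addr_ge0 ?sqr_ge0. Qed.

Lemma normc_ge0 (z : R[i]) : 0 <= normc z.
Proof. by case: z => a b /=; exact: sqrtr_ge0. Qed.

Lemma cnorm_ge0 n (z : 'cV[R[i]]_n) : 0 <= cnorm z.
Proof. exact: sqrtr_ge0. Qed.

Lemma sqr_cnorm n (z : 'cV[R[i]]_n) :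
  cnorm z ^+ 2 = \sum_(i < n) normc (z i 0) ^+ 2.
Proof. by rewrite /cnorm sqr_sqrtr// sumr_ge0// => i _; exact: sqr_ge0. Qed.

Lemma cnorm_cvec_of_seq k (s : seq R) : cnorm (cvec_of_seq k s) = snorm k s.
Proof.
rewrite /cnorm /snorm /csq; congr Num.sqrt; apply: eq_bigr => i _.
by rewrite sqr_normcE mxE.
Qed.

Lemma cnorm_cvec_of_rvec n (x : rvec R n.*2) :
  cnorm (cvec_of_rvec x) ^+ 2 = rsqnorm x.
Proof.
rewrite -csq_rsqnorm -[csq n x]sqr_sqrtr ?csq_ge0//.
by congr (_ ^+ 2); exact: cnorm_cvec_of_seq.
Qed.

Lemma submxcol_cvec_of_rvec m (k : 'I_m -> nat)
    (x : rvec R (\sum_(l < m) k l).*2) l :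
  submxcol (cvec_of_rvec x) l = cvec_of_seq (k l) (seg k l x).
Proof.
apply/colP => i; rewrite !mxE tagnat.RankEsum /seg.
by rewrite !nth_mkseq ?ltn_double ?ltn_Sdouble// doubleD -addnS.
Qed.

Lemma block_norms_cvec_of_rvec m (k : 'I_m -> nat)
    (x : rvec R (\sum_(l < m) k l).*2) :
  block_norms (cvec_of_rvec x) = seg_norms k (fun l => snorm (k l)) x.
Proof.
apply: eq_from_tnth => l; rewrite !tnth_mktuple submxcol_cvec_of_rvec.
exact: cnorm_cvec_of_seq.
Qed.

Lemma block_direction_cvec_of_rvec m (k : 'I_m -> nat) j
    (x : rvec R (\sum_(l < m) k l).*2) :
  block_direction j (cvec_of_rvec x) = cdirection (k j) (seg k j x).
Proof.
by rewrite /block_direction submxcol_cvec_of_rvec cnorm_cvec_of_seq.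
Qed.

Lemma measurable_cvecP n d (T : measurableType d) (F : 'cV[R[i]]_n -> T) :
  measurable_fun setT (fun x : rvec R n.*2 => F (cvec_of_rvec x)) ->
  measurable_fun setT F.
Proof.
move=> mF _ Y mY; rewrite setTI.
by have := mF measurableT Y mY; rewrite setTI.
Qed.

Lemma ge0_integral_cvec n (F : 'cV[R[i]]_n -> \bar R) :
  measurable_fun setT F -> (forall z, 0 <= F z)%E ->
  (\int[lebesgue_cvec n]_z F z =
   \int[lebesgue_rvec n.*2]_x F (cvec_of_rvec x))%E.
Proof.
move=> mF F0; apply: ge0_integral_image => //.
exact: measurable_cvec_of_rvec.
Qed.

Lemma measurable_block_norms m (k : 'I_m -> nat) :
  measurable_fun setT (@block_norms R m k).
Proof.
apply: measurable_cvecP; under [X in measurable_fun _ X]eq_fun do rewrite block_norms_cvec_of_rvec.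
by apply: rmeas_seg_norms => l; exact: rmeas_snorm.
Qed.

Lemma measurable_block_direction m (k : 'I_m -> nat) j :
  measurable_fun setT (@block_direction R m k j).
Proof.
apply: measurable_cvecP; under [X in measurable_fun _ X]eq_fun do rewrite block_direction_cvec_of_rvec.
by apply: rmeas_seg; exact: rmeas_cdirection.
Qed.

(** |z^a|^2, the form of [cweight] on complex vectors. *)
Definition mweight n (a : 'cV[nat]_n) (z : 'cV[R[i]]_n) : R :=
  \prod_(i < n) (normc (z i 0) ^+ 2) ^+ a i 0.

Lemma mweight_ge0 n (a : 'cV[nat]_n) z : 0 <= mweight a z.
Proof. by apply: prodr_ge0 => i _; rewrite exprn_ge0// sqr_ge0. Qed.

Lemma mweight_cvec_of_seq k (a : 'cV[nat]_k) (s : seq R) :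
  mweight a (cvec_of_seq k s) = cweight (fun i => a i 0) s.
Proof. by apply: eq_bigr => i _; rewrite sqr_normcE mxE. Qed.

Lemma measurable_mweight n (a : 'cV[nat]_n) : measurable_fun setT (mweight a).
Proof.
apply: measurable_cvecP.
rewrite (_ : (fun _ => _) = (fun x : rvec R n.*2 => cweight (fun i => a i 0) x)).
  exact: measurable_cweight.
by apply/funext => x; exact: mweight_cvec_of_seq.
Qed.

Lemma measurable_submxcol m (k : 'I_m -> nat) l : measurable_fun setT
  (fun z : 'cV[R[i]]_(\sum_(l < m) k l) => submxcol z l).
Proof.
apply: measurable_cvecP; under [X in measurable_fun _ X]eq_fun do rewrite submxcol_cvec_of_rvec.
apply: rmeas_seg.
exact: (@measurable_cvec_of_rvec R (k l)).
Qed.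

Section formula.
Local Open Scope ereal_scope.
Variables (m : nat) (k : 'I_m -> nat) (j : 'I_m) (alpha : 'cV[nat]_(\sum_(l < m) k l)).
Hypothesis k_gt0 : forall l, (0 < k l)%N.

Definition outer_weight (z : 'cV[R[i]]_(\sum_(l < m) k l)) : R :=
  (\prod_(l < m | l != j) mweight (submxcol alpha l) (submxcol z l))%R.

(** The product of the integrals of |xi^alpha_(l)|^2 over the unit spheres of the blocks l != j. *)
Definition outer_const : R :=
  (\prod_(l < m | l != j) (2 * (pi ^+ k l * (mfact (submxcol alpha l))%:R) /
     ((k l).-1 + mdeg (submxcol alpha l))`!%:R))%R.

(** Block [j] keeps only the exponent 2 k_j - 1 of the volume element; the power of r_j from its
    monomials stays in the integrand. *)
Definition outer_power (l : 'I_m) : nat :=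
  ((k l).*2.-1 + (if l == j then 0 else (mdeg (submxcol alpha l)).*2))%N.

Lemma outer_weight_ge0 z : (0 <= outer_weight z)%R.
Proof. by apply: prodr_ge0 => l _; exact: mweight_ge0. Qed.

Lemma measurable_outer_weight : measurable_fun setT outer_weight.
Proof.
rewrite /outer_weight; under [X in measurable_fun _ X]eq_fun do rewrite big_mkcond.
apply: measurable_prod => l _; case: (l == j) => //=.
exact: (measurableT_comp (@measurable_mweight _ _) (@measurable_submxcol _ _ l)).
Qed.

Lemma outer_const_gt0 : (0 < outer_const)%R.
Proof.
apply: prodr_gt0 => l _; rewrite divr_gt0 ?ltr0n ?fact_gt0// mulr_gt0// mulr_gt0//.
  by rewrite exprn_gt0// pi_gt0.
by rewrite ltr0n prodn_gt0// => i; exact: fact_gt0.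
Qed.

Lemma ge0_integral_blocks (nu : {sigma_finite_measure set 'cV[R[i]]_(k j) -> \bar R})
    (H : rvec R m * 'cV[R[i]]_(k j) -> \bar R) :
  (forall A, measurable A -> nu A = sphere_cvec (k j) A) ->
  measurable_fun setT H -> (forall q, 0 <= H q) ->
  \int[lebesgue_cvec _]_z (H (block_norms z, block_direction j z) * (outer_weight z)%:E) =
  outer_const%:E * \int[nu]_xi \int[lebesgue_rvec m]_r
    (H (r, xi) * (radial_density outer_power r)%:E).
Proof.
move=> nuE mH H0.
pose w l : seq R -> R := if l == j then cst 1%R
  else cweight (fun i => (submxcol alpha l) i ord0).
pose C l : R := if l == j then 1%R else (2 * (pi ^+ k l * (mfact (submxcol alpha l))%:R) /
     ((k l).-1 + mdeg (submxcol alpha l))`!%:R)%R.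
have mHw : measurable_fun setT (fun z : 'cV[R[i]]_(\sum_(l < m) k l) =>
    H (block_norms z, block_direction j z) * (outer_weight z)%:E).
  apply: emeasurable_funM; last by apply/measurable_EFinP; exact: measurable_outer_weight.
  apply: (measurableT_comp mH); apply: measurable_fun_pair.
    exact: measurable_block_norms.
  exact: measurable_block_direction.
rewrite ge0_integral_cvec//; last first.
  by move=> z; rewrite mule_ge0// lee_fin outer_weight_ge0.
have CE : outer_const = (\prod_(l < m) C l)%R.
  rewrite /outer_const big_mkcond; by apply: eq_bigr => l _; rewrite /C; case: (l == j).
transitivity (rint (\sum_(l < m) k l).*2 (fun s =>
    H (seg_norms k (fun l => snorm (k l)) s, cdirection (k j) (seg k j s)) *
    (\prod_(l < m) w l (seg k l s))%:E)).
  apply: eq_integral => x _.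
  rewrite block_norms_cvec_of_rvec block_direction_cvec_of_rvec; congr (_ * _%:E).
  rewrite /outer_weight big_mkcond; apply: eq_bigr => l _; rewrite /w.
  case: (l == j) => //=.
  by rewrite submxcol_cvec_of_rvec mweight_cvec_of_seq.
rewrite CE.
apply: (@rint_polar_blocks _ _ _ nu m k j (fun l => snorm (k l)) w (cdirection (k j))
  outer_power C) => //.
- by move=> l; exact: rmeas_snorm.
- move=> l; rewrite /w; case: eqP => _; first exact: measurable_cst.
  exact: measurable_cweight.
- exact: rmeas_cdirection.
- by move=> l s; rewrite /w; case: eqP => // _; exact: cweight_ge0.
- move=> l; rewrite /C; case: eqP => // _; rewrite divr_ge0// mulr_ge0// mulr_ge0//.
  by rewrite exprn_ge0// pi_ge0.
- move=> l /negbTE lj; rewrite /w /C /outer_power lj.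
  have -> : (pi ^+ k l * (mfact (submxcol alpha l))%:R =
      \prod_(i < k l) (pi * ((submxcol alpha l) i ord0)`!%:R) :> R)%R.
    by rewrite big_split prodr_const card_ord natr_prod.
  exact: radial_block_cweight.
- by rewrite /outer_power eqxx addn0; exact: polar_block_sphere.
- by rewrite /w eqxx.
- by rewrite /C eqxx.
Qed.

End formula.
End cvec_blocks.

Section finite_measure_of.
Context d (T : measurableType d) (R : realType).
Variables (mu : {measure set T -> \bar R}) (fin_mu : fin_num_fun mu).

(** A copy of [mu] indexed by the proof of its finiteness, to which the structure of finite measure
    can be attached. *)
Definition finite_measure_of of fin_num_fun mu : set T -> \bar R := mu.

HB.instance Definition _ := isMeasure.Build _ _ _ (finite_measure_of fin_mu)
  (measure0 mu) (measure_ge0 mu) (@measure_semi_sigma_additive _ _ _ mu).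

HB.instance Definition _ :=
  Measure_isFinite.Build _ _ _ (finite_measure_of fin_mu) fin_mu.

End finite_measure_of.

(** * From nonnegative to real integrands *)

Section signed_formula.
Local Open Scope ereal_scope.
Context {R : realType}.

Lemma sphere_cvec_fin_num k : fin_num_fun (@sphere_cvec R k).
Proof.
move=> A mA; rewrite ge0_fin_numE// (le_lt_trans _ (sphere_cvec_fin k))//.
by apply: le_measure; rewrite ?inE.
Qed.

Definition sphere_finite k : {finite_measure set 'cV[R[i]]_k -> \bar R} :=
  finite_measure_of (@sphere_cvec_fin_num k).

(** The measures [\x^] and [\x] agree on rectangles, hence on all measurable sets, the sphere being
    finite; for the latter this is Tonelli's theorem. *)
Lemma ge0_integral_prod_sphere m k (H : rvec R m * 'cV[R[i]]_k -> \bar R) :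
  measurable_fun setT H -> (forall q, 0 <= H q) ->
  \int[(lebesgue_rvec m \x^ sphere_cvec k)]_q H q =
  \int[sphere_finite k]_xi \int[lebesgue_rvec m]_r H (r, xi).
Proof.
move=> mH H0.
rewrite -(fubini_tonelli2 (m1 := lebesgue_rvec m) (m2 := sphere_finite k) H)//.
apply: eq_measure_integral => A mA _; apply/esym.
apply: product_measure_unique => // B C mB mC.
exact: product_measure2E.
Qed.

(* Holds without any definedness condition since +oo - +oo = -oo. *)
Lemma muleBr_gt0 (c : R) (x y : \bar R) : (0 < c)%R -> 0 <= x -> 0 <= y ->
  c%:E * (x - y) = c%:E * x - c%:E * y.
Proof.
move=> c0; case: x => [x||] //; case: y => [y||] // _ _.
- by rewrite -EFinB -!EFinM -EFinB mulrBr.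
- by rewrite !gt0_muley ?lte_fin//= gt0_muleNy ?lte_fin.
- by rewrite !gt0_muley ?lte_fin.
- by rewrite !gt0_muley ?lte_fin//= gt0_muleNy ?lte_fin.
Qed.

(* The formula holds for the positive and the negative part of u separately, so
   that no integrability is needed. *)
Lemma integral_blocks m (k : 'I_m -> nat) j (alpha : 'cV[nat]_(\sum_(l < m) k l))
    (u : rvec R m * 'cV[R[i]]_(k j) -> R) :
  (forall l, (0 < k l)%N) -> measurable_fun setT u ->
  \int[lebesgue_cvec _]_z
    (u (block_norms z, block_direction j z) * outer_weight j alpha z)%:E =
  (outer_const j alpha)%:E *
  \int[(lebesgue_rvec m \x^ sphere_cvec (k j))]_q
    (u q * radial_density (outer_power j alpha) q.1)%:E.
Proof.
move=> k0 mu_.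
have part (H : rvec R m * 'cV[R[i]]_(k j) -> \bar R) :
    measurable_fun setT H -> (forall q, 0 <= H q) ->
    \int[lebesgue_cvec _]_z
      (H (block_norms z, block_direction j z) * (outer_weight j alpha z)%:E) =
    (outer_const j alpha)%:E *
    \int[(lebesgue_rvec m \x^ sphere_cvec (k j))]_q
      (H q * (radial_density (outer_power j alpha) q.1)%:E).
  move=> mH H0; rewrite (@ge0_integral_blocks R m k j alpha k0 (sphere_finite (k j)) H)//.
  rewrite ge0_integral_prod_sphere//.
  - apply: emeasurable_funM => //; apply/measurable_EFinP.
    exact: (measurableT_comp (measurable_radial_density _) measurable_fst).
  - by move=> q; rewrite mule_ge0// lee_fin radial_density_ge0.
rewrite integralE [in RHS]integralE muleBr_gt0 ?outer_const_gt0 ?integral_ge0//.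
(* A nonnegative weight factors out of the positive part, and likewise of the negative part. *)
have pE d (T : measurableType d) (g w : T -> R) : (forall t, 0 <= w t)%R ->
    (fun t => (g t * w t)%:E)^\+ = (fun t => ((EFin \o g)^\+ t) * (w t)%:E).
  move=> w0; apply/funext => t; rewrite !funeposE maxe_pMl ?lee_fin//.
  by rewrite mul0e EFinM.
have nE d (T : measurableType d) (g w : T -> R) : (forall t, 0 <= w t)%R ->
    (fun t => (g t * w t)%:E)^\- = (fun t => ((EFin \o g)^\- t) * (w t)%:E).
  move=> w0; rewrite -!funeposN -pE//; congr funepos.
  by apply/funext => t /=; rewrite mulNr EFinN.
have mu' : measurable_fun setT (EFin \o u) by exact/measurable_EFinP.
congr (_ - _).
- rewrite (pE _ _ (fun z => u (block_norms z, block_direction j z))); last first.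
    exact: outer_weight_ge0.
  rewrite (pE _ _ u (fun q => radial_density (outer_power j alpha) q.1)); last first.
    by move=> q; exact: radial_density_ge0.
  have := part ((EFin \o u)^\+) (measurable_funepos mu') (funepos_ge0 _).
  move=> E; refine (eq_trans _ E).
  by apply: eq_integral => z _; rewrite !funeposE.
- rewrite (nE _ _ (fun z => u (block_norms z, block_direction j z))); last first.
    exact: outer_weight_ge0.
  rewrite (nE _ _ u (fun q => radial_density (outer_power j alpha) q.1)); last first.
    by move=> q; exact: radial_density_ge0.
  have := part ((EFin \o u)^\-) (measurable_funeneg mu') (funeneg_ge0 _).
  move=> E; refine (eq_trans _ E).
  by apply: eq_integral => z _; rewrite !funenegE.
Qed.

End signed_formula.

(** * Bergman spaces *)

Section holomorphy.
Context {R : realType} {n : nat}.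

Lemma differentiable_entry (i : 'I_n) (z : 'cV[R[i]]_n) :
  differentiable (fun w : 'cV[R[i]]_n => w i 0) z.
Proof.
exact: differentiable_coord.
Qed.

Lemma holomorphicM (f g : 'cV[R[i]]_n -> R[i]) :
  holomorphic f -> holomorphic g -> holomorphic (fun z => f z * g z).
Proof.
move=> hf hg z bz.
exact: (differentiableM (hf z bz) (hg z bz)).
Qed.

Lemma holomorphic_cst (c : R[i]) : @holomorphic R n (cst c).
Proof. by move=> z _; exact: differentiable_cst. Qed.

Lemma holomorphicX (f : 'cV[R[i]]_n -> R[i]) k :
  holomorphic f -> holomorphic (fun z => f z ^+ k).
Proof.
move=> hf; elim: k => [|k IH]; first exact: holomorphic_cst.
by under eq_fun do rewrite exprS; exact: holomorphicM.
Qed.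

Lemma holomorphic_mpow (alpha : 'cV[nat]_n) :
  holomorphic (fun z : 'cV[R[i]]_n => mpow z alpha).
Proof.
rewrite /mpow; elim: (index_enum _) => [|i s IH].
  by under eq_fun do rewrite big_nil; exact: holomorphic_cst.
under eq_fun do rewrite big_cons; apply: holomorphicM => //.
by apply: holomorphicX => z _; exact: differentiable_entry.
Qed.

Lemma holomorphic_bergman_basis (lam : R) (alpha : 'cV[nat]_n) :
  holomorphic (bergman_basis lam alpha).
Proof. apply: holomorphicM; [exact: holomorphic_cst|exact: holomorphic_mpow]. Qed.

End holomorphy.

Section complex_measurability.
Context d {T : measurableType d} {R : realType}.
Implicit Types (D : set T) (f g : T -> R[i]).
Local Notation normc := ComplexField.Normc.normc.

Lemma ReM (x y : R[i]) : complex.Re (x * y) =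
  complex.Re x * complex.Re y - complex.Im x * complex.Im y.
Proof. by case: x => a b; case: y. Qed.

Lemma ImM (x y : R[i]) : complex.Im (x * y) =
  complex.Re x * complex.Im y + complex.Im x * complex.Re y.
Proof. by case: x => a b; case: y. Qed.

Lemma cmeasurableS D f : cmeasurable setT f -> cmeasurable D f.
Proof. by move=> [rf jf]; split; exact: measurable_funTS. Qed.

Lemma cmeasurableM D f g : cmeasurable D f -> cmeasurable D g ->
  cmeasurable D (fun x => f x * g x).
Proof.
move=> [rf jf] [rg jg]; split.
  under eq_fun do rewrite ReM.
  by apply: measurable_funB; exact: measurable_funM.
under eq_fun do rewrite ImM.
by apply: measurable_funD; exact: measurable_funM.
Qed.

Lemma cmeasurable_cst D c : cmeasurable D (cst c : T -> R[i]).
Proof. by split; exact: measurable_cst. Qed.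

Lemma cmeasurable_real D (h : T -> R) : measurable_fun D h ->
  cmeasurable D (fun x => (h x)%:C).
Proof. by move=> mh; split => //=; exact: measurable_cst. Qed.

Lemma cmeasurable_conjc D f : cmeasurable D f -> cmeasurable D (fun x => conjc (f x)).
Proof.
move=> [rf jf]; split.
  by rewrite (_ : (fun _ => _) = (fun x => complex.Re (f x)))//; apply/funext => x; case: (f x).
rewrite (_ : (fun _ => _) = (fun x => - complex.Im (f x))).
  exact: measurableT_comp.
by apply/funext => x; case: (f x).
Qed.

Lemma cmeasurableX D f n : cmeasurable D f -> cmeasurable D (fun x => f x ^+ n).
Proof.
move=> mf; elim: n => [|n IH]; first exact: cmeasurable_cst.
by under eq_fun do rewrite exprS; exact: cmeasurableM.
Qed.

Lemma cmeasurable_prod D (I : Type) (s : seq I) (F : I -> T -> R[i]) :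
  (forall i, cmeasurable D (F i)) -> cmeasurable D (fun x => \prod_(i <- s) F i x).
Proof.
move=> mF; elim: s => [|i s IH].
  by under eq_fun do rewrite big_nil; exact: cmeasurable_cst.
by under eq_fun do rewrite big_cons; exact: cmeasurableM.
Qed.

Lemma measurable_normc D f : cmeasurable D f -> measurable_fun D (fun x => normc (f x)).
Proof.
move=> [rf jf].
rewrite (_ : (fun _ => _) =
  (fun x => Num.sqrt (complex.Re (f x) ^+ 2 + complex.Im (f x) ^+ 2))); last first.
  by apply/funext => x; case: (f x).
apply: (@measurableT_comp _ _ _ _ _ _ (@Num.sqrt R)).
  by apply: continuous_measurable_fun; exact: sqrt_continuous.
by apply: measurable_funD; exact: measurable_funX.
Qed.

Lemma eq_cintegral (mu : {measure set T -> \bar R}) D f g : measurable D ->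
  cmeasurable D f -> cmeasurable D g ->
  {ae mu, forall x, D x -> f x = g x} -> cintegral mu D f = cintegral mu D g.
Proof.
move=> mD [rf jf] [rg jg] fg; rewrite /cintegral /Rintegral; congr (fine _ +i* fine _).
- apply: ae_eq_integral => //; [exact/measurable_EFinP|exact/measurable_EFinP|].
  by apply: filterS fg => x fg /fg /= ->.
- apply: ae_eq_integral => //; [exact/measurable_EFinP|exact/measurable_EFinP|].
  by apply: filterS fg => x fg /fg /= ->.
Qed.

Lemma normr_Re_normc (z : R[i]) : `|complex.Re z| <= normc z.
Proof.
case: z => a b /=; rewrite -(sqrtr_sqr a) ler_sqrt ?addr_ge0 ?sqr_ge0//.
by rewrite lerDl sqr_ge0.
Qed.

Lemma normr_Im_normc (z : R[i]) : `|complex.Im z| <= normc z.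
Proof.
case: z => a b /=; rewrite -(sqrtr_sqr b) ler_sqrt ?addr_ge0 ?sqr_ge0//.
by rewrite lerDr sqr_ge0.
Qed.

Lemma normc_real (x : R) : normc x%:C = `|x|.
Proof. by rewrite /= expr0n/= addr0 sqrtr_sqr. Qed.

Lemma normc_conjc (z : R[i]) : normc (conjc z) = normc z.
Proof. by case: z => a b /=; rewrite sqrrN. Qed.

(** The integrable majorants [F] and [G] make the real and imaginary parts integrable, which the
    additivity of [Rintegral] requires. *)
Lemma cintegralB (mu : {measure set T -> \bar R}) D f g (F G : T -> R) :
  measurable D -> cmeasurable D f -> cmeasurable D g ->
  mu.-integrable D (EFin \o F) -> mu.-integrable D (EFin \o G) ->
  (forall x, D x -> normc (f x) <= F x) -> (forall x, D x -> normc (g x) <= G x) ->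
  cintegral mu D (fun x => f x - g x) = cintegral mu D f - cintegral mu D g.
Proof.
move=> mD [rf jf] [rg jg] iF iG fF gG.
have int (p : T -> R) (h : T -> R[i]) (H : T -> R) : measurable_fun D p ->
    mu.-integrable D (EFin \o H) -> (forall x, D x -> normc (h x) <= H x) ->
    (forall x, `|p x| <= normc (h x)) -> mu.-integrable D (EFin \o p).
  move=> mp iH hH ph; apply: le_integrable iH => //; first exact/measurable_EFinP.
  move=> x Dx; rewrite /= lee_fin (le_trans (ph x))// (le_trans (hH x Dx))//.
  exact: ler_norm.
rewrite /cintegral.
under eq_Rintegral do rewrite raddfB.
under [X in _ +i* X = _]eq_Rintegral do rewrite raddfB.
rewrite !RintegralB//.
- apply: int iF fF _ => // x; exact: normr_Im_normc.
- apply: int iG gG _ => // x; exact: normr_Im_normc.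
- apply: int iF fF _ => // x; exact: normr_Re_normc.
- apply: int iG gG _ => // x; exact: normr_Re_normc.
Qed.

End complex_measurability.

(** * The Bergman space and its projection *)

Section bergman_space.
Context {R : realType} {n : nat}.
Local Notation normc := ComplexField.Normc.normc.
Local Notation mu := (@lebesgue_cvec R n).
Implicit Types (f g h : 'cV[R[i]]_n -> R[i]) (z : 'cV[R[i]]_n).

Lemma measurable_cnorm : measurable_fun setT (@cnorm R n : _ -> measurableTypeR R).
Proof.
apply: measurable_cvecP.
rewrite (_ : (fun _ => _) = (fun x : rvec R n.*2 => snorm n x)).
  exact: rmeas_snorm.
by apply/funext => x; exact: cnorm_cvec_of_seq.
Qed.

Lemma measurable_cball : measurable (@cball R n).
Proof.
rewrite (_ : cball = @cnorm R n @^-1` `]-oo, 1%R[).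
  by rewrite -[X in measurable X]setTI; exact: measurable_cnorm.
by apply/seteqP; split => x /=; rewrite in_itv.
Qed.

Lemma measurable_csphere : measurable (@csphere R n).
Proof.
rewrite (_ : csphere = @cnorm R n @^-1` [set 1%R])//.
by rewrite -[X in measurable X]setTI; exact: measurable_cnorm.
Qed.

Lemma cmeasurable_entry (i : 'I_n) :
  cmeasurable setT (fun z : 'cV[R[i]]_n => z i 0).
Proof.
split; apply: measurable_cvecP.
- under eq_fun do rewrite mxE; exact: measurable_nth.
- under eq_fun do rewrite mxE; exact: measurable_nth.
Qed.

Lemma cmeasurable_mpow (a : 'cV[nat]_n) :
  cmeasurable setT (fun z : 'cV[R[i]]_n => mpow z a).
Proof. by apply: cmeasurable_prod => i; apply: cmeasurableX; exact: cmeasurable_entry. Qed.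

Lemma normc_mpow (a : 'cV[nat]_n) z : normc (mpow z a) ^+ 2 = mweight a z.
Proof.
have normcX (x : R[i]) p : normc (x ^+ p) = normc x ^+ p.
  elim: p => [|p IH]; first exact: ComplexField.Normc.normc1.
  by rewrite !exprS ComplexField.Normc.normcM IH.
rewrite /mpow (big_morph (@normc R) (@ComplexField.Normc.normcM R) (@ComplexField.Normc.normc1 R)).
by rewrite -prodrXl; apply: eq_bigr => i _; rewrite normcX -!exprM mulnC.
Qed.

Lemma mweight_le1 (a : 'cV[nat]_n) z : cball z -> mweight a z <= 1.
Proof.
move=> z1; apply: prodr_ile1 => i _; rewrite exprn_ge0 ?sqr_ge0//=.
rewrite exprn_ile1 ?sqr_ge0//.
have : normc (z i 0) ^+ 2 <= cnorm z ^+ 2.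
  rewrite sqr_cnorm (bigD1 i)//= lerDl sumr_ge0// => l _; exact: sqr_ge0.
move/le_trans; apply; rewrite exprn_ile1 ?cnorm_ge0//; exact: ltW.
Qed.

Section weight.
Variable lam : R.
Hypothesis lam_gtN1 : -1 < lam.

Lemma Gamma_ge0 (x : R) : 0 <= Gamma x.
Proof. by apply: Rintegral_ge0 => t _; rewrite mulr_ge0 ?powR_ge0 ?expR_ge0. Qed.

Lemma bergman_weight_ge0 z : 0 <= bergman_weight lam z.
Proof.
rewrite mulr_ge0 ?powR_ge0// divr_ge0 ?Gamma_ge0// mulr_ge0 ?Gamma_ge0//.
by rewrite exprn_ge0 ?pi_ge0.
Qed.

Lemma measurable_bergman_weight : measurable_fun setT (@bergman_weight R n lam).
Proof.
apply: measurable_funM => //; apply: (measurableT_comp (measurable_powR lam)).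
by apply: measurable_funB => //; apply: measurable_funX; exact: measurable_cnorm.
Qed.

(** The weight is radial, so its mass is that of the sphere times a one-dimensional integral.
    Finiteness puts every bounded measurable function into L2. *)
Lemma integral_bergman_weight_fin : (0 < n)%N ->
  (\int[mu]_(z in cball) (bergman_weight lam z)%:E < +oo)%E.
Proof.
move=> n0; set c := @bergman_const R n lam.
have c0 : 0 <= c.
  by rewrite divr_ge0 ?Gamma_ge0// mulr_ge0 ?Gamma_ge0// exprn_ge0 ?pi_ge0.
pose g (t : measurableTypeR R) : \bar R := (c * (hpos (1 - t) * (1 - t) `^ lam))%:E.
have mB : measurable_fun setT (fun u : measurableTypeR R => 1 - u : measurableTypeR R).
  exact: measurable_funB.
have mg : measurable_fun setT g.
  apply/measurable_EFinP; apply: measurable_funM => //; apply: measurable_funM.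
    exact: (measurableT_comp measurable_hpos mB).
  exact: (measurableT_comp (measurable_powR lam) mB).
have g0 t : (0 <= g t)%E.
  by rewrite lee_fin mulr_ge0// mulr_ge0 ?hpos_ge0 ?powR_ge0.
have mgc : measurable_fun setT (fun z : 'cV[R[i]]_n => g (cnorm z ^+ 2)).
  by apply: (measurableT_comp mg); apply: measurable_funX; exact: measurable_cnorm.
have -> : (\int[mu]_(z in cball) (bergman_weight lam z)%:E =
    \int[mu]_z g (cnorm z ^+ 2)%R)%E.
  rewrite integral_mkcond; apply: eq_integral => z _.
  rewrite patchE /g hposE subr_gt0 expr_lt1 ?cnorm_ge0//.
  case: ifPn => [/set_mem ->|]; first by rewrite mul1r.
  by move=> /negP nz; case: ltP => z1; rewrite ?mul0r ?mulr0//; case: nz; exact/mem_set.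
rewrite ge0_integral_cvec//.
under eq_integral do rewrite cnorm_cvec_of_rvec.
rewrite integral_sphere_radial ?double_gt0//.
have sfin : (@sphere_rvec R n.*2 setT < +oo)%E by exact: (@sphere_cvec_fin R n).
rewrite lte_mul_pinfty ?ge0_fin_numE//.
(* For n > 0 the exponent 2n - 1 is at least 1: it supplies the factor r that the substitution u =
   r^2 consumes. *)
have [p ->] : exists p, (n.*2.-1 = p.+1)%N.
  by case: n n0 => // q _; exists q.*2.
under eq_integral => r _.
  rewrite /g -EFinM mulrCA EFinM.
  over.
rewrite ge0_integralZl ?lee_fin//; last 2 first.
- apply/measurable_EFinP; apply: measurable_funM; first exact: measurable_hpos_expr.
  have mX2 : measurable_fun setT (fun r : measurableTypeR R => 1 - r ^+ 2 : measurableTypeR R).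
    by apply: measurable_funB => //; exact: measurable_funX.
  apply: measurable_funM; first exact: (measurableT_comp measurable_hpos mX2).
  exact: (measurableT_comp (measurable_powR lam) mX2).
- by move=> r _; rewrite lee_fin mulr_ge0 ?hpos_expr_ge0// mulr_ge0 ?hpos_ge0 ?powR_ge0.
by rewrite lte_mul_pinfty ?lee_fin//; exact: integral_radial_weight.
Qed.

Hypothesis n_gt0 : (0 < n)%N.

Lemma L2_bounded f (M : R) : cmeasurable cball f ->
  {ae mu, forall z, cball z -> normc (f z) <= M} -> L2 lam f.
Proof.
move=> mf fM; split => //.
have mw D : measurable_fun D (@bergman_weight R n lam).
  by apply: measurable_funTS; exact: measurable_bergman_weight.
apply: (@le_lt_trans _ _ (\int[mu]_(z in cball) ((M ^+ 2)%:E * (bergman_weight lam z)%:E))%E).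
  apply: ae_ge0_le_integral => //.
  - exact: measurable_cball.
  - by move=> z _; rewrite lee_fin mulr_ge0 ?sqr_ge0 ?bergman_weight_ge0.
  - apply/measurable_EFinP; apply: measurable_funM => //; apply: measurable_funX.
    exact: measurable_normc.
  - by move=> z _; rewrite mule_ge0// lee_fin ?sqr_ge0 ?bergman_weight_ge0.
  - by apply: emeasurable_funM => //; exact/measurable_EFinP.
  - apply: filterS fM => z fM bz; rewrite -EFinM lee_fin ler_wpM2r ?bergman_weight_ge0//.
    by rewrite ler_pXn2r ?nnegrE ?normc_ge0 ?(le_trans (normc_ge0 _) (fM bz))// fM.
rewrite ge0_integralZl//.
- by rewrite lte_mul_pinfty ?lee_fin ?sqr_ge0//; exact: integral_bergman_weight_fin.
- exact: measurable_cball.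
- exact/measurable_EFinP.
- by move=> z _; rewrite lee_fin bergman_weight_ge0.
- by rewrite lee_fin sqr_ge0.
Qed.

Lemma cmeasurable_bergman_basis (a : 'cV[nat]_n) :
  cmeasurable setT (bergman_basis lam a : 'cV[R[i]]_n -> R[i]).
Proof.
apply: cmeasurableM; last exact: cmeasurable_mpow.
exact: cmeasurable_cst.
Qed.

Lemma normc_bergman_basis_le (a : 'cV[nat]_n) : exists M : R, 0 <= M /\
  forall z, cball z -> normc (bergman_basis lam a z) <= M.
Proof.
pose c : R := Num.sqrt (Gamma (n%:R + lam + (mdeg a)%:R + 1) /
  ((mfact a)%:R * Gamma (n%:R + lam + 1))).
exists `|c|; split => // z bz.
rewrite /bergman_basis -/c ComplexField.Normc.normcM normc_real -[leRHS]mulr1.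
rewrite ler_wpM2l// -(@expr_le1 _ 2) ?normc_ge0// normc_mpow.
exact: mweight_le1.
Qed.

(** The projection is specified on L2 only, so a e_alpha must be shown to lie there; it is almost
    everywhere bounded. *)
Lemma L2_toeplitz_symbol (a : 'cV[R[i]]_n -> R[i]) (al : 'cV[nat]_n) :
  Linf mu cball a -> L2 lam (fun z => a z * bergman_basis lam al z).
Proof.
move=> [ma [M aM]]; have [E [E0 eE]] := normc_bergman_basis_le al.
apply: (@L2_bounded _ (M * E)).
  by apply: cmeasurableM => //; apply: cmeasurableS; exact: cmeasurable_bergman_basis.
apply: filterS aM => z aM bz; rewrite ComplexField.Normc.normcM.
by rewrite ler_pM ?normc_ge0 ?aM ?eE.
Qed.

Lemma bergman_bergman_basis (al : 'cV[nat]_n) :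
  bergman lam (bergman_basis lam al : 'cV[R[i]]_n -> R[i]).
Proof.
split; last exact: holomorphic_bergman_basis.
have [E [E0 eE]] := normc_bergman_basis_le al.
apply: (@L2_bounded _ E); first exact: cmeasurableS (cmeasurable_bergman_basis al).
by apply: aeW => z bz; exact: eE.
Qed.

Lemma L2_integrable f : L2 lam f ->
  mu.-integrable cball (EFin \o (fun z => normc (f z) ^+ 2 * bergman_weight lam z)).
Proof.
move=> [mf ffin]; apply/integrableP; split.
  apply/measurable_EFinP; apply: measurable_funM.
    by apply: measurable_funX; exact: measurable_normc.
  by apply: measurable_funTS; exact: measurable_bergman_weight.
under eq_integral => z _.
  rewrite /= ger0_norm; last by rewrite mulr_ge0 ?sqr_ge0 ?bergman_weight_ge0.
  over.
exact: ffin.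
Qed.

(** The orthogonality of h - P h to g, once the integral of the difference is split; this is allowed
    since |h| |g| <= |h|^2 + |g|^2, and similarly for P h. *)
Lemma inner_projection P h g : bergman_projection lam P -> L2 lam h ->
  bergman lam g -> inner lam (P h) g = inner lam h g.
Proof.
move=> hP hh hg; have [[Ph2 _] /(_ g hg)] := hP h hh.
have [g2 _] := hg.
have mprod f : L2 lam f -> cmeasurable cball (fun z =>
    f z * conjc (g z) * (bergman_weight lam z)%:C).
  move=> [mf _]; apply: cmeasurableM.
    by apply: cmeasurableM => //; apply: cmeasurable_conjc; case: g2.
  apply: cmeasurable_real; apply: measurable_funTS; exact: measurable_bergman_weight.
have bound f z : cball z -> normc (f z * conjc (g z) * (bergman_weight lam z)%:C) <=
    normc (f z) ^+ 2 * bergman_weight lam z + normc (g z) ^+ 2 * bergman_weight lam z.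
  move=> _; rewrite !ComplexField.Normc.normcM normc_conjc normc_real.
  rewrite ger0_norm ?bergman_weight_ge0// -mulrDl ler_wpM2r ?bergman_weight_ge0//.
  have := normc_ge0 (f z); have := normc_ge0 (g z).
  by move: (normc (f z)) (normc (g z)) => x y; nra.
have iD f : L2 lam f -> mu.-integrable cball (EFin \o (fun z =>
    normc (f z) ^+ 2 * bergman_weight lam z + normc (g z) ^+ 2 * bergman_weight lam z)).
  move=> hf; have := integrableD measurable_cball (L2_integrable hf) (L2_integrable g2).
  by apply: eq_integrable; [exact: measurable_cball|move=> z _; rewrite /= EFinD].
rewrite /inner; under [in X in cintegral _ _ X = 0]eq_fun do rewrite !mulrBl.
rewrite (@cintegralB _ _ _ _ _ _ _
  (fun z => normc (h z) ^+ 2 * bergman_weight lam z + normc (g z) ^+ 2 * bergman_weight lam z)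
  (fun z => normc (P h z) ^+ 2 * bergman_weight lam z + normc (g z) ^+ 2 * bergman_weight lam z)).
- by move/eqP; rewrite subr_eq0 => /eqP ->.
- exact: measurable_cball.
- exact: mprod.
- exact: mprod.
- exact: iD.
- exact: iD.
- by move=> z; exact: bound.
- by move=> z; exact: bound.
Qed.

End weight.
End bergman_space.

(** * Matrix entries of the Toeplitz operator *)

Section block_identities.
Context {R : realType}.
Local Notation normc := ComplexField.Normc.normc.

Lemma mulc_real (x : R[i]) (r : R) :
  x * r%:C = (complex.Re x * r) +i* (complex.Im x * r).
Proof.
by case: x => a b; apply/eqP; rewrite eq_complex /= !mulr0 subr0 add0r !eqxx.
Qed.

Lemma conjc_realM (r : R) (x : R[i]) : conjc (r%:C * x) = r%:C * conjc x.
Proof.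
by case: x => a b; apply/eqP; rewrite eq_complex /= !mul0r !addr0 !subr0 mulrN !eqxx.
Qed.

Lemma mpow_scale n (c : R[i]) (z : 'cV[R[i]]_n) (a : 'cV[nat]_n) :
  mpow (c *: z) a = c ^+ mdeg a * mpow z a.
Proof.
rewrite /mpow /mdeg -prodrXr -big_split; apply: eq_bigr => i _ /=.
by rewrite !mxE exprMn.
Qed.

Lemma mpow_map_conjc n (z : 'cV[R[i]]_n) (a : 'cV[nat]_n) :
  mpow (map_mx conjc z) a = conjc (mpow z a).
Proof.
rewrite /mpow rmorph_prod; apply: eq_bigr => i _.
by rewrite !mxE rmorphXn.
Qed.

Lemma conjcM_normc (x : R[i]) : x * conjc x = (normc x ^+ 2)%:C.
Proof.
rewrite sqr_normcE; case: x => a b /=; apply/eqP; rewrite eq_complex /=.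
by rewrite !expr2 mulrN opprK eqxx /= mulrN addrC mulrC subrr.
Qed.

Lemma mpowM_conjc n (z : 'cV[R[i]]_n) (a : 'cV[nat]_n) :
  mpow z a * conjc (mpow z a) = (mweight a z)%:C.
Proof. by rewrite conjcM_normc normc_mpow. Qed.

Variables (m : nat) (k : 'I_m -> nat).
Implicit Types (z : 'cV[R[i]]_(\sum_(l < m) k l)) (a : 'cV[nat]_(\sum_(l < m) k l)).

Lemma mpow_blocks z a :
  mpow z a = \prod_(l < m) mpow (submxcol z l) (submxcol a l).
Proof.
rewrite /mpow big_Rank; apply: eq_bigr => l _; apply: eq_bigr => i _.
by rewrite !mxE.
Qed.

Lemma mdeg_blocks a : mdeg a = (\sum_(l < m) mdeg (submxcol a l))%N.
Proof.
rewrite /mdeg big_Rank; apply: eq_bigr => l _; apply: eq_bigr => i _.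
by rewrite mxE.
Qed.

Lemma mfact_blocks a : mfact a = (\prod_(l < m) mfact (submxcol a l))%N.
Proof.
rewrite /mfact big_Rank; apply: eq_bigr => l _; apply: eq_bigr => i _.
by rewrite mxE.
Qed.

Lemma rnorm_block_norms z : rnorm (block_norms z) = cnorm z.
Proof.
rewrite /rnorm -[RHS]ger0_norm ?cnorm_ge0// -sqrtr_sqr sqr_cnorm big_Rank.
congr Num.sqrt; apply: eq_bigr => l _.
by rewrite tnth_mktuple sqr_cnorm; apply: eq_bigr => i _; rewrite mxE.
Qed.

Lemma cnormZ n (c : R) (z : 'cV[R[i]]_n) : cnorm (c%:C *: z) = `|c| * cnorm z.
Proof.
rewrite /cnorm -sqrtr_sqr -sqrtrM ?sqr_ge0// mulr_sumr; congr Num.sqrt.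
apply: eq_bigr => i _; rewrite mxE ComplexField.Normc.normcM normc_real exprMn.
by rewrite real_normK ?num_real.
Qed.

Lemma csphere_block_direction j z : 0 < cnorm (submxcol z j) ->
  csphere (block_direction j z).
Proof.
move=> z0; rewrite /csphere/= /block_direction cnormZ ger0_norm ?invr_ge0 ?cnorm_ge0//.
by rewrite mulVf// gt_eqF.
Qed.

Lemma tau_ball_block_norms z : tau_ball (block_norms z) <-> cball z.
Proof.
rewrite /tau_ball/= rnorm_block_norms; split => [[]//|z1]; split => // l.
by rewrite tnth_mktuple cnorm_ge0.
Qed.

Lemma block_directionE j z : 0 < cnorm (submxcol z j) ->
  submxcol z j = (tnth (block_norms z) j)%:C *: block_direction j z.
Proof.
move=> z0; rewrite tnth_mktuple /block_direction scalerA -rmorphM/=.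
by rewrite mulfV ?gt_eqF// scale1r.
Qed.

(** Where this norm is positive, the direction of z_(j) is a unit vector and z_(j) is recovered from
    its norm and direction. *)
Lemma block_null j : (forall l, (0 < k l)%N) ->
  {ae lebesgue_cvec _, forall z, 0 < cnorm (submxcol z j)}.
Proof.
move=> k0.
(* Integrate the indicator function of r_j = 0 in polar coordinates. *)
pose H (q : rvec R m * 'cV[R[i]]_(k j)) := (1 - hpos (tnth q.1 j))%:E.
have mH : measurable_fun setT H.
  apply/measurable_EFinP; apply: measurable_funB => //.
  apply: (measurableT_comp measurable_hpos).
  exact: (measurableT_comp (measurable_tnth j) measurable_fst).
have H0 q : (0 <= H q)%E.
  by rewrite /H lee_fin hposE; case: ltP => _; rewrite ?subrr// subr0.
pose a0 : 'cV[nat]_(\sum_(l < m) k l) := const_mx 0%N.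
have := @ge0_integral_blocks R m k j a0 k0 (sphere_finite (k j)) H (fun _ _ => erefl) mH H0.
pose A := [set z : 'cV[R[i]]_(\sum_(l < m) k l) | ~ (0 < cnorm (submxcol z j))].
have mA : measurable A.
  rewrite (_ : A = (fun z : 'cV[R[i]]_(\sum_(l < m) k l) => cnorm (submxcol z j)) @^-1` `]-oo, 0]).
    rewrite -[X in measurable X]setTI.
    exact: (measurableT_comp (@measurable_cnorm R (k j)) (@measurable_submxcol R m k j)).
  by apply/seteqP; split => z; rewrite /A /= in_itv/= leNgt => /negP.
have -> : (\int[lebesgue_cvec _]_z (H (block_norms z, block_direction j z) *
    (outer_weight j a0 z)%:E) = lebesgue_cvec _ A)%E.
  transitivity (\int[@lebesgue_cvec R (\sum_(l < m) k l)]_z (\1_A z)%:E)%E; last first.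
    by rewrite integral_indic// setIT.
  have -> // : (fun z => H (block_norms z, block_direction j z) *
    (outer_weight j a0 z)%:E)%E = (fun z => (\1_A z)%:E).
  apply/funext => z; rewrite /outer_weight big1 ?mule1; last first.
    by move=> l _; rewrite /mweight big1// => i _; rewrite !mxE.
  rewrite /H /= tnth_mktuple hposE indicE; congr EFin.
  have [z0|z0] := ltP 0 (cnorm (submxcol z j)).
    by rewrite memNset ?subrr//= => /(_ z0).
  by rewrite mem_set ?subr0// /A/= => /(le_lt_trans z0); rewrite ltxx.
rewrite [X in _ = (_ * X)%E -> _]integral0_eq ?mule0; last first.
  move=> xi _; apply: integral0_eq => r _.
  rewrite /H /radial_density (bigD1 j)//= -EFinM hposE.
  by case: ltP => _; rewrite ?subrr ?mul0r ?mulr0.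
move=> A0; apply: (@negligibleS _ _ _ _ A); last first.
  by apply/negligibleP.
by move=> z.
Qed.

End block_identities.

(** * Powers of the radii and the constant of the formula *)

Section assembly.
Context {R : realType} {m : nat} (k : 'I_m -> nat) (j : 'I_m).
Hypothesis k_gt0 : forall l, (0 < k l)%N.
Variable alpha : 'cV[nat]_(\sum_(l < m) k l).
Local Notation D := (@tau_ball R m `*` @csphere R (k j)).

Lemma measurable_tau_ball : measurable (@tau_ball R m).
Proof.
rewrite (_ : tau_ball = (\bigcap_(l : 'I_m) [set r : rvec R m | 0 <= tnth r l]) `&`
  [set r : rvec R m | rnorm r < 1]); last first.
  apply/seteqP; split => r [r0 r1]; split => // l; first by move=> _; exact: r0.
  exact: r0.
apply: measurableI.
  apply: fin_bigcap_measurable => // l _.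
  rewrite (_ : [set r | _] = (fun r : rvec R m => tnth r l) @^-1` `[0, +oo[).
    by rewrite -[X in measurable X]setTI; exact: measurable_tnth.
  by apply/seteqP; split => r /=; rewrite in_itv/= andbT.
rewrite (_ : [set r | _] = @rnorm R m @^-1` `]-oo, 1[).
  rewrite -[X in measurable X]setTI.
  have mS : measurable_fun setT (@rnorm R m : _ -> measurableTypeR R).
    apply: (@measurableT_comp _ _ _ _ _ _ (@Num.sqrt R)); last exact: measurable_rsqnorm.
    by apply: continuous_measurable_fun; exact: sqrt_continuous.
  exact: mS.
by apply/seteqP; split => r /=; rewrite in_itv.
Qed.

Lemma measurable_tau_sphere : measurable D.
Proof. exact: measurableX measurable_tau_ball (@measurable_csphere R (k j)). Qed.

(** Scaling acts on the positive and negative parts separately, also when both integrals are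
    infinite; c = 0 is apart because of the convention 0 * +oo = 0. *)
Lemma integral_ge0Zl d (T : measurableType d) (mu : {measure set T -> \bar R})
    (c : R) (u : T -> R) : measurable_fun setT u -> 0 <= c ->
  (\int[mu]_x (c * u x)%:E = c%:E * \int[mu]_x (u x)%:E)%E.
Proof.
move=> mu_; rewrite le_eqVlt => /predU1P[<-|c0].
  by rewrite mul0e integral0_eq// => x _; rewrite mul0r.
have mEu : measurable_fun setT (EFin \o u) by exact/measurable_EFinP.
rewrite integralE [in RHS]integralE muleBr_gt0 ?integral_ge0//.
congr (_ - _)%E; rewrite -ge0_integralZl ?lee_fin ?(ltW c0)//.
- apply: eq_integral => x _; rewrite !funeposE maxe_pMr ?lee_fin ?(ltW c0)//.
  by rewrite mule0 EFinM.
- exact: measurable_funepos.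
- apply: eq_integral => x _; rewrite !funenegE maxe_pMr ?lee_fin ?(ltW c0)//.
  by rewrite mule0 EFinM muleN.
- exact: measurable_funeneg.
Qed.

Lemma fineM_ge0 (c : R) (x : \bar R) : 0 <= c -> fine (c%:E * x)%E = c * fine x.
Proof.
rewrite le_eqVlt => /predU1P[<-|c0]; first by rewrite mul0e mul0r.
case: x => [x||] //=.
- by rewrite gt0_muley ?lte_fin//= mulr0.
- by rewrite gt0_muleNy ?lte_fin//= mulr0.
Qed.

(** Extension of [h] by zero trades one domain for the other: the block norms of z lie in [tau_ball]
    exactly when z lies in the ball. *)
Lemma Rintegral_blocks (h : rvec R m * 'cV[R[i]]_(k j) -> R) (K : R) :
  0 <= K -> measurable_fun D h ->
  \int[lebesgue_cvec _]_(z in cball)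
    (K * ((h \_ D) (block_norms z, block_direction j z) * outer_weight j alpha z)) =
  K * outer_const j alpha *
  \int[(lebesgue_rvec m \x^ sphere_cvec (k j))%E]_(q in D)
    (h q * radial_density (outer_power j alpha) q.1).
Proof.
move=> K0 mh; have mD := measurable_tau_sphere.
have mhD : measurable_fun setT (h \_ D) by apply/(measurable_restrictT _ mD).
rewrite /Rintegral -mulrA -[X in _ = K * (X * _)]/(fine (outer_const j alpha)%:E).
transitivity (fine (\int[lebesgue_cvec (\sum_(l < m) k l)]_z
    (K * ((h \_ D) (block_norms z, block_direction j z) * outer_weight j alpha z))%:E)%E).
  congr fine; rewrite integral_mkcond; apply: eq_integral => z _.
  rewrite patchE; case: ifPn => // /negP nz; rewrite [(h \_ D) _]patchE memNset ?mul0r ?mulr0//.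
  by move=> [/= /tau_ball_block_norms bz _]; apply: nz; exact/mem_set.
have mPhi : measurable_fun setT (fun z : 'cV[R[i]]_(\sum_(l < m) k l) =>
    (h \_ D) (block_norms z, block_direction j z) * outer_weight j alpha z).
  apply: measurable_funM; last exact: measurable_outer_weight.
  apply: (measurableT_comp mhD); apply: measurable_fun_pair.
    exact: measurable_block_norms.
  exact: measurable_block_direction.
rewrite integral_ge0Zl// fineM_ge0//; congr *%R.
rewrite integral_blocks// fineM_ge0 ?ltW ?outer_const_gt0//; congr (_ * fine _).
rewrite [RHS]integral_mkcond; apply: eq_integral => q _.
by rewrite !patchE; case: ifP; rewrite ?mul0r.
Qed.

Local Notation kap l := (mdeg (submxcol alpha l)).

Lemma radial_density_tau (r : rvec R m) : tau_ball r ->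
  \prod_(l < m) tnth r l ^+ (2 * k l + 2 * kap l - 1) =
  tnth r j ^+ (kap j).*2 * radial_density (outer_power j alpha) r.
Proof.
move=> [r0 _].
(* [tau_ball] allows r_l = 0, where [hpos] vanishes; the power vanishes there too since p > 0. *)
have E l p : (0 < p)%N -> hpos (tnth r l) * tnth r l ^+ p = tnth r l ^+ p.
  move=> p0; rewrite hposE; have := r0 l; rewrite le_eqVlt => /predU1P[<-|->].
    by rewrite ltxx expr0n gtn_eqF// mulr0.
  by rewrite mul1r.
have k2 l : (0 < (k l).*2.-1)%N by case: (k l) (k_gt0 l).
rewrite /radial_density (bigD1 j)//= [in RHS](bigD1 j)//= mulrA; congr *%R.
  rewrite /outer_power eqxx addn0 E// -exprD; congr (_ ^+ _).
  by have := k_gt0 j; lia.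
apply: eq_bigr => l /negbTE lj; rewrite /outer_power lj E; last by rewrite ltn_addr.
by congr (_ ^+ _); have := k_gt0 l; lia.
Qed.

(** The normalizations of e_alpha and e_beta together contribute 1 / Gamma(n + lam + 1), which
    cancels against [bergman_const], and the product of alpha_(l)! over l != j in the denominator,
    which cancels against the sphere moments. Those m - 1 moments leave 2^(m-1), the factorials (k_l
    + kappa_l - 1)!, and all powers of pi but pi^(k_j). *)
Lemma constant_identity (beta : 'cV[nat]_(\sum_(l < m) k l)) (lam : R) :
  -1 < lam -> (forall l, l != j -> submxcol alpha l = submxcol beta l) ->
  mdeg alpha = mdeg beta ->
  let n := (\sum_(l < m) k l)%N in
  let c (a : 'cV[nat]_(\sum_(l < m) k l)) := Num.sqrt (Gamma (n%:R + lam + (mdeg a)%:R + 1) /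
             ((mfact a)%:R * Gamma (n%:R + lam + 1))) in
  c alpha * c beta * @bergman_const R n lam * outer_const j alpha =
  2 ^+ m.-1 * Gamma (n%:R + lam + (mdeg alpha)%:R + 1) /
   (pi ^+ k j * Gamma (lam + 1) *
    Num.sqrt ((mfact (submxcol alpha j))%:R * (mfact (submxcol beta j))%:R) *
    \prod_(l < m | l != j) ((k l + kap l - 1)`!)%:R).
Proof.
move=> lam1 hab degE n c.
set X := Gamma (n%:R + lam + (mdeg alpha)%:R + 1).
set g := Gamma (n%:R + lam + 1).
have n1 : (1 <= n)%N by rewrite /n (bigD1 j)//= ltn_addr.
have g0 : 0 < g.
  apply: Gamma_gt0; have : (1%:R : R) <= n%:R by rewrite ler_nat.
  by move: lam1; lra.
have X0 : 0 <= X by exact: Gamma_ge0.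
have fact_neq0 p (b : 'cV[nat]_p) : ((mfact b)%:R : R) != 0.
  by rewrite pnatr_eq0 -lt0n prodn_gt0// => i; exact: fact_gt0.
set P : R := \prod_(l < m | l != j) (mfact (submxcol alpha l))%:R.
have P0 : 0 < P.
  by apply: prodr_gt0 => l _; rewrite lt0r ler0n andbT; exact: fact_neq0.
set x : R := (mfact (submxcol alpha j))%:R.
set y : R := (mfact (submxcol beta j))%:R.
have xy0 : 0 < x * y.
  by rewrite mulr_gt0// lt0r ler0n andbT; exact: fact_neq0.
have aE : (mfact alpha)%:R = x * P :> R.
  by rewrite mfact_blocks (bigD1 j)//= natrM natr_prod.
have bE : (mfact beta)%:R = y * P :> R.
  rewrite mfact_blocks (bigD1 j)//= natrM natr_prod; congr *%R.
  by apply: eq_bigr => l lj; rewrite hab.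
have x0 : 0 < x by rewrite lt0r ler0n andbT; exact: fact_neq0.
have y0 : 0 < y by rewrite lt0r ler0n andbT; exact: fact_neq0.
(* Equal degrees give equal Gamma factors, and the blocks l != j have equal factorials; only the
   factorials of block [j] stay under the root. *)
have -> : c alpha * c beta = X / (g * P * Num.sqrt (x * y)).
  rewrite /c -degE aE bE -/X -/g -sqrtrM; last first.
    by rewrite divr_ge0// mulr_ge0 ?(ltW g0)// mulr_ge0 ?ltW.
  rewrite (_ : X / (x * P * g) * (X / (y * P * g)) =
    (X / (g * P * Num.sqrt (x * y))) ^+ 2); last first.
    rewrite exprMn exprVn !exprMn sqr_sqrtr ?(ltW xy0)//; field.
    by rewrite !gt_eqF.
  rewrite sqrtr_sqr ger0_norm// divr_ge0// mulr_ge0 ?sqrtr_ge0//.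
  by rewrite mulr_ge0 ?ltW.
have -> : outer_const j alpha = 2 ^+ m.-1 * (\prod_(l < m | l != j) pi ^+ k l) * P /
    \prod_(l < m | l != j) ((k l + kap l - 1)`!)%:R.
  rewrite /outer_const big_split prodfV; congr (_ / _); last first.
    by apply: eq_bigr => l _; congr (_`!%:R); have := k_gt0 l; lia.
  rewrite !big_split/= prodr_const mulrA; congr (_ ^+ _ * _ * _).
  by rewrite cardC1 card_ord.
have piE : pi ^+ n = pi ^+ k j * \prod_(l < m | l != j) pi ^+ k l :> R.
  by rewrite /n -prodrXr (bigD1 j).
rewrite /bergman_const piE -/g.
set Q := \prod_(l < m | l != j) pi ^+ k l.
have Q0 : 0 < Q by apply: prodr_gt0 => l _; rewrite exprn_gt0// pi_gt0.
set F := \prod_(l < m | _) _.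
have F0 : F != 0.
  by apply/prodf_neq0 => l _; rewrite pnatr_eq0 -lt0n fact_gt0.
have s0 : 0 < Num.sqrt (x * y) by rewrite sqrtr_gt0.
have p0 : 0 < pi ^+ k j :> R by rewrite exprn_gt0// pi_gt0.
(* The inverse of [Gamma (lam + 1)] occurs once on each side and is treated as a letter. *)
rewrite !invfM; set G := (Gamma (lam + 1))^-1.
field.
by rewrite F0 !gt_eqF.
Qed.

End assembly.

(** This rearrangement and the next two are stated in an abstract ring, with letters in place of the
    large complex expressions of the integrand. *)
Lemma basis_product_regroup (S : comPzRingType) (a c1 x c2 y w : S) :
  a * (c1 * x) * (c2 * y) * w = a * (x * y) * (c1 * c2 * w).
Proof. ring. Qed.

Lemma integrand_regroup (S : comPzRingType) (a r x y w c : S) :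
  a * (r * (x * y) * w) * c = a * x * y * (r * w * c).
Proof. ring. Qed.

Lemma weight_regroup (S : comPzRingType) (r o c1 c2 b w : S) :
  r * o * (c1 * c2 * (b * w)) = c1 * c2 * b * (w * r * o).
Proof. ring. Qed.

Theorem corollary7p4 (R : realType) (m : nat) (k : 'I_m -> nat) (j : 'I_m)
  (lam : R)
  (B : ('cV[R[i]]_(\sum_(l < m) k l) -> R[i]) ->
       ('cV[R[i]]_(\sum_(l < m) k l) -> R[i]))
  (a : 'cV[R[i]]_(\sum_(l < m) k l) -> R[i])
  (f : rvec R m * 'cV[R[i]]_(k j) -> R[i])
  (hm : (2 <= m)%N) (hk : forall l, (0 < k l)%N) (hlam : -1 < lam)
  (hB : bergman_projection lam B)
  (ha : Linf (lebesgue_cvec _) cball a)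
  (haU : quasi_radial_homogeneous j a)
  (hf : Linf (lebesgue_rvec m \x^ sphere_cvec (k j))%E
          (tau_ball `*` csphere) f)
  (hfT : forall (r : rvec R m) (xi : 'cV[R[i]]_(k j)) (eta : R[i]),
     tau_ball r -> csphere xi -> `|eta| = 1 -> f (r, eta *: xi) = f (r, xi))
  (haf : {ae lebesgue_cvec _, forall z, cball z ->
     a z = f (block_norms z, block_direction j z)})
  (kappa : 'I_m -> nat) (alpha beta : 'cV[nat]_(\sum_(l < m) k l))
  (halpha : forall l, mdeg (submxcol alpha l) = kappa l)
  (hbeta : forall l, mdeg (submxcol beta l) = kappa l)
  (hab : forall l, l != j -> submxcol alpha l = submxcol beta l) :
  inner lam (toeplitz B a (bergman_basis lam alpha)) (bergman_basis lam beta) =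
  (2 ^+ m.-1 *
     Gamma ((\sum_(l < m) k l)%N%:R + lam + (\sum_(l < m) kappa l)%N%:R + 1) /
   (pi ^+ k j * Gamma (lam + 1) *
    Num.sqrt ((mfact (submxcol alpha j))%:R * (mfact (submxcol beta j))%:R) *
    \prod_(l < m | l != j) ((k l + kappa l - 1)`!)%:R))%:C *
  cintegral (lebesgue_rvec m \x^ sphere_cvec (k j))%E (tau_ball `*` csphere)
    (fun p => f p * mpow p.2 (submxcol alpha j) *
       mpow (map_mx conjc p.2) (submxcol beta j) *
       ((1 - rnorm p.1 ^+ 2) `^ lam *
        \prod_(l < m) tnth p.1 l ^+ (2 * k l + 2 * kappa l - 1))%:C).
Proof.
have kE : kappa = fun l => mdeg (submxcol alpha l).
  by apply/funext => l; rewrite halpha.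
subst kappa => {halpha}.
have N0 : (0 < \sum_(l < m) k l)%N by rewrite (bigD1 j)//= ltn_addr.
have degE : mdeg alpha = mdeg beta.
  by rewrite !mdeg_blocks; apply: eq_bigr => l _; rewrite -hbeta.
pose D : set (rvec R m * 'cV[R[i]]_(k j)) := tau_ball `*` csphere.
have mD : measurable D := @measurable_tau_sphere R m k j.
pose G (q : rvec R m * 'cV[R[i]]_(k j)) := f q * mpow q.2 (submxcol alpha j) *
  mpow (map_mx conjc q.2) (submxcol beta j).
(* The power of r_j comes from z_(j)^alpha_(j) times the conjugate of z_(j)^beta_(j): both degrees
   are kappa_j, which gives r_j^(2 kappa_j) besides the monomials in xi_(j) kept in [G]. *)
pose rho (r : rvec R m) := (1 - rnorm r ^+ 2) `^ lam *
  tnth r j ^+ (mdeg (submxcol alpha j)).*2.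
have mrho : measurable_fun setT (fun q : rvec R m * 'cV[R[i]]_(k j) => rho q.1).
  have mr : measurable_fun setT rho.
    apply: measurable_funM; last by apply: measurable_funX; exact: measurable_tnth.
    apply: (measurableT_comp (measurable_powR lam)); apply: measurable_funB => //.
    apply: measurable_funX.
    apply: (@measurableT_comp _ _ _ _ _ _ (@Num.sqrt R)); last exact: measurable_rsqnorm.
    by apply: continuous_measurable_fun; exact: sqrt_continuous.
  exact: (measurableT_comp mr measurable_fst).
have cG : cmeasurable D G.
  have cmp (a0 : 'cV[nat]_(k j)) :
      cmeasurable D (fun q : rvec R m * 'cV[R[i]]_(k j) => mpow q.2 a0).
    have [mr mi] := cmeasurable_mpow (R := R) a0.
    apply: cmeasurableS; split.
      exact: (measurableT_comp mr measurable_snd).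
    exact: (measurableT_comp mi measurable_snd).
  apply: cmeasurableM; first by apply: cmeasurableM => //; case: hf.
  under eq_fun do rewrite mpow_map_conjc.
  exact: cmeasurable_conjc.
have [mGr mGi] := cG.
pose hR q := complex.Re (G q) * rho q.1.
pose hI q := complex.Im (G q) * rho q.1.
have mhR : measurable_fun D hR.
  by apply: measurable_funM => //; exact: measurable_funTS.
have mhI : measurable_fun D hI.
  by apply: measurable_funM => //; exact: measurable_funTS.
pose n := (\sum_(l < m) k l)%N.
pose c (al : 'cV[nat]_n) : R := Num.sqrt (Gamma (n%:R + lam + (mdeg al)%:R + 1) /
  ((mfact al)%:R * Gamma (n%:R + lam + 1))).
pose K : R := c alpha * c beta * bergman_const (n := n) lam.
have bc0 : 0 <= @bergman_const R n lam.
  by rewrite divr_ge0 ?Gamma_ge0// mulr_ge0 ?Gamma_ge0// exprn_ge0 ?pi_ge0.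
have c0 al : 0 <= c al by exact: sqrtr_ge0.
have K0 : 0 <= K := mulr_ge0 (mulr_ge0 (c0 _) (c0 _)) bc0.
pose Phi (z : 'cV[R[i]]_n) := (block_norms z, block_direction j z).
(* The integrand of the inner product, brought almost everywhere into the form to which
   [Rintegral_blocks] applies. *)
pose J (z : 'cV[R[i]]_n) : R[i] :=
  (K * ((hR \_ D) (Phi z) * outer_weight j alpha z)) +i*
  (K * ((hI \_ D) (Phi z) * outer_weight j alpha z)).
(* The projection disappears here: the entry becomes the inner product of a e_alpha with e_beta. *)
rewrite (inner_projection hB (L2_toeplitz_symbol hlam N0 alpha ha)
  (bergman_bergman_basis hlam N0 beta)).
rewrite /inner (@eq_cintegral _ _ _ _ _ _ J); last first.
(* Two null sets are discarded: the one where a differs from its expression through f, and the one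
   where z_(j) = 0. *)
- apply: filterS2 haf (@block_null R m k j hk) => z az zj bz.
  have DPhi : D (Phi z).
    by split => /=; [exact/tau_ball_block_norms|exact: csphere_block_direction].
  have GE : mpow z alpha * conjc (mpow z beta) =
      (tnth (block_norms z) j ^+ (mdeg (submxcol alpha j)).*2)%:C *
      (mpow (block_direction j z) (submxcol alpha j) *
       conjc (mpow (block_direction j z) (submxcol beta j))) *
      (outer_weight j alpha z)%:C.
    (* In the blocks l != j the exponents of alpha and beta coincide and the product is
       |z_(l)^alpha_(l)|^2; in block [j] the radius is separated from the direction. *)
    rewrite !mpow_blocks rmorph_prod -big_split (bigD1 j)//=; congr (_ * _); last first.
      rewrite rmorph_prod; apply: eq_bigr => l lj.
      by rewrite -hab// mpowM_conjc.
    move: (block_directionE zj); move: (block_direction j z) => xi ->.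
    rewrite !mpow_scale -hbeta rmorphM /= -!(rmorphXn (real_complex R)) conjc_real.
    by rewrite -addnn exprD rmorphM /= mulrACA.
  rewrite /J !patchE (mem_set DPhi) az// /bergman_basis. rewrite conjc_realM.
  transitivity (G (Phi z) * (K * (rho (block_norms z) * outer_weight j alpha z))%:C).
    rewrite basis_product_regroup GE integrand_regroup -!rmorphM -mpow_map_conjc.
    congr (_ * _%:C).
    rewrite /K /c /rho /bergman_weight rnorm_block_norms.
    exact: weight_regroup.
  rewrite mulc_real /hR /hI.
  by congr (_ +i* _); rewrite mulrCA !mulrA.
- have mW := @measurable_outer_weight R m k j alpha.
  have mP (h : rvec R m * 'cV[R[i]]_(k j) -> R) : measurable_fun D h -> measurable_fun setT (fun z => (h \_ D) (Phi z)).
    move=> mh; have mhD : measurable_fun setT (h \_ D) by apply/(measurable_restrictT _ mD).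
    apply: (measurableT_comp mhD); apply: measurable_fun_pair.
      exact: measurable_block_norms.
    exact: measurable_block_direction.
  split; apply: measurable_funTS; apply: measurable_funM => //;
    apply: measurable_funM => //; exact: mP.
- have mb := cmeasurable_bergman_basis (R := R) lam.
  apply: cmeasurableM.
    apply: cmeasurableM.
      apply: cmeasurableM; first by case: ha.
      exact: cmeasurableS.
    by apply: cmeasurable_conjc; exact: cmeasurableS.
  by apply: cmeasurable_real; apply: measurable_funTS; exact: measurable_bergman_weight.
- exact: measurable_cball.
rewrite /cintegral /J.
rewrite (Rintegral_blocks hk alpha K0 mhR) (Rintegral_blocks hk alpha K0 mhI).
have KC : K * outer_const j alpha = 2 ^+ m.-1 *
     Gamma (n%:R + lam + (\sum_(l < m) mdeg (submxcol alpha l))%N%:R + 1) /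
   (pi ^+ k j * Gamma (lam + 1) *
    Num.sqrt ((mfact (submxcol alpha j))%:R * (mfact (submxcol beta j))%:R) *
    \prod_(l < m | l != j) ((k l + mdeg (submxcol alpha l) - 1)`!)%:R).
  rewrite -mdeg_blocks; exact: constant_identity.
rewrite -KC.
(* On the domain, [rho] and [radial_density] recombine into the powers 2 k_l + 2 kappa_l - 1 of the
   formula, real and imaginary parts being taken apart. *)
have RE q : D q -> f q * mpow q.2 (submxcol alpha j) *
    mpow (map_mx conjc q.2) (submxcol beta j) *
    ((1 - rnorm q.1 ^+ 2) `^ lam *
     \prod_(l < m) tnth q.1 l ^+ (2 * k l + 2 * mdeg (submxcol alpha l) - 1))%:C =
  (hR q * radial_density (outer_power j alpha) q.1) +i*
  (hI q * radial_density (outer_power j alpha) q.1).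
  move=> [rq xq]; rewrite (radial_density_tau j hk alpha rq) mulc_real -/(G q).
  by rewrite /hR /hI /rho !mulrA.
have cE (x y z : R) : (x * y) +i* (x * z) = x%:C * (y +i* z).
  by apply/eqP; rewrite eq_complex /= !mul0r subr0 addr0 !eqxx.
rewrite cE; congr (_ * (_ +i* _)).
- by apply: eq_Rintegral => q /set_mem Dq; rewrite RE.
- by apply: eq_Rintegral => q /set_mem Dq; rewrite RE.
Qed.
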